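(* Let $1<\beta\le 2$. Assume that $\theta_0\in L^2(\mathbb{T}^2)$ has mean zero, namely $\int_{\mathbb{T}^2} \theta_0(x)\, dx =0$. Then the active scalar equation on $\mathbb{T}^2$ $$\partial_t \theta + u\cdot\nabla \theta =0,\qquad u= \nabla^\perp \psi,\qquad \Delta \psi =\Lambda^\beta\theta$$ with initial data $\theta_0$ has a global weak solution, i.e. there is a function $\theta$ on $\mathbb{T}^2\times[0,\infty)$ which, for every $T>0$, is a weak solution on $[0,T]$ with initial data $\theta_0$.
   Context: $\mathbb{T}^2$ is the 2D periodic box, $\nabla^\perp=(-\partial_{x_2},\partial_{x_1})$, and $\Lambda=(-\Delta)^{1/2}$, with $\widehat{\Lambda^s f}(k)=|k|^s\widehat f(k)$ on Fourier coefficients; negative powers act on mean-zero functions, and $\psi$ is taken with mean zero, so $-|k|^2\widehat\psi(k)=|k|^\beta\widehat\theta(k)$ for $k\neq0$. Weak solution: let $T>0$. A function $\theta \in L^\infty([0,T];L^2(\mathbb{T}^2))$ is a weak solution with initial data $\theta_0$ if, for any test function $\phi\in C^\infty_c([0,T)\times\mathbb{T}^2)$, $$ \int_0^T \int_{\mathbb{T}^2} \theta\, (\partial_t\phi + u\cdot\nabla \phi)\, dx\,dt = -\int_{\mathbb{T}^2}\theta_0(x)\, \phi(x,0)\,dx . $$ Since $u$ is more singular than $\theta$, the nonlinear term is understood through the commutator form to which it is equal for smooth mean-zero $\theta$: $$\int_{\mathbb{T}^2}\theta\,u\cdot\nabla\phi\,dx=-\frac12\int_{\mathbb{T}^2}\psi\,\left[\Lambda^{2-\beta}\nabla^\perp\cdot,\nabla\phi\right]\psi\,dx,$$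 where $\left[\Lambda^{2-\beta}\nabla^\perp\cdot,\nabla\phi\right]\psi=\Lambda^{2-\beta}\nabla^\perp\cdot(\psi\nabla\phi)-\nabla\phi\cdot\Lambda^{2-\beta}\nabla^\perp\psi$; this is well defined for mean-zero $\theta\in L^2(\mathbb{T}^2)$. *)

(* Defs.v *)
From HB Require Import structures.
From mathcomp Require Import all_boot all_order all_algebra.
From mathcomp Require Import all_classical all_reals all_analysis.
From mathcomp Require Import complex.

Set Implicit Arguments.
Unset Strict Implicit.
Unset Printing Implicit Defensive.

Import Order.TTheory GRing.Theory Num.Theory.
Import numFieldTopology.Exports numFieldNormedType.Exports.

Local Open Scope classical_set_scope.
Local Open Scope ring_scope.
Local Open Scope complex_scope.

(* The torus has side 2 pi, so its frequencies are the points k of Z^2, and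
   |k| is the Euclidean norm.  A function in L^2 of the torus is represented by
   its values on the box [0, 2 pi]^2; its values outside the box are ignored.
   Test functions are 2 pi-periodic functions on R^2. *)
Section Torus.
Context {R : realType}.
Local Notation mR := (measurableTypeR R).
Implicit Types (f g theta psi C : R * R -> R) (k : int * int).

Definition box : set (R * R) := `[0, 2 * pi] `*` `[0, 2 * pi].

Definition leb2 : {measure set (mR * mR) -> \bar R} :=
  (@lebesgue_measure R \x @lebesgue_measure R)%E.

Definition int_box f : R := \int[leb2]_(x in box) f x.

Definition norm2 f : \bar R := 'N[leb2]_2%:E[EFin \o (f \_ box)]%E.

Definition L2 f : Prop := f \_ box \in Lfun leb2 2%:E.

Definition mean_zero f : Prop := int_box f = 0.

Definition fourier f k : R[i] :=
  let kx (x : R * R) : R := k.1%:~R * x.1 + k.2%:~R * x.2 in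
  (((2 * pi) ^+ 2)^-1)%:C *
    (int_box (fun x => f x * cos (kx x)) -i* int_box (fun x => f x * sin (kx x))).

(* A periodic distribution is given by its Fourier coefficients. *)
Definition pdistr := int * int -> R[i].
Implicit Types a b : pdistr.

Definition freq_norm k : R := Num.sqrt (k.1%:~R ^+ 2 + k.2%:~R ^+ 2).

Definition Lam (s : R) a : pdistr := fun k => (freq_norm k `^ s)%:C * a k.

Definition Lapl a : pdistr := fun k => - (freq_norm k ^+ 2)%:C * a k.

Definition dx1 a : pdistr := fun k => 'i%C * k.1%:~R * a k.
Definition dx2 a : pdistr := fun k => 'i%C * k.2%:~R * a k.

Definition perp_div a b : pdistr := fun k => - dx2 a k + dx1 b k.

(* Coefficients of the product of a smooth function and a distribution: the
   convolution of their coefficients, which converges absolutely. *)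
Definition pmul a b : pdistr := fun k =>
  let square n : (R[i] : numFieldType) :=
    \sum_(i < n.*2.+1) \sum_(j < n.*2.+1)
      let l : int * int := (i%:Z - n%:Z, j%:Z - n%:Z) in a (k - l) * b l in
  limn square.

(* [Lam^(2 - beta) gradperp . , v] psi, where v = (v1, v2) *)
Definition commutator (beta : R) (v1 v2 : R * R -> R) psi : pdistr := fun k =>
  Lam (2 - beta) (perp_div (fourier (psi \* v1)) (fourier (psi \* v2))) k
  - (pmul (fourier v1) (Lam (2 - beta) (fun l => - dx2 (fourier psi) l)) k
     + pmul (fourier v2) (Lam (2 - beta) (dx1 (fourier psi))) k).

(* Lapl psi = Lam^beta theta; both sides vanish at k = 0 when beta > 0. *)
Definition stream (beta : R) theta psi : Prop :=
  [/\ L2 psi, mean_zero psi &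
      forall k, k != 0 -> Lapl (fourier psi) k = Lam beta (fourier theta) k].

(* v is the value of the integral of theta u . grad phi, understood through
   the commutator form; psi and the square integrable function C with the
   Fourier coefficients of the commutator are unique up to null sets. *)
Definition nonlinear_value (beta : R) theta (grad1 grad2 : R * R -> R) (v : R)
    : Prop :=
  exists psi C, [/\ stream beta theta psi, L2 C,
    forall k, fourier C k = commutator beta grad1 grad2 psi k &
    v = - 2^-1 * int_box (psi \* C)].

End Torus.

Section WeakSolution.
Context {R : realType}.
Local Notation mR := (measurableTypeR R).

Definition dt (phi : R * (R * R) -> R) : R * (R * R) -> R :=
  'D_((1, (0, 0)) : R * (R * R)) phi.
Definition d1 (phi : R * (R * R) -> R) : R * (R * R) -> R :=
  'D_((0, (1, 0)) : R * (R * R)) phi.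
Definition d2 (phi : R * (R * R) -> R) : R * (R * R) -> R :=
  'D_((0, (0, 1)) : R * (R * R)) phi.

Definition smooth (phi : R * (R * R) -> R) : Prop :=
  forall (vs : seq (R * (R * R))) z,
    differentiable (foldr (fun v g => 'D_v g) phi vs) z.

(* Smooth functions on [0, T) x T^2 up to t = 0 are the restrictions of smooth
   functions on R x T^2. *)
Definition test_function (T : R) (phi : R * (R * R) -> R) : Prop :=
  [/\ smooth phi,
      forall t x1 x2, phi (t, (x1 + 2 * pi, x2)) = phi (t, (x1, x2)),
      forall t x1 x2, phi (t, (x1, x2 + 2 * pi)) = phi (t, (x1, x2)) &
      exists2 T', T' < T & forall t x, T' <= t -> phi (t, x) = 0].

Definition at_time (f : R * (R * R) -> R) (t : R) : R * R -> R :=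
  fun x => f (t, x).

Definition Linfty_L2 (T : R) (theta : R * (R * R) -> R) : Prop :=
  measurable_fun (`[0, T] `*` box : set (mR * (mR * mR))) theta /\
  exists M : R, \forall t \ae (@lebesgue_measure R), t \in `[0, T] ->
    (norm2 (at_time theta t) <= M%:E)%E.

(* The nonlinear term requires theta(t) to have mean zero. *)
Definition weak_solution (beta T : R) (theta0 : R * R -> R)
    (theta : R * (R * R) -> R) : Prop :=
  [/\ Linfty_L2 T theta,
      \forall t \ae (@lebesgue_measure R), t \in `[0, T] ->
        mean_zero (at_time theta t) &
      forall phi, test_function T phi -> exists N : R -> R,
        [/\ \forall t \ae (@lebesgue_measure R), t \in `[0, T] ->
              nonlinear_value beta (at_time theta t)
                (at_time (d1 phi) t) (at_time (d2 phi) t) (N t),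
            (@lebesgue_measure R).-integrable `[0, T] (EFin \o N) &
            \int[@lebesgue_measure R]_(t in `[0, T])
              (int_box (at_time theta t \* at_time (dt phi) t) + N t)
            = - int_box (theta0 \* at_time phi 0)]].

End WeakSolution.

(* Main.v *)
(* With s = 2 - beta, the Fourier coefficients a_k of a solution satisfy
   a_k' = sum over l + m = k of - (l x m) (|l|^-s - |m|^-s) a_l a_m / 2.
   The kernel is at most |k|^2 min(|l|^-s, |m|^-s), so for fixed k the right-hand
   side converges on bounded sets of l^2, and its tail over high frequencies is
   uniformly small when s > 0 (for s = 0 the kernel vanishes).  The truncated
   system conserves the l^2 norm, and an explicit Euler scheme with a sufficiently
   fine step almost does.  The limit of these schemes along an ultrafilter exists
   coefficient by coefficient; by the uniform tail bound it solves the infinite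
   system with an l^2 bound, and theta (t, .) is the function with coefficients
   a (t).

   For the weak formulation, the commutator applied to psi has coefficients
   - sum_l (k x (k - l)) (|k|^s - |l|^s) psi_l phi_{k - l}, bounded by
   sum_l |k - l|^2 |phi_{k - l}| |a_l|, hence square summable by Young's inequality.
   Regrouping finite sums and dominated convergence identify its pairing with psi
   as the sum of a_m' against the conjugate of phi_m, and integration in time is
   done mode by mode.  The initial condition needs the completeness of the
   exponentials, which is proved for smooth functions by telescoping (Chernoff). *)
Require Import Defs.
From mathcomp Require Import all_boot all_order all_algebra.
From mathcomp Require Import all_classical all_reals all_analysis.
From mathcomp Require Import measurable_realfun complex ring lra zify.

Import Order.TTheory GRing.Theory Num.Theory.
Import numFieldTopology.Exports numFieldNormedType.Exports.
Local Open Scope classical_set_scope.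
Local Open Scope ring_scope.
Set Implicit Arguments.
Unset Strict Implicit.
Unset Printing Implicit Defensive.

(** * Sums over the frequency lattice *)

(** Passing to the limit in a quadratic term usually asks for strong compactness of the
    approximations. Here the symmetrized kernel spares it: a uniform tail bound makes the quadratic
    term continuous under coefficientwise convergence of l^2-bounded families. The condition beta >
    1 enters as s <= 1, where t^s lies between 1 and t, so that differences of powers of frequencies
    are controlled by differences of frequencies. Two further obstacles shape the text. Coefficients
    determine a function at each time only up to a null set, whereas theta must be measurable
    jointly in (t, x); the Riesz-Fischer subsequence is therefore an explicit function of the
    coefficients. And [theta0] is an arbitrary square integrable function, not the representative
    built from its coefficients, so the initial term rests on the convergence of the Fourier series
    of the smooth factor. *)

Section Squares.

(** Squares are the truncations used almost everywhere; rectangles serve Fourier inversion, where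
    the two side lengths tend to infinity one after the other. *)
Definition rect (n m : nat) : seq (int * int) :=
  [seq (i%:Z - n%:Z, j%:Z - m%:Z) | i <- iota 0 n.*2.+1, j <- iota 0 m.*2.+1].

Definition sq n := rect n n.

Arguments sq : simpl never.

Lemma rect_uniq n m : uniq (rect n m).
Proof.
apply: allpairs_uniq; rewrite ?iota_uniq // => -[i j] [i' j'] _ _ /= [].
by move=> /addIr[->] /addIr[->].
Qed.

Lemma mem_rect n m (k : int * int) : (k \in rect n m) = ((`|k.1| <= n) && (`|k.2| <= m))%N.
Proof.
apply/allpairsP/idP => [[[i j] [hi hj ->]]|].
  by move: hi hj; rewrite !mem_iota /=; lia.
case: k => k1 k2 h; exists (`|(k1 + n%:Z)%R|%N, `|(k2 + m%:Z)%R|%N).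
rewrite !mem_iota; move: h => /= h; split; [lia|lia|].
by congr pair; lia.
Qed.

Lemma sq_uniq n : uniq (sq n).
Proof. exact: rect_uniq. Qed.

Lemma mem_sq n (k : int * int) : (k \in sq n) = ((`|k.1| <= n) && (`|k.2| <= n))%N.
Proof. exact: mem_rect. Qed.

Lemma mem_sqN n (k : int * int) : (- k \in sq n) = (k \in sq n).
Proof. by rewrite !mem_sq /= !abszN. Qed.

Lemma sq0 n : 0 \in sq n.
Proof. by rewrite mem_sq. Qed.

Lemma mem_sqW m n k : (m <= n)%N -> k \in sq m -> k \in sq n.
Proof. by rewrite !mem_sq => mn /andP[h1 h2]; rewrite !(leq_trans _ mn). Qed.

Lemma mem_sq_max (k : int * int) : k \in sq (maxn `|k.1| `|k.2|)%N.
Proof. by rewrite mem_sq leq_maxl leq_maxr. Qed.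

Lemma near_sq (k : int * int) : \forall n \near \oo, k \in sq n.
Proof.
exists (maxn `|k.1| `|k.2|)%N => // n /= hn.
by apply: mem_sqW hn _; exact: mem_sq_max.
Qed.

Lemma sub_sq (s : seq (int * int)) : exists n, {subset s <= sq n}.
Proof.
elim: s => [|k s [n sn]]; first by exists 0%N.
exists (maxn n (maxn `|k.1| `|k.2|)) => l; rewrite inE => /predU1P[->|/sn].
  by apply: mem_sqW (mem_sq_max k); exact: leq_maxr.
by apply: mem_sqW; exact: leq_maxl.
Qed.

(** The left-hand side has the shape of the partial sums in [pmul]. *)
Lemma big_sq (V : nmodType) n (F : int * int -> V) :
  \sum_(i < n.*2.+1) \sum_(j < n.*2.+1) F (i%:Z - n%:Z, j%:Z - n%:Z) =
  \sum_(k <- sq n) F k.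
Proof.
rewrite big_allpairs_dep.
rewrite -[iota 0 n.*2.+1]/(index_iota 0 n.*2.+1) big_mkord.
by apply: eq_bigr => i _; rewrite big_mkord.
Qed.

Lemma big_uniq_sub (V : nmodType) (s t : seq (int * int)) (F : int * int -> V) :
  uniq s -> uniq t -> {subset s <= t} ->
  \sum_(k <- s) F k = \sum_(k <- t | k \in s) F k.
Proof.
move=> us ut st; rewrite -[RHS]big_filter; apply: perm_big.
apply: uniq_perm; rewrite ?filter_uniq // => k.
by rewrite mem_filter; case: (boolP (k \in s)) => //= /st ->.
Qed.

Lemma big_sqN (V : nmodType) n (F : int * int -> V) :
  \sum_(k <- sq n) F (- k) = \sum_(k <- sq n) F k.
Proof.
rewrite -(big_map (fun k => - k) predT F); apply: perm_big.
apply: uniq_perm; rewrite ?map_inj_uniq ?sq_uniq //.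
move=> k; apply/mapP/idP => [[l + ->]|kn]; first by rewrite mem_sqN.
by exists (- k); rewrite ?mem_sqN ?opprK.
Qed.

Lemma big_sq_pair (V : nmodType) n (k : int * int) (F : int * int -> V) :
  \sum_(l <- sq n | l == k) F l = if k \in sq n then F k else 0.
Proof.
rewrite -big_filter; have [kn|kn] := ifPn.
  by rewrite filter_pred1_uniq ?sq_uniq // big_seq1.
rewrite big1_seq // => i; rewrite mem_filter => /andP[_ /andP[/eqP ->]].
by rewrite (negPf kn).
Qed.

End Squares.

Lemma cvg_sumr (R : realType) (T J : Type) (F : set_system T) (FF : Filter F) (s : seq J)
    (f : T -> J -> R) (l : J -> R) :
  (forall j, f ^~ j @ F --> l j) ->
  (fun x => \sum_(j <- s) f x j) @ F --> \sum_(j <- s) l j.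
Proof.
move=> fl; elim: s => [|j s ih].
  by rewrite big_nil; under eq_fun do rewrite big_nil; exact: cvg_cst.
by rewrite big_cons; under eq_fun do rewrite big_cons; exact: cvgD.
Qed.

Section Sums.
Context {R : realType}.
Implicit Types (g w : int * int -> R) (A M : R) (k l m : int * int).

(* For [g >= 0]: the sum of [g] over Z^2 is at most [A]. *)
Definition bnd g A := forall n, \sum_(k <- sq n) g k <= A.

Lemma bnd_ge0 g A : (forall k, 0 <= g k) -> bnd g A -> 0 <= A.
Proof. by move=> g0 /(_ 0%N); apply: le_trans; apply: sumr_ge0. Qed.

Lemma bnd_uniq g A s : (forall k, 0 <= g k) -> bnd g A -> uniq s ->
  \sum_(k <- s) g k <= A.
Proof.
move=> g0 gA us; have [n sn] := sub_sq s.
rewrite (big_uniq_sub g us (sq_uniq n) sn) (le_trans _ (gA n)) //.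
by rewrite [leRHS](bigID (mem s)) /= lerDl sumr_ge0.
Qed.

Lemma bnd_single g A k : (forall k, 0 <= g k) -> bnd g A -> g k <= A.
Proof.
by move=> g0 gA; have := @bnd_uniq g A [:: k] g0 gA isT; rewrite big_seq1.
Qed.

Lemma le_bnd g g' A : (forall k, g' k <= g k) -> bnd g A -> bnd g' A.
Proof. by move=> gg gA n; rewrite (le_trans _ (gA n)) // ler_sum. Qed.

Lemma bndZ g A c : 0 <= c -> bnd g A -> bnd (fun k => c * g k) (c * A).
Proof. by move=> c0 gA n; rewrite -mulr_sumr ler_wpM2l. Qed.

Lemma bndD g g' A A' : bnd g A -> bnd g' A' -> bnd (fun k => g k + g' k) (A + A').
Proof. by move=> gA gA' n; rewrite big_split lerD. Qed.

Lemma sum_sq_mono g : (forall k, 0 <= g k) ->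
  nondecreasing_seq (fun n => \sum_(k <- sq n) g k).
Proof.
move=> g0 m n mn.
rewrite (big_uniq_sub g (sq_uniq m) (sq_uniq n)); last by move=> k; apply: mem_sqW.
by rewrite [leRHS](bigID (mem (sq m))) /= lerDl sumr_ge0.
Qed.

Lemma bnd_cvg g A : (forall k, 0 <= g k) -> bnd g A ->
  cvgn (fun n => \sum_(k <- sq n) g k).
Proof.
move=> g0 gA; apply: nondecreasing_is_cvgn; first exact: sum_sq_mono.
by exists A => _ [n _ <-].
Qed.

(** Let L be the limit of the sums over squares. A finite set outside [sq N], joined to [sq N],
    still has sum at most L, so its own sum is at most the distance from the sum over [sq N] to
    L. *)
Lemma bnd_tail g A (e : R) : (forall k, 0 <= g k) -> bnd g A -> 0 < e ->
  exists N, forall s, uniq s -> (forall k, k \in s -> k \notin sq N) ->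
    \sum_(k <- s) g k <= e.
Proof.
move=> g0 gA e0; have cg := bnd_cvg g0 gA.
have [N _ hN] := (cvgrPdist_le _ _).1 cg _ e0.
exists N => s us sN; have := hN N (leqnn _); set L := limn _.
have gL : bnd g L by move=> n; apply: nondecreasing_cvgn_le => //; exact: sum_sq_mono.
have := @bnd_uniq g L (sq N ++ s) g0 gL; rewrite big_cat cat_uniq us (sq_uniq N) andbT.
move=> h1; have {}h1 : \sum_(k <- sq N) g k + \sum_(k <- s) g k <= L.
  by apply: h1; apply/hasPn => k /sN.
by rewrite ger0_norm ?subr_ge0 ?gL // => h2; lra.
Qed.

(** Both [f + g] and [g] are nonnegative with bounded sums; the partial sums of [f] are the
    difference of theirs. *)
Lemma abs_cvg (f g : int * int -> R) A : (forall k, `|f k| <= g k) -> bnd g A ->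
  cvgn (fun n => \sum_(k <- sq n) f k).
Proof.
move=> fg gA; have g0 k : 0 <= g k by exact: le_trans (fg k).
have : cvgn (fun n => \sum_(k <- sq n) (f k + g k)).
  apply: (@bnd_cvg _ (A + A)) => [k|].
    by have := fg k; rewrite ler_norml => /andP[? _]; lra.
  by apply: (@le_bnd (fun k => g k + g k)) (bndD gA gA) => k;
    have := fg k; rewrite ler_norml => /andP[_ ?]; lra.
move=> cfg; have -> : (fun n => \sum_(k <- sq n) f k) =
  (fun n => \sum_(k <- sq n) (f k + g k) - \sum_(k <- sq n) g k).
  by apply/funext => n; rewrite -sumrB; apply: eq_bigr => k _; rewrite addrK.
by apply: is_cvgB => //; exact: bnd_cvg g0 gA.
Qed.

(** Dominated convergence for series. The region of summation may vary with [N] in any way: on a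
    fixed square [sq K] finitely many terms converge, and off it the terms are at most twice the
    tail of [g]. *)
Lemma tannery (f : nat -> int * int -> R) (f' g : int * int -> R) A (r : nat -> nat) :
  (forall N k, `|f N k| <= g k) -> bnd g A -> (forall k, f ^~ k @ \oo --> f' k) ->
  (fun N => \sum_(k <- sq (r N)) f N k - \sum_(k <- sq (r N)) f' k) @ \oo --> (0 : R).
Proof.
move=> fg gA ff'; have g0 k : 0 <= g k by exact: le_trans (fg 0%N k).
have f'g k : `|f' k| <= g k.
  by apply: (cvgr_to_le (cvg_norm (ff' k))); apply: nearW => n.
apply/cvgrPdist_le => e e0.
have e4 : 0 < e / 4 by lra.
have [K hK] := bnd_tail g0 gA e4.
have : (fun N => \sum_(k <- sq K) `|f N k - f' k|) @ \oo --> \sum_(k <- sq K) (0 : R).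
  apply: cvg_sumr => k.
  by rewrite -(normr0 R) -(subrr (f' k)); apply: cvg_norm; apply: cvgB => //; exact: cvg_cst.
rewrite big1 //; move/cvgrPdist_le => /(_ (e / 2)) /(_ ltac:(lra)) [N0 _ hN0].
exists N0 => // N /= /hN0 /=; rewrite !sub0r !normrN => hs.
rewrite -sumrB (le_trans (ler_norm_sum _ _ _)) // (bigID (mem (sq K))) /=.
have -> : e = e / 2 + (e / 4 + e / 4) by lra.
apply: lerD.
  apply: le_trans (le_trans (ler_norm _) hs).
  rewrite -big_filter.
  rewrite (@big_uniq_sub _ _ (sq K)) ?filter_uniq ?sq_uniq //; last first.
    by move=> k; rewrite mem_filter => /andP[].
  by rewrite [leRHS](bigID (mem [seq i <- sq (r N) | i \in sq K])) /= lerDl sumr_ge0.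
rewrite -big_filter.
apply: (@le_trans _ _ (\sum_(k <- [seq i <- sq (r N) | i \notin sq K]) (g k + g k))).
  by apply: ler_sum => k _; rewrite (le_trans (ler_normB _ _)) // lerD.
rewrite big_split /=; suff h : \sum_(k <- [seq i <- sq (r N) | i \notin sq K]) g k <= e / 4.
  exact: lerD.
apply: (hK _ (filter_uniq _ (sq_uniq _))) => k.
by rewrite mem_filter => /andP[].
Qed.

(** Taken with r N = 2 N for sums over pairs in [sq N] regrouped by the sum of the pair, and with
    the identity otherwise. *)
Lemma tannery_cvg (f : nat -> int * int -> R) (f' g : int * int -> R) A (r : nat -> nat) (S : R) :
  (forall N k, `|f N k| <= g k) -> bnd g A -> (forall k, f ^~ k @ \oo --> f' k) ->
  (forall N, (N <= r N)%N) ->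
  (fun N => \sum_(k <- sq N) f' k) @ \oo --> S ->
  (fun N => \sum_(k <- sq (r N)) f N k) @ \oo --> S.
Proof.
move=> fg gA ff' rN fS; rewrite -[S]add0r.
have -> : (fun N => \sum_(k <- sq (r N)) f N k) =
  (fun N => (\sum_(k <- sq (r N)) f N k - \sum_(k <- sq (r N)) f' k) + \sum_(k <- sq (r N)) f' k).
  by apply/funext => N; rewrite subrK.
apply: cvgD; first exact: tannery fg gA ff'.
suff rinf : r @ \oo --> \oo by exact: (cvg_comp _ _ rinf fS).
apply/cvgnyPge => n; exists n => // m /= nm; exact: leq_trans (rN m).
Qed.

Lemma bnd_shift w A k s : (forall k, 0 <= w k) -> bnd w A -> uniq s ->
  \sum_(l <- s) w (k - l) <= A.
Proof.
move=> w0 wA us; rewrite -(big_map (fun l => k - l) predT w).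
apply: bnd_uniq => //; rewrite map_inj_uniq // => l l' /addrI /oppr_inj //.
Qed.

Lemma bnd_shift' w A k s : (forall k, 0 <= w k) -> bnd w A -> uniq s ->
  \sum_(l <- s) w (l - k) <= A.
Proof.
move=> w0 wA us; rewrite -(big_map (fun l => l - k) predT w).
by apply: bnd_uniq => //; rewrite map_inj_uniq // => l l' /addIr.
Qed.

Lemma cauchy_schwarz_seq (s : seq (int * int)) (u v : int * int -> R) :
  (forall k, 0 <= u k) ->
  (\sum_(k <- s) u k * v k) ^+ 2 <= (\sum_(k <- s) u k) * (\sum_(k <- s) u k * v k ^+ 2).
Proof.
move=> u0; elim: s => [|k s ih]; first by rewrite !big_nil expr0n mulr0.
rewrite !big_cons.
set a := \sum_(k <- s) u k in ih *; set b := \sum_(k <- s) u k * v k in ih *.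
set c := \sum_(k <- s) u k * v k ^+ 2 in ih *.
have a0 : 0 <= a by apply: sumr_ge0.
have c0 : 0 <= c by apply: sumr_ge0 => j _; rewrite mulr_ge0 // sqr_ge0.
have uk := u0 k.
(* This is the new cross term. Multiplied by [a] it follows from (v_k a - b)^2 >= 0 and b^2 <= a
   c. *)
suff : 2 * v k * b <= c + v k ^+ 2 * a.
  move=> h; have := ler_wpM2l uk h; nra.
have [a00|an0] := eqVneq a 0.
  have b0 : b = 0 by apply/eqP; rewrite -sqrf_eq0 eq_le sqr_ge0 (le_trans ih) ?a00 ?mul0r.
  by rewrite b0 a00 !mulr0 addr0.
have ap : 0 < a by rewrite lt_def an0.
rewrite -(ler_pM2l ap).
have : 0 <= (v k * a - b) ^+ 2 by exact: sqr_ge0.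
nra.
Qed.

(** Cauchy-Schwarz with the weights w (k - l), of total mass at most [A], gives one factor [A];
    summing over k first gives the other. *)
Lemma young w A (a : int * int -> R) M : (forall k, 0 <= w k) -> bnd w A ->
  bnd (fun k => a k ^+ 2) M ->
  forall N, bnd (fun k => (\sum_(l <- sq N) w (k - l) * a l) ^+ 2) (A ^+ 2 * M).
Proof.
move=> w0 wA aM N n.
have A0 : 0 <= A by exact: bnd_ge0 w0 wA.
apply: (@le_trans _ _ (\sum_(k <- sq n) A * \sum_(l <- sq N) w (k - l) * a l ^+ 2)).
  apply: ler_sum => k _; rewrite (le_trans (cauchy_schwarz_seq _ _ _)) //.
  rewrite ler_wpM2r ?bnd_shift ?sq_uniq //.
  by apply: sumr_ge0 => l _; rewrite mulr_ge0 ?sqr_ge0.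
rewrite -mulr_sumr expr2 -mulrA ler_wpM2l // exchange_big /=.
apply: (@le_trans _ _ (\sum_(l <- sq N) A * a l ^+ 2)).
  apply: ler_sum => l _; rewrite -mulr_suml ler_wpM2r ?sqr_ge0 //.
  by rewrite bnd_shift' ?sq_uniq.
by rewrite -mulr_sumr ler_wpM2l.
Qed.

(** A product of one-dimensional weights, so that its sum over a square factors. *)
Definition decay k : R := (1 + k.1%:~R ^+ 2)^-1 * (1 + k.2%:~R ^+ 2)^-1.

Lemma decay_bnd : bnd decay 25.
Proof.
pose f (j : int) : R := (1 + j%:~R ^+ 2)^-1.
have f0 j : 0 <= f j by rewrite invr_ge0 addr_ge0 // sqr_ge0.
(* The term -4/(n + 1) makes the induction close: the two new terms 1/(1 + (n + 1)^2) cost at most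
   4/(n + 1) - 4/(n + 2). At n = 0 the bound is an equality. *)
have H n : \sum_(i < n.*2.+1) f (i%:Z - n%:Z) <= 5 - 4 / n.+1%:R.
  elim: n => [|n ih].
    by rewrite big_ord1 /f subrr expr0n addr0; lra.
  rewrite doubleS big_ord_recl big_ord_recr /=.
  have -> : \sum_(i < n.*2.+1) f ((bump 0 i)%:Z - n.+1%:Z) = \sum_(i < n.*2.+1) f (i%:Z - n%:Z).
    by apply: eq_bigr => i _; congr f; rewrite /bump; lia.
  have -> : (bump 0 n.*2.+1)%:Z - n.+1%:Z = n.+1%:Z by rewrite /bump; lia.
  have -> : f (0 - n.+1%:Z) = f n.+1%:Z by rewrite /f sub0r mulrNz sqrrN.
  rewrite addrCA; apply: (le_trans (lerD ih (lexx _))).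
  rewrite /f /= -!natr1; set x : R := n%:R.
  have x0 : 1 <= x + 1 by rewrite /x lerDr.
  have e1 : (1 + (x + 1) ^+ 2)^-1 + (1 + (x + 1) ^+ 2)^-1 <= 4 / (x + 1) - 4 / (x + 1 + 1).
    have -> : 4 / (x + 1) - 4 / (x + 1 + 1) = 4 / ((x + 1) * (x + 1 + 1)) by field; lra.
    set u := x + 1 in x0 *; have -> : (1 + u ^+ 2)^-1 + (1 + u ^+ 2)^-1 = 2 / (1 + u ^+ 2) by lra.
    rewrite ler_pdivrMr; last by nra.
    rewrite mulrAC ler_pdivlMr; nra.
  have -> : n.+1%:~R = x + 1 :> R by rewrite -pmulrn -natr1.
  by lra.
have H5 n : \sum_(i < n.*2.+1) f (i%:Z - n%:Z) <= 5.
  by rewrite (le_trans (H n)) // gerBl divr_ge0.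
move=> n; rewrite -big_sq /decay /= -/f.
under eq_bigr do rewrite -mulr_sumr.
rewrite -mulr_suml; have -> : 25 = 5 * 5 :> R by lra.
have S0 : 0 <= \sum_(i < n.*2.+1) f (i%:Z - n%:Z) by exact: sumr_ge0.
exact: (ler_pM S0 S0 (H5 n) (H5 n)).
Qed.

End Sums.

(** * Moduli and limits of complex numbers *)

Section ComplexAux.
Context {R : realType}.
Local Open Scope complex_scope.
Implicit Types (z w : R[i]).
Local Notation Re := (@complex.Re R).
Local Notation Im := (@complex.Im R).
Local Notation cabs := (@Normc.normc R).

Definition nsq z : R := Re z ^+ 2 + Im z ^+ 2.

Lemma ReD z w : Re (z + w) = Re z + Re w. Proof. by case: z; case: w. Qed.
Lemma ImD z w : Im (z + w) = Im z + Im w. Proof. by case: z; case: w. Qed.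
Lemma ReN z : Re (- z) = - Re z. Proof. by case: z. Qed.
Lemma ImN z : Im (- z) = - Im z. Proof. by case: z. Qed.
Lemma ReM z w : Re (z * w) = Re z * Re w - Im z * Im w.
Proof. by case: z; case: w. Qed.
Lemma ImM z w : Im (z * w) = Re z * Im w + Im z * Re w.
Proof. by case: z; case: w. Qed.
Lemma ReJ z : Re (conjc z) = Re z. Proof. by case: z. Qed.
Lemma ImJ z : Im (conjc z) = - Im z. Proof. by case: z. Qed.

Lemma Re_sum (I : Type) (r : seq I) (P : pred I) (F : I -> R[i]) :
  Re (\sum_(i <- r | P i) F i) = \sum_(i <- r | P i) Re (F i).
Proof. exact: (big_morph Re ReD). Qed.

Lemma Im_sum (I : Type) (r : seq I) (P : pred I) (F : I -> R[i]) :
  Im (\sum_(i <- r | P i) F i) = \sum_(i <- r | P i) Im (F i).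
Proof. exact: (big_morph Im ImD). Qed.

Lemma complexP z w : Re z = Re w -> Im z = Im w -> z = w.
Proof. by case: z w => [a b] [c d] /= -> ->. Qed.

Lemma conjcM z w : conjc (z * w) = conjc z * conjc w. Proof. exact: rmorphM. Qed.
Lemma conjcD z w : conjc (z + w) = conjc z + conjc w. Proof. exact: rmorphD. Qed.
Lemma conjcN z : conjc (- z) = - conjc z. Proof. exact: rmorphN. Qed.
Lemma conjc_sum (I : Type) (r : seq I) (P : pred I) (F : I -> R[i]) :
  conjc (\sum_(i <- r | P i) F i) = \sum_(i <- r | P i) conjc (F i).
Proof. exact: rmorph_sum. Qed.

Definition conjE := (conjcM, conjcD, conjcN, @conjc_real R, conjc_sum, @conjcK R).

Definition ReImE := (ReD, ImD, ReN, ImN, ReM, ImM, ReJ, ImJ, Re_sum, Im_sum).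

Lemma cabs_sqr z : cabs z ^+ 2 = nsq z.
Proof. by case: z => a b /=; rewrite sqr_sqrtr // addr_ge0 ?sqr_ge0. Qed.

Lemma cabsE z : cabs z = Num.sqrt (nsq z).
Proof. by case: z. Qed.

Lemma nsq_ge0 z : 0 <= nsq z.
Proof. by rewrite addr_ge0 ?sqr_ge0. Qed.

Lemma cabs_ge0 z : 0 <= cabs z.
Proof. by rewrite cabsE sqrtr_ge0. Qed.

Lemma cabs0 : cabs 0 = 0.
Proof. exact: Normc.normc0. Qed.

Lemma nsq0 : nsq 0 = 0.
Proof. by rewrite /nsq /= expr0n addr0. Qed.

Lemma nsqJ z : nsq (conjc z) = nsq z.
Proof. by rewrite /nsq ReJ ImJ sqrrN. Qed.

Lemma cabsM z w : cabs (z * w) = cabs z * cabs w.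
Proof. exact: Normc.normcM. Qed.

Lemma cabsN z : cabs (- z) = cabs z.
Proof. exact: normcN. Qed.

Lemma cabsJ z : cabs (conjc z) = cabs z.
Proof. by rewrite !cabsE nsqJ. Qed.

Lemma cabsD z w : cabs (z + w) <= cabs z + cabs w.
Proof. exact: le_normcD. Qed.

Lemma cabsB z w : cabs (z - w) <= cabs z + cabs w.
Proof. by rewrite -(cabsN w) cabsD. Qed.

Lemma cabs_real (r : R) : cabs r%:C = `|r|.
Proof. by rewrite /= expr0n addr0 sqrtr_sqr. Qed.

Lemma cabs_Re z : `|Re z| <= cabs z.
Proof. by rewrite cabsE -sqrtr_sqr ler_wsqrtr // lerDl sqr_ge0. Qed.

Lemma cabs_Im z : `|Im z| <= cabs z.
Proof. by rewrite cabsE -sqrtr_sqr ler_wsqrtr // lerDr sqr_ge0. Qed.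

Lemma cabs_le_ReIm z : cabs z <= `|Re z| + `|Im z|.
Proof.
rewrite cabsE -[leRHS]ger0_norm ?addr_ge0 // -sqrtr_sqr ler_wsqrtr //.
by rewrite /nsq sqrrD !real_normK ?num_real // lerD2r lerDl mulrn_wge0 // mulr_ge0.
Qed.

Lemma cabs_sum (I : Type) (r : seq I) (P : pred I) (F : I -> R[i]) :
  cabs (\sum_(i <- r | P i) F i) <= \sum_(i <- r | P i) cabs (F i).
Proof.
elim/big_rec2 : _ => [|i y z _ h]; first by rewrite cabs0.
by rewrite (le_trans (cabsD _ _)) // lerD2l.
Qed.

Lemma cabs_mul_le z w : cabs (z * w) <= (nsq z + nsq w) / 2.
Proof.
rewrite cabsM -!cabs_sqr; have := sqr_ge0 (cabs z - cabs w); nra.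
Qed.

Lemma cabs_le1 z M : nsq z <= M -> cabs z <= 1 + M.
Proof. rewrite -cabs_sqr; have := sqr_ge0 (cabs z - 1); have := cabs_ge0 z; nra. Qed.

(** Convergence of real and imaginary parts along any filter, so that limit theorems for real
    functions apply to each part. *)
Definition ccvg (T : Type) (F : set_system T) (f : T -> R[i]) (l : R[i]) : Prop :=
  (fun x => Re (f x)) @ F --> Re l /\ (fun x => Im (f x)) @ F --> Im l.

Section Ccvg.
Variables (T : Type) (F : set_system T).
Context {FF : Filter F}.
Implicit Types (f g : T -> R[i]).

Lemma ccvg_cst z : ccvg F (fun=> z) z.
Proof. by split; exact: cvg_cst. Qed.

Lemma ccvgD f g l l' : ccvg F f l -> ccvg F g l' -> ccvg F (fun x => f x + g x) (l + l').
Proof.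
move=> [? ?] [? ?]; split; under eq_fun do rewrite ReImE; rewrite ReImE; exact: cvgD.
Qed.

Lemma ccvgN f l : ccvg F f l -> ccvg F (fun x => - f x) (- l).
Proof.
move=> [? ?]; split; under eq_fun do rewrite ReImE; rewrite ReImE; exact: cvgN.
Qed.

Lemma ccvgB f g l l' : ccvg F f l -> ccvg F g l' -> ccvg F (fun x => f x - g x) (l - l').
Proof. by move=> ? ?; apply: ccvgD => //; exact: ccvgN. Qed.

Lemma ccvgM f g l l' : ccvg F f l -> ccvg F g l' -> ccvg F (fun x => f x * g x) (l * l').
Proof.
move=> [? ?] [? ?]; split; under eq_fun do rewrite ReImE; rewrite ReImE.
  by apply: cvgB; exact: cvgM.
by apply: cvgD; exact: cvgM.
Qed.

Lemma ccvgJ f l : ccvg F f l -> ccvg F (fun x => conjc (f x)) (conjc l).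
Proof.
move=> [? ?]; split; under eq_fun do rewrite ReImE; rewrite ReImE => //; exact: cvgN.
Qed.

Lemma ccvgR (f : T -> R) (l : R) : f @ F --> l -> ccvg F (fun x => (f x)%:C) l%:C.
Proof. by move=> fl; split => //=; exact: cvg_cst. Qed.

Lemma ccvg_sum (J : Type) (s : seq J) (P : pred J) (f : T -> J -> R[i]) (l : J -> R[i]) :
  (forall j, P j -> ccvg F (f ^~ j) (l j)) ->
  ccvg F (fun x => \sum_(j <- s | P j) f x j) (\sum_(j <- s | P j) l j).
Proof.
move=> fl; elim: s => [|j s ih].
  by rewrite big_nil; under eq_fun do rewrite big_nil; exact: ccvg_cst.
rewrite big_cons; under eq_fun do rewrite big_cons.
by case: ifPn => // Pj; apply: ccvgD => //; exact: fl.
Qed.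

Lemma ccvg_nsq f l : ccvg F f l -> (fun x => nsq (f x)) @ F --> nsq l.
Proof. by move=> [? ?]; apply: cvgD; rewrite expr2; under eq_fun do rewrite expr2; exact: cvgM. Qed.

Lemma ccvg_cabs f l : ccvg F f l -> (fun x => cabs (f x)) @ F --> cabs l.
Proof.
move=> fl; rewrite cabsE; under eq_fun do rewrite cabsE.
apply: continuous_cvg; first exact: sqrt_continuous.
exact: ccvg_nsq.
Qed.

Lemma ccvg_le f l (u : T -> R) (b : R) {PF : ProperFilter F} : ccvg F f l -> u @ F --> b ->
  (\forall x \near F, cabs (f x) <= u x) -> cabs l <= b.
Proof.
move=> /ccvg_cabs fl ub h; rewrite -subr_ge0; apply: (cvgr_to_ge (cvgB ub fl)).
by apply: filterS h => x; rewrite subr_ge0.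
Qed.

Lemma cabs_ccvg f l : (fun x => cabs (f x - l)) @ F --> (0 : R) -> ccvg F f l.
Proof.
move=> h; split; apply/cvgrPdist_le => e e0.
  move/cvgrPdist_le : h => /(_ e e0); apply: filterS => x.
  rewrite sub0r normrN ger0_norm ?cabs_ge0 // distrC; apply: le_trans.
  by rewrite -ReN -ReD cabs_Re.
move/cvgrPdist_le : h => /(_ e e0); apply: filterS => x.
rewrite sub0r normrN ger0_norm ?cabs_ge0 // distrC; apply: le_trans.
by rewrite -ImN -ImD cabs_Im.
Qed.

Lemma ccvg_unique f l l' {PF : ProperFilter F} : ccvg F f l -> ccvg F f l' -> l = l'.
Proof.
by move=> [h1 h2] [h3 h4]; apply: complexP; [exact: cvg_unique h1 h3|exact: cvg_unique h2 h4].
Qed.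

End Ccvg.

(** Links [ccvg] to the [limn] in R[i] by which [pmul] is defined. *)
Lemma ccvg_limn (f : nat -> R[i]) l : ccvg \oo f l ->
  limn (f : nat -> (R[i] : numFieldType)) = l.
Proof.
move=> fl; apply: cvg_lim; first exact: norm_hausdorff.
apply/cvgrPdist_le => e e0.
have -> : e = (Re e)%:C by rewrite RRe_real // gtr0_real.
have e0' : 0 < Re e by move: e0; rewrite ltcE => /andP[_].
have : (fun x => cabs (l - f x)) @ \oo --> cabs (l - l).
  by apply: ccvg_cabs; apply: ccvgB => //; exact: ccvg_cst.
rewrite subrr cabs0 => /cvgrPdist_le /(_ _ e0'); apply: filterS => n.
rewrite sub0r normrN ger0_norm ?cabs_ge0 //.
by rewrite normc_def lecR cabsE.
Qed.

Lemma abs_ccvg (f : int * int -> R[i]) (g : int * int -> R) A :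
  (forall k, cabs (f k) <= g k) -> bnd g A ->
  exists l, ccvg \oo (fun n => \sum_(k <- sq n) f k) l.
Proof.
move=> fg gA.
have h1 : cvgn (fun n => \sum_(k <- sq n) Re (f k)).
  by apply: (@abs_cvg _ _ g A) => // k; apply: le_trans (fg k); exact: cabs_Re.
have h2 : cvgn (fun n => \sum_(k <- sq n) Im (f k)).
  by apply: (@abs_cvg _ _ g A) => // k; apply: le_trans (fg k); exact: cabs_Im.
exists (limn (fun n => \sum_(k <- sq n) Re (f k)) +i* limn (fun n => \sum_(k <- sq n) Im (f k))).
by split; under eq_fun do rewrite ReImE.
Qed.

Lemma sum_cabs_le (g : int * int -> R[i]) A M (f : int * int -> R[i]) :
  bnd (nsq \o f) A -> bnd (nsq \o g) M -> bnd (fun k => cabs (f k * g k)) ((A + M) / 2).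
Proof.
move=> fA gM n; apply: (@le_trans _ _ (\sum_(k <- sq n) (nsq (f k) + nsq (g k)) / 2)).
  by apply: ler_sum => k _; exact: cabs_mul_le.
rewrite -mulr_suml ler_wpM2r // big_split; apply: lerD; [exact: fA|exact: gM].
Qed.

End ComplexAux.

(** * The symmetrized kernel *)

Section Kernel.
Context {R : realType}.
Local Open Scope complex_scope.
Implicit Types (k l m : int * int) (a b : int * int -> R[i]).
Local Notation cabs := (@Normc.normc R).
Local Notation fn := (@freq_norm R).

Definition cross l m : R := l.1%:~R * m.2%:~R - l.2%:~R * m.1%:~R.

Lemma fn_ge0 k : 0 <= fn k. Proof. exact: sqrtr_ge0. Qed.

Lemma fn_sqr k : fn k ^+ 2 = k.1%:~R ^+ 2 + k.2%:~R ^+ 2.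
Proof. by rewrite sqr_sqrtr // addr_ge0 ?sqr_ge0. Qed.

Lemma fnN k : fn (- k) = fn k.
Proof. by rewrite /freq_norm /= !mulrNz !sqrrN. Qed.

Lemma fnE k : fn k = cabs (k.1%:~R +i* k.2%:~R).
Proof. by []. Qed.

Lemma fnD k l : fn (k + l) <= fn k + fn l.
Proof. by rewrite !fnE; apply: le_trans (cabsD _ _); rewrite /= !rmorphD. Qed.

Lemma fnB k l : `|fn k - fn l| <= fn (k - l).
Proof.
have h1 := fnD (k - l) l; have h2 := fnD (l - k) k; rewrite !subrK in h1 h2.
by rewrite -opprB fnN in h2; rewrite ler_norml; apply/andP; split; lra.
Qed.

Lemma fn_sq_ge1 k : k != 0 -> 1 <= fn k ^+ 2.
Proof.
move=> k0; rewrite fn_sqr -!rmorphXn -rmorphD /= ler1z.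
case: k k0 => a b /= k0; suff : a != 0 \/ b != 0 by nia.
have [a0|] := eqVneq a 0; last by left.
by right; apply: contraNN k0 => /eqP ->; rewrite a0.
Qed.

Lemma fn_ge1 k : k != 0 -> 1 <= fn k.
Proof. by move/fn_sq_ge1; have := fn_ge0 k; nra. Qed.

Lemma fn_eq0 : fn 0 = 0.
Proof. by rewrite /freq_norm /= expr0n addr0 sqrtr0. Qed.

Lemma absz_sqr_le (x : int) n : (`|x| <= n)%N -> x ^+ 2 <= n%:Z ^+ 2.
Proof. by move=> h; rewrite -(real_normK (num_real x)) -abszE ler_pXn2r. Qed.

Lemma absz_sqr_ge (x : int) n : (n <= `|x|)%N -> n%:Z ^+ 2 <= x ^+ 2.
Proof. by move=> h; rewrite -(real_normK (num_real x)) -abszE ler_pXn2r. Qed.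

Lemma fn_notin n k : k \notin sq n -> n.+1%:R <= fn k.
Proof.
rewrite mem_sq negb_and -!ltnNge => h.
have : (n.+1%:R : R) ^+ 2 <= fn k ^+ 2.
  rewrite fn_sqr -[n.+1%:R]/(n.+1%:~R) -!rmorphXn -rmorphD /= ler_int.
  have h1 := sqr_ge0 k.1; have h2 := sqr_ge0 k.2.
  by case/orP: h => /absz_sqr_ge; lra.
by rewrite ler_pXn2r // nnegrE ?fn_ge0.
Qed.

Lemma fn_in n k : k \in sq n -> fn k ^+ 2 <= 2 * n%:R ^+ 2.
Proof.
rewrite mem_sq => h.
rewrite fn_sqr -[n%:R]/(n%:~R) -[2]/(2%:~R) -!rmorphXn -rmorphD -rmorphM /= ler_int.
by case/andP: h => /absz_sqr_le + /absz_sqr_le; lra.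
Qed.

Lemma cross_le l m : `|cross l m| <= fn l * fn m.
Proof.
rewrite -(@ler_pXn2r _ 2) ?nnegrE ?mulr_ge0 ?fn_ge0 // real_normK ?num_real //.
rewrite exprMn !fn_sqr /cross.
set x := _%:~R; set y := _%:~R; set z := _%:~R; set t := _%:~R.
have := sqr_ge0 (x * t + z * y); nra.
Qed.

(** This trades a factor |m| for |l + m|, the output frequency, which stays fixed while l and m
    grow. *)
Lemma cross_sum l m : cross l m = cross l (l + m).
Proof. rewrite /cross /= !rmorphD /=; ring. Qed.

Lemma crossC l m : cross m l = - cross l m.
Proof. rewrite /cross; ring. Qed.

Lemma crossNN l m : cross (- l) (- m) = cross l m.
Proof. rewrite /cross /= !rmorphN /=; ring. Qed.

Lemma crossNr l m : cross l (- m) = - cross l m.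
Proof. rewrite /cross /= !rmorphN /=; ring. Qed.

Lemma cross0l m : cross 0 m = 0.
Proof. by rewrite /cross /= !mul0r subrr. Qed.

Lemma cross0r m : cross m 0 = 0.
Proof. by rewrite /cross /= !mulr0 subrr. Qed.

Variable s : R.
Hypothesis s0 : 0 <= s.
Hypothesis s1 : s <= 1.

(** At frequency 0 this is 0 for s > 0 and 1 for s = 0; [ker] does not see the value, since the
    cross product vanishes there. *)
Definition wgt k : R := fn k `^ (- s).

(* The coefficient at k of - u . grad theta is the sum of
   - (l x m) |l|^-s a_l a_m over l + m = k; symmetrizing in l and m gives this
   kernel, which is O(|k|^2) uniformly in l. *)
Definition ker l m : R := - 2^-1 * cross l m * (wgt l - wgt m).

Lemma wgtN k : wgt (- k) = wgt k.
Proof. by rewrite /wgt fnN. Qed.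

Lemma wgt_ge0 k : 0 <= wgt k.
Proof. exact: powR_ge0. Qed.

Lemma kerC l m : ker l m = ker m l.
Proof. rewrite /ker (crossC l m); ring. Qed.

Lemma kerNN l m : ker (- l) (- m) = ker l m.
Proof. by rewrite /ker crossNN !wgtN. Qed.

(** For r in [0, 1] the power t^r lies between 1 and t. *)
Lemma powR_sub1 (t r : R) : 0 <= r -> r <= 1 -> 0 < t -> `|t `^ r - 1| <= `|t - 1|.
Proof.
move=> r0 r1 t0; have [t1|t1] := leP 1 t.
  have h1 := ler1_powR t1 r1; have h2 := ler_powR t1 r0.
  by rewrite powRr0 in h2; rewrite !ger0_norm; lra.
have t01 : 0 < t <= 1 by rewrite t0 ltW.
have h1 := ger_powR t01 r0; rewrite powRr0 in h1.
have h2 : t <= t `^ r by rewrite -{1}(powRr1 (ltW t0)); exact: ger_powR.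
by rewrite !ler0_norm; lra.
Qed.

(** The bound of [powR_sub1] at t = x / y, rescaled. Its asymmetry lets the caller choose the
    frequency that divides. *)
Lemma powRB_le (x y r : R) : 0 <= r -> r <= 1 -> 0 < x -> 0 < y ->
  `|x `^ r - y `^ r| <= `|x - y| * (y `^ r / y).
Proof.
move=> r0 r1 x0 y0.
have -> : x = (x / y) * y by rewrite divfK // gt_eqF.
rewrite (powRM _ (divr_ge0 (ltW x0) (ltW y0)) (ltW y0)); set t := x / y.
have -> : t `^ r * y `^ r - y `^ r = (t `^ r - 1) * y `^ r by ring.
have -> : t * y - y = (t - 1) * y by ring.
rewrite !normrM (ger0_norm (powR_ge0 _ _)) (gtr0_norm y0).
have -> : `|t - 1| * y * (y `^ r / y) = `|t - 1| * y `^ r by field; rewrite gt_eqF.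
apply: (ler_wpM2r (powR_ge0 _ _)).
by apply: powR_sub1 => //; rewrite divr_gt0.
Qed.

Lemma wgt_sub l m : l != 0 -> m != 0 -> `|wgt l - wgt m| <= fn (l + m) / fn l * wgt m.
Proof.
move=> l0 m0; have x1 := fn_ge1 l0; have y1 := fn_ge1 m0.
rewrite /wgt !powRN; set x := fn l in x1 *; set y := fn m in y1 *.
have xs : 0 < x `^ s by apply: powR_gt0; lra.
have ys : 0 < y `^ s by apply: powR_gt0; lra.
have -> : (x `^ s)^-1 - (y `^ s)^-1 = (y `^ s - x `^ s) / (x `^ s * y `^ s).
  by field; rewrite !gt_eqF.
rewrite normrM (gtr0_norm (_ : 0 < (_ * _)^-1)) ?invr_gt0 ?mulr_gt0 //.
rewrite invfM mulrA; apply: ler_wpM2r; first by rewrite invr_ge0 ltW.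
rewrite ler_pdivrMr //.
apply: le_trans (powRB_le s0 s1 _ _) _; [lra|lra|].
rewrite -[x `^ s / x]mulrC mulrA; apply: ler_wpM2r; first exact: ltW.
apply: ler_wpM2r; first by rewrite invr_ge0; lra.
by have := fnB m (- l); rewrite fnN opprK (addrC m).
Qed.

(** The bound |l x (l + m)| <= |l| |l + m| cancels the 1/|l| of [wgt_sub]. The weight that remains
    makes high frequencies negligible. *)
Lemma ker_le l m : `|ker l m| <= fn (l + m) ^+ 2 * wgt m.
Proof.
have W := wgt_ge0 m.
have [->|l0] := eqVneq l 0; first by rewrite /ker cross0l mulr0 mul0r normr0 mulr_ge0 ?sqr_ge0.
have [->|m0] := eqVneq m 0; first by rewrite /ker cross0r mulr0 mul0r normr0 mulr_ge0 ?sqr_ge0 // wgt_ge0.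
rewrite /ker !normrM normrN (ger0_norm (_ : 0 <= 2^-1)) ?invr_ge0 //.
have h1 : `|cross l m| <= fn l * fn (l + m) by rewrite cross_sum cross_le.
have h2 := wgt_sub l0 m0.
have x1 := fn_ge1 l0; have z0 := fn_ge0 (l + m).
have h3 : `|cross l m| * `|wgt l - wgt m| <= (fn l * fn (l + m)) * (fn (l + m) / fn l * wgt m).
  exact: ler_pM.
have e : (fn l * fn (l + m)) * (fn (l + m) / fn l * wgt m) = fn (l + m) ^+ 2 * wgt m.
  by field; rewrite gt_eqF //; lra.
rewrite e in h3; have := normr_ge0 (cross l m); have := normr_ge0 (wgt l - wgt m); nra.
Qed.

Lemma ker_le' l m : `|ker l m| <= fn (l + m) ^+ 2 * wgt l.
Proof. by rewrite kerC addrC ker_le. Qed.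

(* For [s = 0] the kernel vanishes, but N^-s does not tend to 0. *)
Definition dlt (N : nat) : R := if s == 0 then 0 else N.+1%:R `^ (- s).

Lemma dlt_ge0 N : 0 <= dlt N.
Proof. by rewrite /dlt; case: ifP => // _; exact: powR_ge0. Qed.

Lemma wgt_le k c : 0 < c -> c <= fn k -> wgt k <= c `^ (- s).
Proof.
move=> c0 ck; rewrite /wgt !powRN lef_pV2 ?posrE ?powR_gt0 //; last exact: lt_le_trans ck.
by rewrite ge0_ler_powR // nnegrE ?fn_ge0 // ltW.
Qed.

Lemma ker_tail N l m : (l \notin sq N) || (m \notin sq N) ->
  `|ker l m| <= fn (l + m) ^+ 2 * dlt N.
Proof.
move=> h; have [s00|sn0] := eqVneq s 0.
  by rewrite /ker /wgt s00 oppr0 !powRr0 subrr mulr0 normr0 mulr_ge0 ?sqr_ge0 ?dlt_ge0.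
rewrite /dlt (negPf sn0); case/orP: h => /fn_notin h.
  by apply: le_trans (ker_le' _ _) _; rewrite ler_wpM2l ?sqr_ge0 // wgt_le.
by apply: le_trans (ker_le _ _) _; rewrite ler_wpM2l ?sqr_ge0 // wgt_le.
Qed.

Lemma ker_bnd l m : `|ker l m| <= fn (l + m) ^+ 2.
Proof.
have [->|l0] := eqVneq l 0; first by rewrite /ker cross0l mulr0 mul0r normr0 sqr_ge0.
apply: le_trans (ker_le' _ _) _; rewrite ler_piMr ?sqr_ge0 //.
by have := wgt_le ltr01 (fn_ge1 l0); rewrite powR1.
Qed.

Lemma dlt_cvg0 : dlt @ \oo --> (0 : R).
Proof.
apply/cvgrPdist_le => e e0; have [s00|sn0] := eqVneq s 0.
  by apply: nearW => n; rewrite /dlt s00 eqxx subrr normr0 ltW.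
have sp : 0 < s by rewrite lt_def sn0.
exists (Num.bound (e^-1 `^ s^-1)) => // n /= hn.
rewrite sub0r normrN ger0_norm ?dlt_ge0 // /dlt (negPf sn0) powRN.
have h : e^-1 <= n.+1%:R `^ s.
  have -> : e^-1 = (e^-1 `^ s^-1) `^ s.
    by rewrite -powRrM mulVf // powRr1 // invr_ge0 ltW.
  apply: ge0_ler_powR; rewrite ?nnegrE ?powR_ge0 //.
  have /ltW := archi_boundP (powR_ge0 e^-1 s^-1); move/le_trans; apply.
  by rewrite ler_nat ltnW.
by rewrite -[leRHS]invrK lef_pV2 ?posrE ?invr_gt0 // powR_gt0.
Qed.

End Kernel.

(** * The truncated quadratic term and its energy identity *)

Section Quad.
Context {R : realType}.
Local Open Scope complex_scope.
Variable s : R.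
Hypothesis s0 : 0 <= s.
Hypothesis s1 : s <= 1.
Implicit Types (k l m : int * int) (a b : int * int -> R[i]).
Local Notation cabs := (@Normc.normc R).
Local Notation fn := (@freq_norm R).
Local Notation Re := (@complex.Re R).

(** Characterizes the coefficients of real-valued functions. *)
Definition hermitian a := forall k, a (- k) = conjc (a k).

(** Both factors are kept in the square. The truncation is then symmetric in the two frequencies, as
    the energy identity requires. *)
Definition quad (N : nat) a k : R[i] :=
  \sum_(l <- sq N | k - l \in sq N) (ker s l (k - l))%:C * (a l * a (k - l)).

(** Since |a_l a_m| <= (|a_l|^2 + |a_m|^2) / 2, a bounded kernel acts boundedly on l^2 at each
    output frequency. The kernel [c] is left general so that it may be cut off to a tail. *)
Lemma quad_gen_le (c : int * int -> R) (D M : R) N (P : pred (int * int)) a k : 0 <= D ->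
  (forall l, `|c l| <= D) -> bnd (nsq \o a) M ->
  cabs (\sum_(l <- sq N | P l) (c l)%:C * (a l * a (k - l))) <= D * M.
Proof.
move=> D0 cD aM; apply: le_trans (cabs_sum _ _ _) _.
apply: (@le_trans _ _ (\sum_(l <- sq N | P l) D * ((nsq (a l) + nsq (a (k - l))) / 2))).
  by apply: ler_sum => l _; rewrite cabsM cabs_real ler_pM ?cabs_ge0 // cabs_mul_le.
apply: (@le_trans _ _ (\sum_(l <- sq N) D * ((nsq (a l) + nsq (a (k - l))) / 2))).
  rewrite [leRHS](bigID P) /= lerDl sumr_ge0 // => l _.
  by rewrite mulr_ge0 // divr_ge0 // addr_ge0 ?nsq_ge0.
rewrite -mulr_sumr ler_wpM2l // -mulr_suml big_split /=.
have h1 := aM N; have h2 := bnd_shift k (fun k => nsq_ge0 (a k)) aM (sq_uniq N).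
by rewrite /= in h1 h2; lra.
Qed.

Lemma ker_sub_le l k : `|ker s l (k - l)| <= fn k ^+ 2.
Proof. by have := ker_bnd s0 s1 l (k - l); rewrite subrKC. Qed.

Lemma quad_le N a k M : bnd (nsq \o a) M -> cabs (quad N a k) <= fn k ^+ 2 * M.
Proof.
move=> aM; apply: quad_gen_le => //; first exact: sqr_ge0.
by move=> l; exact: ker_sub_le.
Qed.

Lemma quad_tail N N' a k M : (N <= N')%N -> bnd (nsq \o a) M ->
  cabs (quad N' a k - quad N a k) <= fn k ^+ 2 * dlt s N * M.
Proof.
move=> NN aM.
have sub : {subset sq N <= sq N'} by move=> l; apply: mem_sqW.
(* The difference is the sum over pairs in [sq N'] with at least one index outside [sq N]; the other
   pairs receive the coefficient 0. *)
have -> : quad N' a k - quad N a k = \sum_(l <- sq N' | k - l \in sq N')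
   (if (l \in sq N) && (k - l \in sq N) then 0 else ker s l (k - l))%:C * (a l * a (k - l)).
  rewrite /quad [X in _ - X]big_mkcond (big_uniq_sub _ (sq_uniq N) (sq_uniq N') sub).
  rewrite [X in _ - X]big_mkcond [X in X - _]big_mkcond -sumrB [RHS]big_mkcond.
  apply: eq_bigr => l _; case: (boolP (l \in sq N)) => lN /=; last by rewrite subr0.
  case: (boolP (k - l \in sq N)) => kl; last by rewrite subr0.
  by rewrite (sub _ kl) mul0r subrr.
apply: quad_gen_le => //; first by rewrite mulr_ge0 ?sqr_ge0 ?dlt_ge0.
move=> l; case: ifPn => [_|]; first by rewrite normr0 mulr_ge0 ?sqr_ge0 ?dlt_ge0.
by rewrite negb_and => /(ker_tail s0 s1); rewrite subrKC.
Qed.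

Lemma sumr_const_sq N (c : R) : \sum_(l <- sq N) c = c *+ size (sq N).
Proof. by rewrite big_const_seq count_predT iter_addr_0. Qed.

(** A crude Lipschitz constant of [quad N] at frequency k for the sup norm over [sq N]: number of
    terms, kernel bound, and 2 (1 + M) from the difference of two products. It grows with [N] but is
    only used at fixed [N]. *)
Definition lip N k (M : R) : R := (size (sq N))%:R * (fn k ^+ 2 * (2 * (1 + M))).

Lemma quad_lip N a b k M (eta : R) : 0 <= eta ->
  bnd (nsq \o a) M -> bnd (nsq \o b) M ->
  (forall l, l \in sq N -> cabs (a l - b l) <= eta) ->
  cabs (quad N a k - quad N b k) <= lip N k M * eta.
Proof.
move=> e0 aM bM ab; rewrite /quad -sumrB.
apply: le_trans (cabs_sum _ _ _) _.
have aM1 l : cabs (a l) <= 1 + M by apply/cabs_le1/(bnd_single _ (fun k => nsq_ge0 (a k)) aM).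
have bM1 l : cabs (b l) <= 1 + M by apply/cabs_le1/(bnd_single _ (fun k => nsq_ge0 (b k)) bM).
have M0 : 0 <= M := bnd_ge0 (fun k => nsq_ge0 (a k)) aM.
rewrite /lip -mulrA mulr_natl -(sumr_const_sq N) big_mkcond big_seq [leRHS]big_seq.
apply: ler_sum => l lN; have C0 : 0 <= fn k ^+ 2 * (2 * (1 + M)) * eta.
  by apply: mulr_ge0 => //; apply: mulr_ge0; [exact: sqr_ge0|lra].
case: ifPn => // kN; rewrite -mulrBr cabsM cabs_real -mulrA.
apply: ler_pM; rewrite ?cabs_ge0 ?ker_sub_le //.
have -> : a l * a (k - l) - b l * b (k - l) =
   (a l - b l) * a (k - l) + b l * (a (k - l) - b (k - l)) by ring.
apply: le_trans (cabsD _ _) _; rewrite !cabsM.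
have h1 := ab _ lN; have h2 := ab _ kN.
have -> : 2 * (1 + M) * eta = eta * (1 + M) + (1 + M) * eta by ring.
by apply: lerD; apply: ler_pM; rewrite ?cabs_ge0.
Qed.

Lemma quadJ N a k : hermitian a -> quad N a (- k) = conjc (quad N a k).
Proof.
move=> ha; rewrite /quad big_mkcond -big_sqN -big_mkcond /=.
rewrite conjc_sum; apply: eq_big => [l|l _]; first by rewrite -opprD mem_sqN.
by rewrite -opprD kerNN !ha !conjE.
Qed.

Lemma quad0 N a : quad N a 0 = 0.
Proof.
rewrite /quad big1 // => l _; rewrite sub0r /ker cross_sum subrr cross0r.
by rewrite mulr0 mul0r mul0r.
Qed.

Lemma big_pair_sum (V : nmodType) N (F : int * int -> int * int -> V) k :
  \sum_(l <- sq N | k - l \in sq N) F l (k - l) =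
  \sum_(l <- sq N) \sum_(m <- sq N | l + m == k) F l m.
Proof.
rewrite big_mkcond; apply: eq_bigr => l _.
rewrite -(big_sq_pair N (k - l) (F l)); apply: eq_bigl => m.
by apply/eqP/eqP => [->|<-]; rewrite ?subrKC // [l + m]addrC addrK.
Qed.

(* If p + l + m = 0 then l x p = - l x m, so exchanging p and m cancels each half
   of the kernel. *)
Lemma energy_sum N a : hermitian a ->
  \sum_(k <- sq N) Re (conjc (a k) * quad N a k) = 0.
Proof.
move=> ha; rewrite -Re_sum.
pose g p l m : R[i] := (p + l + m == 0)%:R * (a p * a l * a m).
have gC p l m : g m l p = g p l m.
  by rewrite /g [m + l + p]addrC (addrC m l) addrA; congr (_ * _); ring.
have gC' p l m : g p m l = g p l m.
  by rewrite /g addrAC; congr (_ * _); ring.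
pose S := \sum_(p <- sq N) \sum_(l <- sq N) \sum_(m <- sq N)
  (cross l m * wgt s l)%:C * g p l m.
(* The conjugate of a_k is a_{-k}; with p = - k the constraint becomes p + l + m = 0, symmetric in
   the three frequencies. *)
have -> : \sum_(k <- sq N) conjc (a k) * quad N a k =
    \sum_(p <- sq N) \sum_(l <- sq N) \sum_(m <- sq N) (ker s l m)%:C * g p l m.
  rewrite -big_sqN; apply: eq_bigr => p _; rewrite -ha opprK /quad.
  rewrite (big_pair_sum N (fun l m => (ker s l m)%:C * (a l * a m))) mulr_sumr.
  apply: eq_bigr => l _; rewrite big_mkcond mulr_sumr; apply: eq_bigr => m _.
  rewrite /g -addrA addrC addr_eq0; case: eqP => _; last by rewrite mulr0 mul0r mulr0.
  by rewrite mul1r; ring.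
have S0 : S = 0.
  have SN : S = - S.
    transitivity (\sum_(p <- sq N) \sum_(l <- sq N) \sum_(m <- sq N)
      (cross l p * wgt s l)%:C * g m l p).
      rewrite /S exchange_big /= [RHS]exchange_big /=; apply: eq_bigr => l _.
      by rewrite exchange_big.
    rewrite /S -sumrN; apply: eq_bigr => p _; rewrite -sumrN; apply: eq_bigr => l _.
    rewrite -sumrN; apply: eq_bigr => m _; rewrite gC /g.
    case: eqP => [h|_]; last by rewrite !mul0r !mulr0 oppr0.
    have -> : cross l p = - cross l m :> R.
      rewrite (cross_sum l p) -crossNr; congr cross.
      by apply/eqP; rewrite -addr_eq0 (addrC l) h.
    by rewrite mulNr rmorphN mulNr.
  have : S *+ 2 == 0 by rewrite mulr2n {2}SN subrr.
  by rewrite mulrn_eq0 /= => /eqP.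
suff -> : \sum_(p <- sq N) \sum_(l <- sq N) \sum_(m <- sq N) (ker s l m)%:C * g p l m =
    - (2^-1 * S) - 2^-1 * S by rewrite S0 mulr0 subr0 oppr0.
transitivity (\sum_(p <- sq N) \sum_(l <- sq N) \sum_(m <- sq N)
  (- 2^-1 * ((cross l m * wgt s l)%:C * g p l m)
   - 2^-1 * ((cross m l * wgt s m)%:C * g p l m))).
  apply: eq_bigr => p _; apply: eq_bigr => l _; apply: eq_bigr => m _.
  rewrite /ker (crossC l m) !(rmorphM, rmorphN, rmorphB) /= fmorphV rmorph_nat; ring.
under eq_bigr do under eq_bigr do rewrite big_split.
under eq_bigr do rewrite big_split.
rewrite big_split /=; congr (_ + _).
  rewrite -mulNr mulr_sumr; apply: eq_bigr => p _; rewrite mulr_sumr; apply: eq_bigr => l _.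
  by rewrite mulr_sumr.
rewrite -mulNr mulr_sumr; apply: eq_bigr => p _; rewrite mulr_sumr exchange_big.
apply: eq_bigr => l _; rewrite mulr_sumr; apply: eq_bigr => m _.
by rewrite gC' mulNr.
Qed.

End Quad.

(** * Euler scheme for the Galerkin system *)

Section Euler.
Context {R : realType}.
Local Open Scope complex_scope.
Variable s : R.
Hypothesis s0 : 0 <= s.
Hypothesis s1 : s <= 1.
Implicit Types (k l m : int * int) (a b : int * int -> R[i]).
Local Notation cabs := (@Normc.normc R).
Local Notation fn := (@freq_norm R).
Local Notation Re := (@complex.Re R).
Local Notation quad := (@quad R s).

Ltac nneg := repeat first [ assumption | exact: sqr_ge0 | exact: dlt_ge0 |
  exact: cabs_ge0 | exact: nsq_ge0 | exact: ler0n | exact: ltW | apply: mulr_ge0 | apply: addr_ge0 ].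

Definition supported n a := forall k, k \notin sq n -> a k = 0.

Definition energy n a : R := \sum_(k <- sq n) nsq (a k).

Lemma supported_bnd n a : supported n a -> bnd (nsq \o a) (energy n a).
Proof.
move=> sa N; rewrite /energy (bigID (mem (sq n))) /= [X in _ + X]big1 ?addr0; last first.
  by move=> k /sa ->; exact: nsq0.
rewrite -big_filter.
rewrite (@big_uniq_sub _ _ (sq n) (nsq \o a)) ?filter_uniq ?sq_uniq //; last first.
  by move=> k; rewrite mem_filter => /andP[].
rewrite [leRHS](bigID (mem [seq i <- sq N | i \in sq n])) /= lerDl.
by apply: sumr_ge0 => k _; exact: nsq_ge0.
Qed.

Lemma energy_ge0 n a : 0 <= energy n a.
Proof. by apply: sumr_ge0 => k _; exact: nsq_ge0. Qed.

Definition estep n (h : R) a : int * int -> R[i] :=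
  fun k => if k \in sq n then a k + h%:C * quad n a k else 0.

Lemma estep_supported n h a : supported n (estep n h a).
Proof. by move=> k /negPf kn; rewrite /estep kn. Qed.

Lemma estep_hermitian n h a : hermitian a -> hermitian (estep n h a).
Proof.
move=> ha k; rewrite /estep (mem_sqN n k).
have [kn|kn] := boolP (k \in sq n); last by rewrite conjc0.
rewrite (quadJ _ _ _ ha) ha conjcD conjcM.
by rewrite conjc_real.
Qed.

Definition dsq n : R := \sum_(k <- sq n) fn k ^+ 2 ^+ 2.

Lemma dsq_ge0 n : 0 <= dsq n.
Proof. by apply: sumr_ge0 => k _; exact: sqr_ge0. Qed.

(** In the expansion of |a + h q|^2 the term linear in h sums to 0 by [energy_sum], and |q_k| <=
    |k|^2 E, with E the energy of a, bounds the quadratic term. *)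
Lemma estep_energy n h a : supported n a -> hermitian a ->
  energy n (estep n h a) <= energy n a + h ^+ 2 * dsq n * energy n a ^+ 2.
Proof.
move=> sa ha; rewrite {1}/energy.
have -> : \sum_(k <- sq n) nsq (estep n h a k) =
   energy n a + 2 * h * (\sum_(k <- sq n) Re (conjc (a k) * quad n a k)) +
   h ^+ 2 * \sum_(k <- sq n) nsq (quad n a k).
  rewrite !mulr_sumr -!big_split /= big_seq [RHS]big_seq; apply: eq_bigr => k kn.
  rewrite /estep kn /nsq !ReImE /=; ring.
rewrite energy_sum // mulr0 addr0 lerD2l -mulrA; apply: ler_wpM2l; first exact: sqr_ge0.
rewrite /dsq mulr_suml; apply: ler_sum => k _.
rewrite -cabs_sqr -exprMn.
have E0 := energy_ge0 n a.
rewrite ler_pXn2r ?nnegrE //; [|by nneg..].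
by apply: quad_le => //; exact: supported_bnd.
Qed.

Variable a0 : int * int -> R[i].
Variable M : R.
Hypothesis ha0 : hermitian a0.
Hypothesis a0M : bnd (nsq \o a0) M.
Hypothesis a00 : a0 0 = 0.

Let M0 : 0 <= M := bnd_ge0 (fun k => nsq_ge0 (a0 k)) a0M.
Let M1 : R := M + 1.

(* The explicit Euler step increases the energy by O(h^2); with 1/h = [mesh n]
   the total increase up to time [n] is at most 1. *)
Definition mesh n : nat := ((Num.bound (n%:R * dsq n * (M + 1) ^+ 2)) + n).+1.

Definition hstep n : R := (mesh n)%:R^-1.

Definition trunc_init n : int * int -> R[i] := fun k => if k \in sq n then a0 k else 0.

Definition scheme n j := iter j (estep n (hstep n)) (trunc_init n).

Lemma mesh_gt0 n : 0 < (mesh n)%:R :> R. Proof. by rewrite ltr0n. Qed.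

Lemma hstep_gt0 n : 0 < hstep n. Proof. by rewrite invr_gt0 mesh_gt0. Qed.

Lemma mesh_ge n : n%:R * dsq n * (M + 1) ^+ 2 <= (mesh n)%:R.
Proof.
have D0 := dsq_ge0 n; have h : 0 <= n%:R * dsq n * (M + 1) ^+ 2 by nneg.
have /ltW := archi_boundP h; move/le_trans; apply.
by rewrite ler_nat /mesh (leq_trans (leq_addr n _)).
Qed.

(** The summand [n] in [mesh] provides this explicit rate. *)
Lemma hstep_le n : hstep n <= n.+1%:R^-1.
Proof. by rewrite lef_pV2 ?posrE ?ltr0n // ler_nat /mesh ltnS leq_addl. Qed.

Lemma scheme_supported n j : supported n (scheme n j).
Proof.
case: j => [k /negPf kn|j]; last exact: estep_supported.
by rewrite /scheme /= /trunc_init kn.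
Qed.

Lemma scheme_hermitian n j : hermitian (scheme n j).
Proof.
elim: j => [k|j ih]; last exact: estep_hermitian.
by rewrite /scheme /= /trunc_init mem_sqN; case: ifP => _; rewrite ?ha0 //= oppr0.
Qed.

(** Put D = dsq n (M + 1)^2 and h = [hstep n]. Up to time n there are n / h steps, so the total is
    at most h (n D), and n D <= 1 / h by the choice of [mesh]. *)
Lemma mesh_incr n j : (j <= n * mesh n)%N ->
  j%:R * (hstep n ^+ 2 * dsq n * (M + 1) ^+ 2) <= 1.
Proof.
move=> jn.
have h1 := mesh_ge n; have q0 := mesh_gt0 n; have h0 := hstep_gt0 n.
have jn' : j%:R <= n%:R * (mesh n)%:R :> R by rewrite -natrM ler_nat.
have e : hstep n * (mesh n)%:R = 1 by rewrite mulVf // gt_eqF.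
have D00 := dsq_ge0 n; have D0 : 0 <= dsq n * (M + 1) ^+ 2 by nneg.
rewrite -(mulrA (hstep n ^+ 2)); set D := dsq n * _ in D0 *; rewrite -mulrA -/D in h1.
apply: (@le_trans _ _ ((n%:R * (mesh n)%:R) * (hstep n ^+ 2 * D))).
  by apply: ler_wpM2r => //; nneg.
have -> : n%:R * (mesh n)%:R * (hstep n ^+ 2 * D) = (hstep n * (mesh n)%:R) * hstep n * (n%:R * D) by ring.
rewrite e mul1r -[leRHS]e; apply: ler_wpM2l => //; exact: ltW.
Qed.

(** The bound sustains itself: with [mesh_incr] it keeps the energy below M + 1, and this controls
    the next increment. *)
Lemma scheme_energy n j : (j <= n * mesh n)%N ->
  energy n (scheme n j) <= M + j%:R * (hstep n ^+ 2 * dsq n * (M + 1) ^+ 2).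
Proof.
elim: j => [_|j ih jn].
  rewrite mul0r addr0; apply: le_trans (a0M n); rewrite /energy big_seq [leRHS]big_seq.
  by apply: ler_sum => k kn; rewrite /scheme /= /trunc_init kn.
have {}ih := ih (ltnW jn).
apply: le_trans (estep_energy _ (scheme_supported (n := n) j) (scheme_hermitian n j)) _.
rewrite -natr1 mulrDl mul1r addrA; apply: lerD => //.
apply: ler_wpM2l; first by have := dsq_ge0 n; move=> ?; nneg.
rewrite ler_pXn2r ?nnegrE ?energy_ge0 //; last by rewrite addr_ge0.
apply: le_trans ih _; rewrite lerD2l.
by apply: mesh_incr; exact: ltnW.
Qed.

Lemma scheme_bnd n j : (j <= n * mesh n)%N -> bnd (nsq \o scheme n j) M1.
Proof.
move=> jn N; apply: le_trans (supported_bnd (@scheme_supported n j) N) _.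
apply: le_trans (scheme_energy jn) _; rewrite lerD2l.
exact: mesh_incr.
Qed.

Lemma scheme0 n j : scheme n j 0 = 0.
Proof.
elim: j => [|j ih]; first by rewrite /scheme /= /trunc_init sq0.
by rewrite /scheme iterS -/(scheme n j) /estep sq0 ih quad0 mulr0 addr0.
Qed.

Lemma schemeS n j k : k \in sq n ->
  scheme n j.+1 k = scheme n j k + (hstep n)%:C * quad n (scheme n j) k.
Proof. by move=> kn; rewrite /scheme iterS -/(scheme n j) /estep kn. Qed.

Lemma scheme_lip n j d k : (j + d <= n * mesh n)%N ->
  cabs (scheme n (j + d) k - scheme n j k) <= hstep n * d%:R * (fn k ^+ 2 * M1).
Proof.
have [kn|kn] := boolP (k \in sq n); last first.
  move=> _; rewrite !(scheme_supported _ kn) subrr cabs0.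
  by have h0 := ltW (hstep_gt0 n); rewrite /M1; nneg.
elim: d => [_|d ih jd]; first by rewrite addn0 subrr cabs0 mulr0 mul0r.
rewrite addnS in jd *; have {}ih := ih (ltnW jd).
rewrite schemeS // addrAC; apply: le_trans (cabsD _ _) _.
rewrite -natr1 mulrDr mulr1 mulrDl; apply: lerD => //.
rewrite cabsM cabs_real (gtr0_norm (hstep_gt0 n)); apply: ler_wpM2l.
  exact: ltW (hstep_gt0 n).
by apply: quad_le => //; exact: scheme_bnd (ltnW jd).
Qed.

(** The constant [lip] times the speed at which coefficients in [sq N] can move, at most 2 N^2 M1
    because |l|^2 <= 2 N^2 there. *)
Definition Lip N k : R := lip N k M1 * (2 * N%:R ^+ 2 * M1).

Lemma Lip_ge0 N k : 0 <= Lip N k.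
Proof.
rewrite /Lip /lip /M1; nneg.
Qed.

(** Consistency with the truncation at a fixed [N]: per unit of time the error is the kernel tail
    beyond [N] plus the drift of [quad N] during the interval. Apart from the elapsed time the bound
    is independent of n, so it survives the limit of the schemes. *)
Lemma scheme_diff N n j d k : (N <= n)%N -> k \in sq n -> (j + d <= n * mesh n)%N ->
  cabs (scheme n (j + d) k - scheme n j k - (hstep n * d%:R)%:C * quad N (scheme n j) k)
  <= hstep n * d%:R * (fn k ^+ 2 * dlt s N * M1 + Lip N k * (hstep n * d%:R)).
Proof.
move=> Nn kn; have h0 := ltW (hstep_gt0 n).
have M10 : 0 <= M1 by rewrite /M1 addr_ge0.
elim: d => [_|d ih jd].
  by rewrite addn0 subrr sub0r cabsN mulr0 !mul0r cabs0.
rewrite addnS in jd *; have {}ih := ih (ltnW jd).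
rewrite schemeS //.
have -> : scheme n (j + d) k + (hstep n)%:C * quad n (scheme n (j + d)) k - scheme n j k -
    (hstep n * d.+1%:R)%:C * quad N (scheme n j) k =
  (scheme n (j + d) k - scheme n j k - (hstep n * d%:R)%:C * quad N (scheme n j) k) +
  (hstep n)%:C * ((quad n (scheme n (j + d)) k - quad N (scheme n (j + d)) k) +
    (quad N (scheme n (j + d)) k - quad N (scheme n j) k)).
  by rewrite -natr1 mulrDr mulr1 rmorphD /=; ring.
apply: le_trans (cabsD _ _) _.
set D := fn k ^+ 2 * dlt s N * M1 in ih *; set L := Lip N k in ih *.
set x := hstep n * d%:R in ih *.
have x0 : 0 <= x by rewrite /x; nneg.
have L0 : 0 <= L by exact: Lip_ge0.
have D0 : 0 <= D by rewrite /D; nneg.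
have -> : hstep n * d.+1%:R = x + hstep n by rewrite -natr1 mulrDr mulr1.
suff h : cabs ((hstep n)%:C * ((quad n (scheme n (j + d)) k - quad N (scheme n (j + d)) k) +
    (quad N (scheme n (j + d)) k - quad N (scheme n j) k))) <= hstep n * (D + L * x).
  apply: le_trans (lerD ih h) _.
  have : 0 <= (x + hstep n) * (L * hstep n) by nneg.
  lra.
rewrite cabsM cabs_real ger0_norm //; apply: ler_wpM2l => //.
apply: le_trans (cabsD _ _) _; apply: lerD.
  by apply: quad_tail => //; exact: scheme_bnd (ltnW jd).
have -> : L * x = lip N k M1 * (x * (2 * N%:R ^+ 2 * M1)) by rewrite /L /Lip; ring.
apply: quad_lip => //; first by nneg.
- exact: scheme_bnd (ltnW jd).
- by apply: scheme_bnd; apply: leq_trans (ltnW jd); rewrite leq_addr.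
move=> l lN; apply: le_trans (scheme_lip _ (ltnW jd)) _.
apply: ler_wpM2l => //; apply: ler_wpM2r => //; exact: fn_in.
Qed.

End Euler.

(** * Limit of the schemes *)

(** Compactness gives a cluster point, and a cluster point of an ultrafilter is a limit: otherwise
    the complement of some neighbourhood would belong to the ultrafilter and would have to meet that
    neighbourhood. *)
Lemma ultra_bounded_cvg (R : realType) (U : set_system nat) (UU : UltraFilter U)
    (u : nat -> R) (B : R) :
  (\forall n \near U, `|u n| <= B) -> exists l : R, u @ U --> l.
Proof.
move=> uB; have := @segment_compact R (- B) B (u @ U) _.
have : (u @ U) [set` `[- B, B]].
  by rewrite /fmap /=; apply: filterS uB => n /=; rewrite in_itv /= ler_norml.
move=> uS /(_ _ uS) [p [_ cp]]; exists p => V Vp.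
have [//|Vn] := in_ultra_setVsetC (u @^-1` V) UU.
have [x [/=]] : (~` V) `&` V !=set0 by apply: cp.
by [].
Qed.

Lemma ultra_bounded_ccvg (R : realType) (U : set_system nat) (UU : UltraFilter U)
    (u : nat -> R[i]) (B : R) :
  (\forall n \near U, Normc.normc (u n) <= B) -> exists l, ccvg U u l.
Proof.
move=> uB.
have [x hx] : exists l : R, (fun n => complex.Re (u n)) @ U --> l.
  by apply: (@ultra_bounded_cvg _ _ UU _ B); apply: filterS uB => n; apply: le_trans; exact: cabs_Re.
have [y hy] : exists l : R, (fun n => complex.Im (u n)) @ U --> l.
  by apply: (@ultra_bounded_cvg _ _ UU _ B); apply: filterS uB => n; apply: le_trans; exact: cabs_Im.
by exists (Complex x y).
Qed.

Section Limit.
Context {R : realType}.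
Local Open Scope complex_scope.
Variable s : R.
Hypothesis s0 : 0 <= s.
Hypothesis s1 : s <= 1.
Implicit Types (k l m : int * int) (a b : int * int -> R[i]).
Local Notation cabs := (@Normc.normc R).
Local Notation fn := (@freq_norm R).
Local Notation quad := (@quad R s).
Variable a0 : int * int -> R[i].
Variable M : R.
Hypothesis ha0 : hermitian a0.
Hypothesis a0M : bnd (nsq \o a0) M.
Hypothesis a00 : a0 0 = 0.

Lemma ccvg_quad (T : Type) (F : set_system T) (FF : Filter F) N (f : T -> int * int -> R[i]) a k :
  (forall l, ccvg F (f ^~ l) (a l)) -> ccvg F (fun x => quad N (f x) k) (quad N a k).
Proof.
move=> fa; apply: ccvg_sum => l _; apply: ccvgM; first exact: ccvg_cst.
by apply: ccvgM; exact: fa.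
Qed.

Local Notation mesh := (mesh M).
Local Notation hstep := (hstep M).
(** The scheme as a function of time, constant between grid points. *)
Let appr n (t : R) : int * int -> R[i] := scheme s a0 M n (Num.truncn (t * (mesh n)%:R)).

Lemma mesh_trunc_le n (t : R) : 0 <= t -> t <= n%:R -> (Num.truncn (t * (mesh n)%:R) <= n * mesh n)%N.
Proof.
move=> t0 tn; rewrite truncn_le_nat -natr1 natrM.
by rewrite (@le_lt_trans _ _ (n%:R * (mesh n)%:R)) ?ltrDl // ler_wpM2r.
Qed.

(** All coefficients at all times converge at once along the ultrafilter, without extracting
    subsequences. The equation is recorded as an estimate on forward increments, because the step
    functions satisfy such an estimate uniformly, whereas they have no useful derivative. *)
Lemma galerkin_limit : exists a : R -> int * int -> R[i],
  [/\ forall k, a 0 k = a0 k,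
      forall t, 0 <= t -> [/\ bnd (nsq \o a t) (M + 1), hermitian (a t) & a t 0 = 0],
      forall k t d, 0 <= t -> 0 <= d -> cabs (a (t + d) k - a t k) <= d * (fn k ^+ 2 * (M + 1)) &
      forall N k t d, 0 <= t -> 0 <= d ->
        cabs (a (t + d) k - a t k - d%:C * quad N (a t) k)
        <= d * (fn k ^+ 2 * dlt s N * (M + 1) + Lip M N k * d)].
Proof.
have [U [UU oU]] := ultraFilterLemma (eventually_filter).
have nearU (P : nat -> Prop) : (\forall n \near \oo, P n) -> \forall n \near U, P n.
  exact: oU.
have nT (t : R) : \forall n \near U, t <= n%:R.
  apply: nearU; exists (Num.bound t) => // n /= hn.
  have h : `|t| <= n%:R.
    have /ltW := archi_boundP (normr_ge0 t); rewrite /Num.bound normr_id.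
    by move/le_trans; apply; rewrite ler_nat.
  exact: le_trans (ler_norm _) h.
have aB t : 0 <= t -> \forall n \near U, bnd (nsq \o appr n t) (M + 1).
  move=> t0; apply: filterS (nT t) => n tn; apply: scheme_bnd => //.
  exact: mesh_trunc_le.
have lim_ex (tk : R * (int * int)) :
    exists z : R[i], 0 <= tk.1 -> ccvg U (fun n => appr n tk.1 tk.2) z.
  case: (pselect (0 <= tk.1)) => t0; last by exists 0.
  have [z hz] : exists z : R[i], ccvg U (fun n => appr n tk.1 tk.2) z.
    apply: (@ultra_bounded_ccvg _ _ UU _ (1 + (M + 1))); apply: filterS (aB _ t0) => n h.
    apply: cabs_le1; exact: (bnd_single _ (fun k => nsq_ge0 (appr n tk.1 k)) h).
  by exists z.
have [a' ha'] := choice lim_ex.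
pose a t k := a' (t, k).
have ha t k : 0 <= t -> ccvg U (fun n => appr n t k) (a t k) by move=> t0; exact: (ha' (t, k)).
have h_cvg : (fun n => hstep n) @ U --> (0 : R).
  have : (fun n => hstep n) @ \oo --> (0 : R).
    apply: (@squeeze_cvgr _ _ _ _ (fun=> 0) (fun n => n.+1%:R^-1)).
    - by apply: nearW => n; rewrite hstep_le (ltW (hstep_gt0 _ _)).
    - exact: cvg_cst.
    - exact: cvg_harmonic.
  by apply: cvg_trans; apply: cvg_app.
(* The number of grid steps between t and t + d; multiplied by the step it differs from d by at most
   one step. *)
pose D (t d : R) n := (Num.truncn ((t + d) * (mesh n)%:R) - Num.truncn (t * (mesh n)%:R))%N.
have DE (t d : R) n : 0 <= d -> Num.truncn ((t + d) * (mesh n)%:R) = (Num.truncn (t * (mesh n)%:R) + D t d n)%N.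
  move=> d0; rewrite /D subnKC //; apply: le_truncn; apply: ler_wpM2r => //.
  by rewrite lerDl.
have D_cvg (t d : R) : 0 <= t -> 0 <= d -> (fun n => hstep n * (D t d n)%:R) @ U --> d.
  move=> t0 d0.
  have hb n : d - hstep n <= hstep n * (D t d n)%:R <= d + hstep n.
    have q0 : 0 < (mesh n)%:R :> R by exact: mesh_gt0.
    have h0 := hstep_gt0 M n.
    have e : hstep n * (mesh n)%:R = 1 by rewrite mulVf // gt_eqF.
    have /truncn_itv/andP[l1 l2] : 0 <= t * (mesh n)%:R by rewrite mulr_ge0.
    have /truncn_itv/andP[] : 0 <= (t + d) * (mesh n)%:R by rewrite mulr_ge0 // addr_ge0.
    rewrite DE // -natr1 natrD => l3 l4; rewrite -natr1 in l2.
    set x := (Num.truncn _)%:R in l1 l2 l3 l4; set y := (D t d n)%:R in l3 l4 *.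
    set q := (mesh n)%:R in e q0 l1 l2 l3 l4; set h := hstep n in e h0 *.
    have e1 : d = h * (d * q) by rewrite mulrCA e mulr1.
    apply/andP; split.
      rewrite lerBlDr {1}e1 -[X in _ + X]mulr1 -mulrDr; apply: ler_wpM2l; [exact: ltW|lra].
    rewrite {1}e1 -[X in _ + X]mulr1 -mulrDr; apply: ler_wpM2l; [exact: ltW|lra].
  apply: (@squeeze_cvgr _ _ _ _ (fun n => d - hstep n) (fun n => d + hstep n)).
  - exact: nearW.
  - by rewrite -[X in _ --> X]subr0; apply: cvgB => //; exact: cvg_cst.
  - by rewrite -[X in _ --> X]addr0; apply: cvgD => //; exact: cvg_cst.
exists a; split.
- move=> k; apply: (ccvg_unique (ha 0 k (lexx 0))).
  have : \forall n \near U, appr n 0 k = a0 k.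
    apply: nearU; apply: filterS (near_sq k) => n kn.
    by rewrite /appr mul0r truncn0 /scheme /= /trunc_init kn.
  move=> h; split; apply: cvg_near_cst; by apply: filterS h => n ->.
- move=> t t0; split.
  + move=> N; have h : (fun n => \sum_(k <- sq N) nsq (appr n t k)) @ U --> \sum_(k <- sq N) nsq (a t k).
      by apply: cvg_sumr => k; apply: ccvg_nsq; exact: ha.
    apply: (cvgr_to_le h).
    by apply: filterS (aB _ t0) => n; exact.
  + move=> k; apply: (ccvg_unique (ha t (- k) t0)).
    have -> : (fun n => appr n t (- k)) = (fun n => conjc (appr n t k)).
      by apply/funext => n; exact: scheme_hermitian.
    by apply: ccvgJ; exact: ha.
  + apply: (ccvg_unique (ha t 0 t0)).
    have -> : (fun n => appr n t 0) = (fun=> 0) by apply/funext => n; exact: scheme0.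
    exact: ccvg_cst.
- move=> k t d t0 d0.
  apply: (ccvg_le (F := U) (f := fun n => appr n (t + d) k - appr n t k)
    (u := fun n => hstep n * (D t d n)%:R * (fn k ^+ 2 * (M + 1)))).
  + by apply: ccvgB; apply: ha => //; exact: addr_ge0.
  + by apply: cvgM; [exact: D_cvg|exact: cvg_cst].
  + apply: filterS (nT (t + d)) => n hn; rewrite /appr DE //.
    by apply: scheme_lip => //; rewrite -DE //; apply: mesh_trunc_le => //; exact: addr_ge0.
- move=> N k t d t0 d0.
  apply: (ccvg_le (F := U) (f := fun n => appr n (t + d) k - appr n t k -
      (hstep n * (D t d n)%:R)%:C * quad N (appr n t) k)
    (u := fun n => hstep n * (D t d n)%:R * (fn k ^+ 2 * dlt s N * (M + 1) + Lip M N k * (hstep n * (D t d n)%:R)))).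
  + apply: ccvgB; first by apply: ccvgB; apply: ha => //; exact: addr_ge0.
    apply: ccvgM; first by apply: ccvgR; exact: D_cvg.
    by apply: ccvg_quad => l; exact: ha.
  + apply: cvgM; first exact: D_cvg.
    by apply: cvgD; [exact: cvg_cst|apply: cvgM; [exact: cvg_cst|exact: D_cvg]].
  + have h3 : \forall n \near U, (N <= n)%N /\ k \in sq n.
      apply: nearU; exists (maxn N (maxn `|k.1| `|k.2|))%N => // n /=.
      rewrite geq_max => /andP[-> h]; split=> //; apply: mem_sqW h _; exact: mem_sq_max.
    apply: filterS2 h3 (nT (t + d)) => n [Nn kn] hn; rewrite /appr DE //.
    by apply: scheme_diff => //; rewrite -DE //; apply: mesh_trunc_le => //; exact: addr_ge0.
Qed.

End Limit.

(** * The quadratic term without truncation *)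

Section QuadLimit.
Context {R : realType}.
Local Open Scope complex_scope.
Variable s : R.
Hypothesis s0 : 0 <= s.
Hypothesis s1 : s <= 1.
Implicit Types (k l m : int * int) (a b : int * int -> R[i]).
Local Notation cabs := (@Normc.normc R).
Local Notation fn := (@freq_norm R).
Local Notation quad := (@quad R s).
Local Notation Re := (@complex.Re R).
Local Notation Im := (@complex.Im R).

(** The right-hand side of the infinite system. *)
Definition qlim a k : R[i] :=
  Complex (limn (fun N => Re (quad N a k))) (limn (fun N => Im (quad N a k))).

Lemma ccvg_tannery (f : nat -> int * int -> R[i]) (f' : int * int -> R[i])
    (g : int * int -> R) A (r : nat -> nat) (S : R[i]) :
  (forall N k, cabs (f N k) <= g k) -> bnd g A -> (forall k, ccvg \oo (f ^~ k) (f' k)) ->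
  (forall N, (N <= r N)%N) ->
  ccvg \oo (fun N => \sum_(k <- sq N) f' k) S ->
  ccvg \oo (fun N => \sum_(k <- sq (r N)) f N k) S.
Proof.
move=> fg gA ff' rN [S1 S2]; split; under eq_fun do rewrite ReImE.
  apply: (tannery_cvg (f' := fun k => Re (f' k)) _ gA) => //.
  - by move=> N k; exact: le_trans (cabs_Re _) (fg N k).
  - by move=> k; case: (ff' k).
  - by under eq_fun do rewrite -Re_sum.
apply: (tannery_cvg (f' := fun k => Im (f' k)) _ gA) => //.
- by move=> N k; exact: le_trans (cabs_Im _) (fg N k).
- by move=> k; case: (ff' k).
- by under eq_fun do rewrite -Im_sum.
Qed.

(** The full sum over l converges absolutely, and for each l the constraint that k - l lie in the
    square eventually holds, so the constraint disappears in the limit. *)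
Lemma ccvg_qlim a M k : bnd (nsq \o a) M -> ccvg \oo (fun N => quad N a k) (qlim a k).
Proof.
move=> aM; suff [S [h1 h2]] : exists S, ccvg \oo (fun N => quad N a k) S.
  by split => /=; [rewrite (cvg_lim _ h1)|rewrite (cvg_lim _ h2)].
pose f l := (ker s l (k - l))%:C * (a l * a (k - l)).
pose g l := fn k ^+ 2 * ((nsq (a l) + nsq (a (k - l))) / 2).
have fg l : cabs (f l) <= g l.
  rewrite /f cabsM cabs_real ler_pM ?cabs_ge0 //; last exact: cabs_mul_le.
  exact: ker_sub_le.
have gA : bnd g (fn k ^+ 2 * ((M + M) / 2)).
  apply: bndZ; first exact: sqr_ge0.
  move=> n; rewrite -mulr_suml ler_wpM2r // big_split; apply: lerD; first exact: aM.
  by apply: (bnd_shift k (fun k => nsq_ge0 (a k)) aM); exact: sq_uniq.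
have [S hS] := abs_ccvg fg gA; exists S.
have := @ccvg_tannery (fun N l => if k - l \in sq N then f l else 0) f g _ id S _ gA _ _ hS.
rewrite /quad; under eq_fun do rewrite -big_mkcond; apply => //.
- by move=> N l; case: ifP => // _; rewrite cabs0 (le_trans _ (fg l)) ?cabs_ge0.
- move=> l; have h := near_sq (k - l).
  by split; apply: cvg_near_cst; apply: filterS h => n ->.
Qed.

Lemma qlim_tail a M N k : bnd (nsq \o a) M ->
  cabs (qlim a k - quad N a k) <= fn k ^+ 2 * dlt s N * M.
Proof.
move=> aM; apply: (ccvg_le (F := \oo) (f := fun N' => quad N' a k - quad N a k)
  (u := fun=> fn k ^+ 2 * dlt s N * M)).
- by apply: ccvgB; [exact: ccvg_qlim aM|exact: ccvg_cst].
- exact: cvg_cst.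
- by exists N => // N' /= NN; exact: quad_tail.
Qed.

Lemma qlim_le a M k : bnd (nsq \o a) M -> cabs (qlim a k) <= fn k ^+ 2 * M.
Proof.
move=> aM; apply: (ccvg_le (F := \oo) (f := fun N => quad N a k)
  (u := fun=> fn k ^+ 2 * M)).
- exact: ccvg_qlim aM.
- exact: cvg_cst.
- by apply: nearW => N; exact: quad_le.
Qed.

End QuadLimit.

(* Only forward increments are controlled: the scheme runs forward in time. *)
Lemma is_derive_increment (R : realType) (F G : R -> R) (t : R) : 0 < t ->
  {for t, continuous G} ->
  (forall e, 0 < e -> exists2 eta, 0 < eta & forall u d, 0 <= u -> 0 <= d -> d < eta ->
    `|F (u + d) - F u - d * G u| <= d * e) ->
  is_derive t 1 F (G t).
Proof.
move=> t0 Gt H.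
suff hc : h^-1 *: (F (h *: 1 + t) - F t) @[h --> 0^'] --> G t.
  by apply: DeriveDef; [apply/cvg_ex; exists (G t)|exact: cvg_lim hc].
apply/cvgrPdist_le => e e0.
have e2 : 0 < e / 2 by lra.
have [eta eta0 heta] := H _ e2.
have Gn : \forall h \near 0^', `|G t - G (h + t)| <= e / 2.
  have : (fun h => G (h + t)) @ 0^' --> G t.
    apply: (cvg_comp (fun h => h + t) G _ Gt).
    have : (fun h : R => h + t) @ 0^' --> 0 + t.
      by apply: cvgD; [exact: nbhs_dnbhs|exact: cvg_cst].
    by rewrite add0r.
  by move/cvgrPdist_le => /(_ _ e2).
near=> h; rewrite scaler1.
have h0 : h != 0 by near: h; exact: nbhs_dnbhs_neq.
have hs : `|h| < Num.min eta t.
  by near: h; apply: dnbhs0_lt; rewrite lt_min eta0.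
move: hs; rewrite lt_min => /andP[h1 h2].
have gh : `|G t - G (h + t)| <= e / 2 by near: h.
rewrite /GRing.scale /= distrC -(@ler_pM2l _ `|h|) ?normr_gt0 // -normrM mulrBr mulVKf //.
move: (h0); rewrite neq_lt => /orP[hn|hp].
  (* For h < 0 the forward increment starts at t + h, with slope G (t + h); continuity of [G] at t
     brings the slope back to G t. *)
  have := heta (h + t) (- h); rewrite -[_ + - h]addrAC addrN add0r (ltr0_norm hn) in h1 h2 *.
  move=> /(_ ltac:(lra) ltac:(lra) h1) k1.
  have -> : F (h + t) - F t - h * G t = - (F t - F (h + t) - - h * G (h + t)) + (- h) * (G t - G (h + t)) by ring.
  apply: le_trans (ler_normD _ _) _; rewrite normrN.
  have -> : - h * e = - h * (e / 2) + - h * (e / 2) by field.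
  apply: lerD => //; rewrite normrM ger0_norm; last lra.
  by apply: ler_wpM2l => //; lra.
have := heta t h; rewrite (gtr0_norm hp) in h1 h2 *.
move=> /(_ ltac:(lra) ltac:(lra) h1); rewrite (addrC t) => k1.
apply: le_trans k1 _; apply: ler_wpM2l; lra.
Unshelve. all: by end_near. Qed.

(** * The limit coefficients solve the infinite system *)

Section LimitDerivative.
Context {R : realType}.
Local Open Scope complex_scope.
Variable s : R.
Hypothesis s0 : 0 <= s.
Hypothesis s1 : s <= 1.
Implicit Types (k l m : int * int).
Local Notation cabs := (@Normc.normc R).
Local Notation fn := (@freq_norm R).
Local Notation quad := (@quad R s).
Local Notation qlim := (@qlim R s).
Local Notation Re := (@complex.Re R).
Local Notation Im := (@complex.Im R).
Variable a0 : int * int -> R[i].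
Variable M : R.
Hypothesis ha0 : hermitian a0.
Hypothesis a0M : bnd (nsq \o a0) M.
Hypothesis a00 : a0 0 = 0.

Lemma continuous_lip (f : R -> R) (C : R) :
  (forall t t', `|f t - f t'| <= C * `|t - t'|) -> continuous f.
Proof.
move=> fC t; apply/cvgrPdist_le => e e0.
have C0 : 0 <= C by have := fC 1 0; rewrite subr0 normr1 mulr1; exact: le_trans.
have C1 : 0 < C + 1 by lra.
near=> u; apply: le_trans (fC t u) _.
have h : `|t - u| <= e / (C + 1).
  near: u; apply/nbhs_ballP; exists (e / (C + 1)); first by rewrite /= divr_gt0.
  by move=> u /ltW.
have : C * (e / (C + 1)) <= e by rewrite mulrA ler_pdivrMr // mulrC ler_pM2l //; lra.
apply: le_trans; exact: ler_wpM2l.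
Unshelve. all: by end_near. Qed.

Lemma galerkin_solution : exists a : R -> int * int -> R[i],
  [/\ forall k, a 0 k = a0 k,
      forall t, [/\ bnd (nsq \o a t) (M + 1), hermitian (a t) & a t 0 = 0],
      forall k, continuous (fun t => Re (a t k)) /\ continuous (fun t => Im (a t k)),
      forall k, continuous (fun t => Re (qlim (a t) k)) /\ continuous (fun t => Im (qlim (a t) k)) &
      forall k (t : R), 0 < t -> is_derive t 1 (fun t => Re (a t k)) (Re (qlim (a t) k)) /\
        is_derive t 1 (fun t => Im (a t k)) (Im (qlim (a t) k))].
Proof.
have [a [aini aprop alip adiff]] := galerkin_limit s0 s1 ha0 a0M a00.
have M10 : 0 <= M + 1 by have := bnd_ge0 (fun k => nsq_ge0 (a0 k)) a0M; lra.
(* Constant extension to negative times makes the coefficients continuous on the whole line; the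
   equation is claimed for t > 0 only. *)
pose b t k := a (Num.max 0 t) k.
have b_prop t : [/\ bnd (nsq \o b t) (M + 1), hermitian (b t) & b t 0 = 0].
  by apply: aprop; rewrite le_max lexx.
have b_bnd t : bnd (nsq \o b t) (M + 1) by case: (b_prop t).
have b_lip0 k t t' : t <= t' -> cabs (b t k - b t' k) <= fn k ^+ 2 * (M + 1) * `|t - t'|.
  move=> tt'; rewrite /b; set u := Num.max 0 t; set u' := Num.max 0 t'.
  have u0 : 0 <= u by rewrite le_max lexx.
  have uu : u <= u' /\ u' - u <= `|t - t'|.
    rewrite distrC ger0_norm ?subr_ge0 // /u /u'.
    by rewrite /Num.max; case: ltP => ?; case: ltP => ?; split; lra.
  rewrite -cabsN opprB -[in a u'](subrKC u u').
  apply: le_trans (alip k u (u' - u) u0 _) _; first by rewrite subr_ge0; case: uu.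
  by rewrite mulrC; apply: ler_wpM2l; [rewrite mulr_ge0 ?sqr_ge0|case: uu].
have b_lip k t t' : cabs (b t k - b t' k) <= fn k ^+ 2 * (M + 1) * `|t - t'|.
  have [/b_lip0 //|/ltW/b_lip0] := leP t t'; by rewrite -cabsN opprB distrC.
have b_cont k : continuous (fun t => Re (b t k)) /\ continuous (fun t => Im (b t k)).
  split; apply: (@continuous_lip _ (fn k ^+ 2 * (M + 1))) => t t';
    apply: le_trans (b_lip k t t').
    by rewrite -ReN -ReD cabs_Re.
  by rewrite -ImN -ImD cabs_Im.
have b_ccvg k (t : R) : ccvg (nbhs t) (fun t => b t k) (b t k).
  by split; [exact: (b_cont k).1|exact: (b_cont k).2].
(* A uniform limit of continuous functions: e / 3 for the tail at u, e / 3 for the tail at t, e / 3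
   for the finite sum. *)
have q_ccvg k (t : R) : ccvg (nbhs t) (fun t => qlim (b t) k) (qlim (b t) k).
  apply: cabs_ccvg; apply/cvgrPdist_le => e e0.
  have /cvgrPdist_le /(_ (e / 3)) : (fun N => fn k ^+ 2 * dlt s N * (M + 1)) @ \oo --> (0 : R).
    rewrite -[X in _ --> X](mul0r (M + 1)) -(mulr0 (fn k ^+ 2)).
    apply: cvgM; last exact: cvg_cst.
    by apply: cvgM; [exact: cvg_cst|exact: dlt_cvg0].
  move=> /(_ ltac:(lra)) [N _ /(_ N (leqnn N))] /=; rewrite sub0r normrN => hN.
  have {}hN := le_trans (ler_norm _) hN.
  have : ccvg (nbhs t) (fun u => quad N (b u) k - quad N (b t) k) (quad N (b t) k - quad N (b t) k).
    by apply: ccvgB; [apply: ccvg_quad => l; exact: b_ccvg|exact: ccvg_cst].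
  move/ccvg_cabs.
  rewrite subrr cabs0 => /cvgrPdist_le /(_ (e / 3) ltac:(lra)).
  apply: filterS => u; rewrite !sub0r !normrN !ger0_norm ?cabs_ge0 // => h3.
  have h1 := qlim_tail s0 s1 N k (b_bnd u); have h2 := qlim_tail s0 s1 N k (b_bnd t).
  rewrite -[X in X <= _]/(cabs (qlim (b u) k - qlim (b t) k)).
  have -> : qlim (b u) k - qlim (b t) k = (qlim (b u) k - quad N (b u) k) +
     ((quad N (b u) k - quad N (b t) k) - (qlim (b t) k - quad N (b t) k)) by ring.
  apply: le_trans (cabsD _ _) _; have h4 := cabsB (quad N (b u) k - quad N (b t) k) (qlim (b t) k - quad N (b t) k).
  lra.
exists b; split => //.
- by move=> k; rewrite /b maxxx.
- by move=> k; split=> t; case: (q_ccvg k t).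
have key k e : 0 < e -> exists2 eta, 0 < eta & forall u d, 0 <= u -> 0 <= d -> d < eta ->
    cabs (b (u + d) k - b u k - d%:C * qlim (b u) k) <= d * e.
  move=> e0.
  have /cvgrPdist_le /(_ (e / 3)) : (fun N => fn k ^+ 2 * dlt s N * (M + 1)) @ \oo --> (0 : R).
    rewrite -[X in _ --> X](mul0r (M + 1)) -(mulr0 (fn k ^+ 2)).
    apply: cvgM; last exact: cvg_cst.
    by apply: cvgM; [exact: cvg_cst|exact: dlt_cvg0].
  move=> /(_ ltac:(lra)) [N _ /(_ N (leqnn N))] /=; rewrite sub0r normrN => hN.
  have {}hN := le_trans (ler_norm _) hN.
  have L0 : 0 <= Lip M N k by exact: Lip_ge0 a0M _ _.
  (* With this choice Lip d <= e / 3, and the 1 in the denominator covers Lip = 0. The tails in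
     [adiff] and [qlim_tail] give e / 3 each. *)
  exists (e / (3 * (Lip M N k + 1))); first by rewrite divr_gt0 // mulr_gt0 //; lra.
  move=> u d u0 d0 du.
  have ud : 0 <= u + d by rewrite addr_ge0.
  have h1 := adiff N k u d u0 d0.
  have h2 := qlim_tail s0 s1 N k (b_bnd u).
  have bu v : 0 <= v -> b v = a v by move=> v0; rewrite /b; apply/funext => l; rewrite max_r.
  rewrite !bu // in h2 *.
  have -> : a (u + d) k - a u k - d%:C * qlim (a u) k = (a (u + d) k - a u k - d%:C * quad N (a u) k)
     - d%:C * (qlim (a u) k - quad N (a u) k) by ring.
  apply: le_trans (cabsB _ _) _; rewrite cabsM cabs_real (ger0_norm d0).
  have h3 : Lip M N k * d <= e / 3.
    apply: (@le_trans _ _ (Lip M N k * (e / (3 * (Lip M N k + 1))))).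
      by apply: ler_wpM2l => //; exact: ltW.
    rewrite mulrA ler_pdivrMr; last by lra.
    by nra.
  have h4 : d * cabs (qlim (a u) k - quad N (a u) k) <= d * (e / 3).
    by apply: ler_wpM2l => //; lra.
  have h5 : d * (fn k ^+ 2 * dlt s N * (M + 1) + Lip M N k * d) <= d * (e / 3 + e / 3).
    by apply: ler_wpM2l => //; lra.
  lra.
move=> k t t0; split.
  apply: (@is_derive_increment _ (fun u => Re (b u k)) (fun u => Re (qlim (b u) k))) => //; first by case: (q_ccvg k t).
  move=> e /(key k) [eta eta0 h]; exists eta => // u d u0 d0 de.
  apply: le_trans (h u d u0 d0 de); apply: le_trans (cabs_Re _).
  by rewrite !ReImE /= mul0r subr0.
apply: (@is_derive_increment _ (fun u => Im (b u k)) (fun u => Im (qlim (b u) k))) => //; first by case: (q_ccvg k t).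
move=> e /(key k) [eta eta0 h]; exists eta => // u d u0 d0 de.
apply: le_trans (h u d u0 d0 de); apply: le_trans (cabs_Im _).
by rewrite !ReImE /= mul0r addr0.
Qed.

End LimitDerivative.

(** * Riesz-Fischer with an explicit representative *)

(** Cauchy-Schwarz for the telescoped difference, with weights 2^j and 2^-j. *)
Lemma dyadic_increments (R : realType) (u : nat -> R) (S : R) :
  (forall k, \sum_(j < k) 2 ^+ j * (u j.+1 - u j) ^+ 2 <= S) ->
  forall n m, (u (n + m)%N - u n) ^+ 2 <= 2 * 2^-1 ^+ n * S.
Proof.
move=> H n m.
have S0 : 0 <= S by have := H 0%N; rewrite big_ord0.
pose T k := \sum_(j < k) 2 ^+ j * (u j.+1 - u j) ^+ 2.
(* The form that passes through the induction: the factors are the sums over n <= j < n + m of 2^-j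
   and of the weighted squares. *)
suff : (u (n + m)%N - u n) ^+ 2 <= (2 * (2^-1 ^+ n - 2^-1 ^+ (n + m))) * (T (n + m)%N - T n).
  move/le_trans; apply; apply: ler_pM.
  - by rewrite mulr_ge0 // subr_ge0 exprD ler_piMr ?exprn_ge0 // exprn_ile1 //; lra.
  - rewrite subr_ge0; elim: m => [|m ih]; first by rewrite addn0.
    apply: le_trans ih _; rewrite addnS /T big_ord_recr /= lerDl.
    by apply: mulr_ge0; [exact: exprn_ge0|exact: sqr_ge0].
  - by rewrite ler_wpM2l // gerBl exprn_ge0.
  - apply: le_trans (H (n + m)%N); rewrite gerBl /T sumr_ge0 // => j _.
    by apply: mulr_ge0; [exact: exprn_ge0|exact: sqr_ge0].
elim: m => [|m ih]; first by rewrite addn0 !subrr expr0n mulr0.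
rewrite addnS; set a := u (n + m).+1 - u (n + m)%N.
have -> : u (n + m).+1 - u n = (u (n + m)%N - u n) + a by rewrite /a; ring.
have -> : T (n + m).+1 - T n = (T (n + m)%N - T n) + 2 ^+ (n + m) * a ^+ 2.
  by rewrite /T big_ord_recr /= addrAC.
have -> : 2 * (2^-1 ^+ n - 2^-1 ^+ (n + m).+1) =
    2 * (2^-1 ^+ n - 2^-1 ^+ (n + m)) + 2^-1 ^+ (n + m) :> R by rewrite exprS; field.
set x := u (n + m)%N - u n in ih *; set p := 2 * _ in ih *; set q := T _ - T _ in ih *.
have p0 : 0 <= p.
  by rewrite mulr_ge0 // subr_ge0 exprD ler_piMr ?exprn_ge0 // exprn_ile1 //; lra.
have q0 : 0 <= q.
  rewrite /q subr_ge0; clear; elim: m => [|m ih]; first by rewrite addn0.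
  apply: le_trans ih _; rewrite addnS /T big_ord_recr /= lerDl.
  by apply: mulr_ge0; [exact: exprn_ge0|exact: sqr_ge0].
set y := 2 ^+ (n + m); have y0 : 0 < y by rewrite exprn_gt0.
have -> : 2^-1 ^+ (n + m) = y^-1 by rewrite exprVn.
have e : (p + y^-1) * (q + y * a ^+ 2) = p * q + a ^+ 2 + (p * (y * a ^+ 2) + y^-1 * q).
  by field; rewrite gt_eqF.
rewrite e; suff : 2 * (x * a) <= p * (y * a ^+ 2) + y^-1 * q by nra.
have [q00|qn0] := eqVneq q 0.
  have -> : x = 0 by apply/eqP; rewrite -sqrf_eq0 eq_le sqr_ge0 andbT (le_trans ih) // q00 mulr0.
  rewrite mul0r mulr0 q00 mulr0 addr0; apply: mulr_ge0 => //.
  by apply: mulr_ge0; [exact: ltW|exact: sqr_ge0].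
have h : 0 <= (x * y * a - q) ^+ 2 by exact: sqr_ge0.
have qp : 0 < q by rewrite lt_def qn0.
rewrite -(ler_pM2l (mulr_gt0 y0 qp)).
have -> : y * q * (p * (y * a ^+ 2) + y^-1 * q) = p * q * (y * a) ^+ 2 + q ^+ 2.
  by field; rewrite gt_eqF.
have h2 : x ^+ 2 * (y * a) ^+ 2 <= p * q * (y * a) ^+ 2 by apply: ler_wpM2r => //; exact: sqr_ge0.
nra.
Qed.

Lemma cvg_geo_half (R : realType) (C : R) : (fun n => C * 2^-1 ^+ n) @ \oo --> (0 : R).
Proof.
rewrite -[X in _ --> X](mulr0 C); apply: cvgM; first exact: cvg_cst.
by apply: cvg_expr; rewrite ger0_norm; lra.
Qed.

Lemma dyadic_cvg (R : realType) (u : nat -> R) (S : R) :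
  (forall k, \sum_(j < k) 2 ^+ j * (u j.+1 - u j) ^+ 2 <= S) ->
  cvgn u /\ forall n, (limn u - u n) ^+ 2 <= 2 * 2^-1 ^+ n * S.
Proof.
move=> H; have D := dyadic_increments H.
have cu : cvgn u.
  apply/cauchy_cvgP/cauchy_exP => e e0.
  have /cvgrPdist_lt /(_ (e ^+ 2)) := @cvg_geo_half R (2 * S).
  move=> /(_ ltac:(exact: exprn_gt0)) [N _ /(_ N (leqnn N))] /=.
  rewrite sub0r normrN => hN.
  exists (u N); exists N => // n /= Nn; rewrite /ball /= distrC.
  rewrite -(@ltr_pXn2r _ 2) ?nnegrE ?(ltW e0) // real_normK ?num_real //.
  rewrite -(subnKC Nn); apply: le_lt_trans (D N (n - N)%N) _.
  by apply: le_lt_trans hN; rewrite mulrAC ler_norm.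
split=> // n.
have : (fun m => (u (n + m)%N - u n) ^+ 2) @ \oo --> (limn u - u n) ^+ 2.
  have h : (fun m => u (n + m)%N) @ \oo --> limn u.
    exact: (cvg_comp _ _ (@cvg_addnl n) cu).
  rewrite expr2; under eq_fun do rewrite expr2.
  by apply: cvgM; apply: cvgB => //; exact: cvg_cst.
move/cvgr_to_le; apply; exact: nearW.
Qed.

(** * Square integrable functions on a set of finite measure *)

Section SquareIntegrable.
Context d (T : measurableType d) (R : realType).
Variables (mu : {measure set T -> \bar R}) (D : set T).
Hypothesis mD : measurable D.
Hypothesis finD : (mu D < +oo)%E.
Implicit Types (f g : T -> R).

Definition sqi f := measurable_fun D f /\ mu.-integrable D (EFin \o (fun x => f x ^+ 2)).

Local Notation int f := (\int[mu]_(x in D) f x).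

Lemma bounded_integrable f C : measurable_fun D f -> (forall x, D x -> `|f x| <= C) ->
  mu.-integrable D (EFin \o f).
Proof.
move=> mf fC; apply: measurable_bounded_integrable => //.
exists C; split; first exact: num_real.
by move=> M CM x Dx /=; apply: le_trans (fC x Dx) _; exact: ltW.
Qed.

Lemma integrable_addr f g : mu.-integrable D (EFin \o f) -> mu.-integrable D (EFin \o g) ->
  mu.-integrable D (EFin \o (fun x => f x + g x)).
Proof. by move=> hf hg; have := integrableD mD hf hg. Qed.

Lemma integrable_mulr f c : mu.-integrable D (EFin \o f) ->
  mu.-integrable D (EFin \o (fun x => c * f x)).
Proof. by move=> hf; have := integrableZl mD c hf. Qed.

Lemma sqi_mul f g : sqi f -> sqi g -> mu.-integrable D (EFin \o (fun x => f x * g x)).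
Proof.
move=> [mf f2] [mg g2].
apply: (@le_integrable _ _ _ _ _ mD _ (EFin \o (fun x => f x ^+ 2 + g x ^+ 2))).
- by apply/measurable_EFinP; exact: measurable_funM.
- move=> x Dx; rewrite /= lee_fin [leRHS]ger0_norm ?addr_ge0 ?sqr_ge0 // normrM.
  rewrite -(real_normK (num_real (f x))) -(real_normK (num_real (g x))).
  have := sqr_ge0 (`|f x| - `|g x|); have := normr_ge0 (f x); have := normr_ge0 (g x); nra.
- exact: integrable_addr.
Qed.

Lemma sqi_bounded f C : measurable_fun D f -> (forall x, D x -> `|f x| <= C) -> sqi f.
Proof.
move=> mf fC; split=> //; apply: (@bounded_integrable _ (C ^+ 2)).
  exact: measurable_funX.
move=> x Dx; rewrite normrX; have := fC x Dx; have := normr_ge0 (f x); nra.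
Qed.

Lemma sqi_cst c : sqi (fun=> c).
Proof. by apply: (@sqi_bounded _ `|c|). Qed.

Lemma sqi_integrable f : sqi f -> mu.-integrable D (EFin \o f).
Proof.
move=> hf; have := sqi_mul hf (sqi_cst 1).
by congr (_.-integrable _ _); apply/funext => x /=; rewrite mulr1.
Qed.

Lemma sqiD f g : sqi f -> sqi g -> sqi (fun x => f x + g x).
Proof.
move=> hf hg; split; first by apply: measurable_funD; [case: hf|case: hg].
have -> : EFin \o (fun x => (f x + g x) ^+ 2) =
    EFin \o (fun x => f x ^+ 2 + (g x ^+ 2 + 2 * (f x * g x))).
  by apply/funext => x /=; congr EFin; ring.
apply: integrable_addr; first by case: hf.
apply: integrable_addr; first by case: hg.
by apply: integrable_mulr; exact: sqi_mul.
Qed.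

Lemma sqi_bmul f g C : sqi f -> measurable_fun D g -> (forall x, D x -> `|g x| <= C) ->
  sqi (fun x => f x * g x).
Proof.
move=> [mf f2] mg gC; split; first exact: measurable_funM.
apply: (@le_integrable _ _ _ _ _ mD _ (EFin \o (fun x => C ^+ 2 * f x ^+ 2))).
- by apply/measurable_EFinP/measurable_funX; exact: measurable_funM.
- move=> x Dx; rewrite /= lee_fin normrX normrM exprMn normrM !normrX.
  rewrite (mulrC (`|f x| ^+ 2)); apply: ler_wpM2r; first exact: sqr_ge0.
  have := gC x Dx; have := normr_ge0 (g x); have := ler_norm C; nra.
- exact: integrable_mulr.
Qed.

Lemma sqiZ f c : sqi f -> sqi (fun x => c * f x).
Proof.
move=> hf; under eq_fun do rewrite mulrC.
by apply: (@sqi_bmul _ _ `|c|).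
Qed.

Lemma sqiB f g : sqi f -> sqi g -> sqi (fun x => f x - g x).
Proof.
move=> hf /(sqiZ (-1)) hg; under eq_fun do rewrite -mulN1r.
exact: sqiD.
Qed.

Lemma sqi_sum (I : Type) (s : seq I) (F : I -> T -> R) :
  (forall i, sqi (F i)) -> sqi (fun x => \sum_(i <- s) F i x).
Proof.
move=> hF; elim: s => [|i s ih].
  by under eq_fun do rewrite big_nil; exact: sqi_cst.
by under eq_fun do rewrite big_cons; exact: sqiD.
Qed.

Lemma Rintegral_sum (I : Type) (s : seq I) (F : I -> T -> R) :
  (forall i, mu.-integrable D (EFin \o F i)) ->
  int (fun x => \sum_(i <- s) F i x) = \sum_(i <- s) int (F i).
Proof.
move=> hF; elim: s => [|i s ih].
  rewrite big_nil; under eq_Rintegral do rewrite big_nil.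
  by rewrite Rintegral_cst // mul0r.
rewrite big_cons -ih; under eq_Rintegral do rewrite big_cons.
rewrite RintegralD //.
have -> : EFin \o (fun x => \sum_(j <- s) F j x) = (fun x => \sum_(i <- s) (EFin \o F i) x)%E.
  by apply/funext => x /=; rewrite sumEFin.
exact: integrable_sum.
Qed.

(** The polynomial A + 2 t X + t^2 B is the integral of (f + t g)^2, hence nonnegative; it is
    evaluated at its minimum t = - X / B. *)
Lemma sqi_cauchy_schwarz f g : sqi f -> sqi g ->
  (int (fun x => f x * g x)) ^+ 2 <= int (fun x => f x ^+ 2) * int (fun x => g x ^+ 2).
Proof.
move=> hf hg; set A := int (fun x => f x ^+ 2); set B := int (fun x => g x ^+ 2).
set X := int (fun x => f x * g x).
have H t : 0 <= A + 2 * t * X + t ^+ 2 * B.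
  have -> : A + 2 * t * X + t ^+ 2 * B = int (fun x => (f x + t * g x) ^+ 2).
    transitivity (int (fun x => f x ^+ 2 + ((2 * t) * (f x * g x) + t ^+ 2 * g x ^+ 2))).
      have i1 := sqi_mul hf hg.
      have i2 : mu.-integrable D (EFin \o (fun x => g x ^+ 2)) by case: hg.
      have i3 : mu.-integrable D (EFin \o (fun x => f x ^+ 2)) by case: hf.
      rewrite RintegralD //; last by apply: integrable_addr; exact: integrable_mulr.
      rewrite RintegralD //; [|exact: integrable_mulr..].
      by rewrite !RintegralZl // addrA.
    by apply: eq_Rintegral => x _; ring.
  by apply: Rintegral_ge0 => x _; exact: sqr_ge0.
have B0 : 0 <= B by apply: Rintegral_ge0 => x _; exact: sqr_ge0.
have [B00|Bn0] := eqVneq B 0.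
  rewrite B00 mulr0; have [->|Xn0] := eqVneq X 0; first by rewrite expr0n.
  (* For B = 0 and X nonzero the polynomial is linear, and at this t it would equal -1. *)
  have := H (- (A + 1) / (2 * X)); rewrite B00 mulr0 addr0.
  have -> : 2 * (- (A + 1) / (2 * X)) * X = - (A + 1) by field.
  by lra.
have Bp : 0 < B by rewrite lt_def Bn0.
have := H (- X / B).
have -> : A + 2 * (- X / B) * X + (- X / B) ^+ 2 * B = A - X ^+ 2 / B by field.
by rewrite subr_ge0 ler_pdivrMr.
Qed.

Lemma sqi_cvg f (u : nat -> T -> R) g : sqi f -> (forall n, sqi (u n)) -> sqi g ->
  (fun n => int (fun x => (f x - u n x) ^+ 2)) @ \oo --> (0 : R) ->
  (fun n => int (fun x => u n x * g x)) @ \oo --> int (fun x => f x * g x).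
Proof.
move=> hf hu hg h; apply/cvgrPdist_le => e e0.
set B := int (fun x => g x ^+ 2).
have B0 : 0 <= B by apply: Rintegral_ge0 => x _; exact: sqr_ge0.
have e1 : 0 < e ^+ 2 / (B + 1) by rewrite divr_gt0 ?exprn_gt0 //; lra.
move/cvgrPdist_le : h => /(_ _ e1); apply: filterS => n; rewrite sub0r normrN => hn.
have {}hn := le_trans (ler_norm _) hn.
rewrite -RintegralB //; [|exact: sqi_mul..].
rewrite (@eq_Rintegral _ _ _ _ _ (fun x => (f x - u n x) * g x)); last by move=> x _; ring.
rewrite -(@ler_pXn2r _ 2) ?nnegrE ?(ltW e0) // real_normK ?num_real //.
apply: le_trans (sqi_cauchy_schwarz (sqiB hf (hu n)) hg) _; rewrite -/B.
apply: (@le_trans _ _ (e ^+ 2 / (B + 1) * B)); first exact: ler_wpM2r.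
rewrite mulrAC ler_pdivrMr; last lra.
have := sqr_ge0 e; nra.
Qed.

(** The upper limit is defined at every point and measurable without any assumption of convergence;
    where the sequence converges it is the limit. *)
Definition esup_lim (u : nat -> T -> R) (x : T) : R := fine (limn_esup (fun n => (u n x)%:E)).

Lemma esup_lim_measurable u : (forall n, measurable_fun D (u n)) -> measurable_fun D (esup_lim u).
Proof.
move=> mu_; apply: (@measurableT_comp _ _ _ _ _ _ fine) => //.
by apply: measurable_fun_limn_esup => n; exact/measurable_EFinP.
Qed.

(** The functions 2^n (u_{n+1} - u_n)^2 have integrals at most 4^-n, so their sum S is integrable,
    hence finite almost everywhere. There [dyadic_cvg] gives convergence with squared error at most
    2 2^-n S, and the integral of S is at most 2. *)
Lemma riesz_fischer (u : nat -> T -> R) : (forall n, sqi (u n)) ->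
  (forall n, int (fun x => (u n.+1 x - u n x) ^+ 2) <= 8^-1 ^+ n) ->
  sqi (esup_lim u) /\ forall n, int (fun x => (esup_lim u x - u n x) ^+ 2) <= 4 * 2^-1 ^+ n.
Proof.
move=> hu du.
have mf : measurable_fun D (esup_lim u) by apply: esup_lim_measurable => n; case: (hu n).
pose v n x : \bar R := (2 ^+ n * (u n.+1 x - u n x) ^+ 2)%:E.
have v0 n x : (0 <= v n x)%E by rewrite lee_fin; apply: mulr_ge0; [exact: exprn_ge0|exact: sqr_ge0].
have mv n : measurable_fun D (v n).
  apply/measurable_EFinP/measurable_funM => //; apply: measurable_funX.
  by apply: measurable_funB; [case: (hu n.+1)|case: (hu n)].
have iv n : (\int[mu]_(x in D) v n x <= (4^-1 ^+ n)%:E)%E.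
  rewrite /v; under eq_integral do rewrite EFinM.
  have [_ iu] := sqiB (hu n.+1) (hu n).
  rewrite integralZl // -[X in (_ * X)%E]fineK; last exact: integrable_fin_num.
  rewrite -EFinM lee_fin (_ : 4^-1 = 2 * 8^-1 :> R); last by field.
  by rewrite exprMn; apply: ler_wpM2l; [rewrite exprn_ge0|exact: du].
pose S x : \bar R := (\sum_(n <oo) v n x)%E.
have S0 x : (0 <= S x)%E by apply: nneseries_ge0.
have mS : measurable_fun D S by apply: ge0_emeasurable_sum => //.
have iS : (\int[mu]_(x in D) S x <= 2%:E)%E.
  rewrite integral_nneseries //; apply: lime_le.
    by apply: is_cvg_nneseries => n _ _; apply: integral_ge0.
  apply: nearW => n.
  apply: (@le_trans _ _ (\sum_(0 <= i < n) (4^-1 ^+ i)%:E)%E).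
    by apply: lee_sum.
  rewrite sumEFin lee_fin.
  have := @geometric_le_lim R n 1 4^-1; rewrite /series /geometric /=.
  under eq_bigr do rewrite mul1r.
  move=> /(_ ltac:(lra) ltac:(lra) ltac:(rewrite ger0_norm; lra)) /le_trans; apply.
  by rewrite ler_pdivrMr; lra.
have intS : mu.-integrable D S.
  apply/integrableP; split => //; under eq_integral do rewrite gee0_abs //.
  by rewrite (le_lt_trans iS) // ltry.
have key n : {ae mu, forall x, D x ->
    (((esup_lim u x - u n x) ^+ 2)%:E <= (2 * 2^-1 ^+ n)%:E * S x)%E}.
  have := integrable_ae mD intS; apply: filterS => x hx Dx.
  have Sx := hx Dx.
  have H k : \sum_(j < k) 2 ^+ j * (u j.+1 x - u j x) ^+ 2 <= fine (S x).
    rewrite -lee_fin fineK // -sumEFin -(big_mkord xpredT (fun j => (2 ^+ j * (u j.+1 x - u j x) ^+ 2)%:E)).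
    by apply: (@nneseries_lim_ge R (v ^~ x) xpredT 0%N k) => j _ _; exact: v0.
  have [cu hl] := @dyadic_cvg R (u ^~ x) _ H.
  have -> : esup_lim u x = limn (fun n => u n x).
    have cE : (fun n => (u n x)%:E) @ \oo --> (limn (fun n => u n x))%:E.
      by apply: cvg_EFin; [exact: nearW|exact: cu].
    rewrite /esup_lim is_cvg_limn_esupE; last by apply/cvg_ex; eexists; exact: cE.
    by rewrite (cvg_lim _ cE).
  by rewrite -(fineK Sx) -EFinM lee_fin.
have bound n : (\int[mu]_(x in D) ((esup_lim u x - u n x) ^+ 2)%:E <= (4 * 2^-1 ^+ n)%:E)%E.
  apply: (@le_trans _ _ (\int[mu]_(x in D) ((2 * 2^-1 ^+ n)%:E * S x))%E).
    apply: ae_ge0_le_integral => //.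
    - by move=> x _; rewrite lee_fin sqr_ge0.
    - apply/measurable_EFinP/measurable_funX; apply: measurable_funB => //.
      by case: (hu n).
    - by move=> x _; rewrite mule_ge0 // lee_fin mulr_ge0 ?exprn_ge0.
    - exact: measurable_funeM.
  have c0 : 0 <= 2 * 2^-1 ^+ n :> R by rewrite mulr_ge0 ?exprn_ge0.
  rewrite ge0_integralZl //.
  rewrite (_ : 4 * _ = 2 * 2^-1 ^+ n * 2); last by ring.
  by rewrite [X in (_ <= X)%E]EFinM; apply: lee_wpmul2l.
have hsub n : sqi (fun x => esup_lim u x - u n x).
  have m1 : measurable_fun D (fun x => esup_lim u x - u n x).
    by apply: measurable_funB => //; case: (hu n).
  split=> //; apply/integrableP; split; first exact/measurable_EFinP/measurable_funX.
  under eq_integral do rewrite /= ger0_norm ?sqr_ge0 //.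
  by apply: le_lt_trans (bound n) _; rewrite ltry.
split.
  have := sqiD (hsub 0%N) (hu 0%N); congr (sqi _); apply/funext => x; by rewrite subrK.
move=> n; rewrite -lee_fin /Rintegral fineK; first exact: bound.
by case: (hsub n) => _ /(integrable_fin_num mD).
Qed.

End SquareIntegrable.

(** * Fourier series on the box *)

Lemma cvg_pairR (T : Type) (U V : topologicalType) (F : set_system T) (FF : Filter F)
    (f : T -> U) (g : T -> V) (x : U) (y : V) :
  f @ F --> x -> g @ F --> y -> (fun t => (f t, g t)) @ F --> (x, y).
Proof. move=> fx gy; exact: (cvg_pair fx gy). Qed.

Section Box.
Context {R : realType}.
Local Notation mR := (measurableTypeR R).
Local Notation mu := (@leb2 R).
Local Notation bx := (@box R).
Local Notation leb := (@lebesgue_measure R).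
Implicit Types (f g : R * R -> R).

(** Measurability is for the product of the two sigma-algebras. Rounding the first variable down to
    multiples of 1/(n + 1) gives functions that, on each of countably many strips, depend
    continuously on the second variable alone; they converge pointwise to [f]. *)
Lemma continuous_measurable_prod f : continuous f -> measurable_fun (setT : set (mR * mR)) f.
Proof.
move=> cf; pose rnd n (x : R) : R := (Num.floor (n.+1%:R * x))%:~R / n.+1%:R.
have rnd_cvg x : (fun n => rnd n x) @ \oo --> x.
  have hb n : x - n.+1%:R^-1 <= rnd n x <= x.
    have n0 : 0 < n.+1%:R :> R by rewrite ltr0n.
    have /andP[h1 h2] := floor_itv (n.+1%:R * x).
    rewrite /rnd ler_pdivrMr // ler_pdivlMr // mulrBl mulVf ?gt_eqF // (mulrC x) h1 andbT.
    by rewrite intrD in h2; lra.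
  apply: (@squeeze_cvgr _ _ _ _ (fun n => x - n.+1%:R^-1) (fun=> x)).
  - exact: nearW.
  - rewrite -[X in _ --> X]subr0; apply: cvgB; [exact: cvg_cst|exact: cvg_harmonic].
  - exact: cvg_cst.
apply: (@measurable_fun_cvg _ _ _ _ (fun n z => f (rnd n z.1, z.2))); last first.
  move=> [x y] _; have h : (fun n => (rnd n x, y)) @ \oo --> (x, y).
    by apply: cvg_pairR; [exact: rnd_cvg|exact: cvg_cst].
  exact: (cvg_comp _ _ h (cf (x, y))).
move=> n _ Y mY; rewrite setTI.
have -> : (fun z => f (rnd n z.1, z.2)) @^-1` Y =
  \bigcup_(j : int) ([set x : R | Num.floor (n.+1%:R * x) = j] `*` [set y : R | Y (f (j%:~R / n.+1%:R, y))]).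
  apply/seteqP; split=> [[x y] /= h|[x y] [j _] [/= hj h]].
    by exists (Num.floor (n.+1%:R * x)).
  by rewrite /= /rnd hj.
apply: countable_bigcupT_measurable => // j; apply: measurableX.
  have -> : [set x : R | Num.floor (n.+1%:R * x) = j] = `[j%:~R / n.+1%:R, (j + 1)%:~R / n.+1%:R[%classic.
    have n0 : 0 < n.+1%:R :> R by rewrite ltr0n.
    apply/seteqP; split=> x /=.
      by rewrite in_itv /= ler_pdivrMr // ltr_pdivlMr // mulrC => <-; exact: floor_itv.
    by rewrite in_itv /= ler_pdivrMr // ltr_pdivlMr // mulrC => h; exact: floor_def.
  exact: measurable_itv.
have cg : continuous (fun y : R => f (j%:~R / n.+1%:R, y)).
  move=> y; apply: (cvg_comp (fun y : R => (j%:~R / n.+1%:R, y)) f); last exact: cf.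
  by apply: cvg_pairR; [exact: cvg_cst|exact: cvg_id].
by have := continuous_measurable_fun cg measurableT mY; rewrite setTI.
Qed.

Lemma measurable_box : measurable (bx : set (mR * mR)).
Proof. by apply: measurableX; exact: measurable_itv. Qed.

Lemma twopi_gt0 : 0 < 2 * pi :> R.
Proof. by rewrite mulr_gt0 ?pi_gt0. Qed.

Lemma leb2_box : mu bx = ((2 * pi) ^+ 2)%:E.
Proof.
rewrite /leb2 /= product_measure1E; [|exact: measurable_itv..].
by rewrite /= !lebesgue_measure_itv /= lte_fin twopi_gt0 oppr0 adde0 -EFinM expr2.
Qed.

Lemma leb2_box_fin : (mu bx < +oo)%E.
Proof. by rewrite leb2_box ltry. Qed.

Lemma int_box_cst (c : R) : int_box (fun=> c) = c * (2 * pi) ^+ 2.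
Proof. by rewrite /int_box Rintegral_cst ?leb2_box //; exact: measurable_box. Qed.

Definition sqb f := sqi mu bx f.

Lemma L2P f : L2 f <-> sqb f.
Proof.
have mB := measurable_box; split=> [h|[mf i2]].
  have := h; rewrite /L2 inE => /andP[]; rewrite !inE /= => mf _.
  split; first exact/(measurable_restrictT _ mB).
  have := Lfun2_integrable_sqr h.
  rewrite (integrable_mkcond _ mB); congr (_.-integrable _ _); apply/funext => x.
  by rewrite /= /patch; case: ifP => //= _; rewrite expr0n.
rewrite /L2 inE; apply/andP; split; rewrite inE /=.
  exact/(measurable_restrictT _ mB).
rewrite /finite_norm unlock poweR_lty //.
move/(integrable_mkcond _ mB) : i2 => /integrableP[_].
apply: le_lt_trans; rewrite le_eqVlt; apply/orP; left; apply/eqP; apply: eq_integral => x _.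
rewrite /= /patch; case: ifP => /= _; last by rewrite normr0 powR0 // normr0.
by rewrite powR_mulrn // normrX.
Qed.

Lemma norm2_le f (M : R) : sqb f -> int_box (fun x => f x ^+ 2) <= M ->
  (norm2 f <= (Num.sqrt M)%:E)%E.
Proof.
have mB := measurable_box; move=> [mf i2] fM; rewrite /norm2 unlock.
have -> : (\int[mu]_x `|(EFin \o f \_ bx) x| `^ 2 = (int_box (fun x => f x ^+ 2))%:E)%E.
  rewrite /int_box /Rintegral fineK; last exact: integrable_fin_num.
  rewrite [RHS]integral_mkcond; apply: eq_integral => x _.
  rewrite /= /patch; case: ifP => /= _; last by rewrite normr0 powR0.
  by rewrite powR_mulrn // -normrX ger0_norm ?sqr_ge0.
have I0 : 0 <= int_box (fun x => f x ^+ 2) by apply: Rintegral_ge0 => x _; exact: sqr_ge0.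
rewrite poweR_EFin lee_fin powR12_sqrt //.
exact: ler_wsqrtr.
Qed.

Lemma continuous_box_bounded f : continuous f -> exists C, forall x, bx x -> `|f x| <= C.
Proof.
move=> cf.
have cb : compact bx by apply: compact_setX; exact: segment_compact.
have /compact_bounded [M [_ hM]] : compact (f @` bx).
  by apply: continuous_compact => //; exact: continuous_subspaceT.
exists (M + 1) => x bxx; apply: (hM (M + 1)); first by rewrite ltrDl.
by exists x.
Qed.

Lemma continuous_meas f : continuous f -> measurable_fun bx f.
Proof. by move=> /continuous_measurable_prod; exact: measurable_funS. Qed.

Lemma continuous_sqb f : continuous f -> sqb f.
Proof.
move=> cf; have [C hC] := continuous_box_bounded cf.
apply: (sqi_bounded measurable_box leb2_box_fin _ hC); exact: continuous_meas.
Qed.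

Lemma FTC_periodic (F f : R -> R) : continuous f ->
  (forall x : R, is_derive x (1 : R) F (f x)) -> F (2 * pi) = F 0 ->
  (\int[leb]_(x in `[0%R, (2 * pi)%R]) (f x)%:E = 0)%E.
Proof.
move=> cf dF per; have cF : continuous F.
  by move=> x; apply/differentiable_continuous/derivable1_diffP; case: (dF x).
rewrite (@continuous_FTC2 _ f F) ?twopi_gt0 //.
- by rewrite per subee.
- exact: continuous_subspaceT.
- split=> [x _||]; first by case: (dF x).
  + by apply: cvg_at_right_filter; exact: cF.
  + by apply: cvg_at_left_filter; exact: cF.
- by move=> x _; rewrite derive1E; case: (dF x).
Qed.

Lemma int_box_iter1 g : continuous g ->
  (forall y, (\int[leb]_(x in `[0%R, (2 * pi)%R]) (g (x, y))%:E = 0)%E) -> int_box g = 0.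
Proof.
move=> cg g0; have mB := measurable_box.
have := sqi_integrable mB leb2_box_fin (continuous_sqb cg) => /(integrable_mkcond _ mB) ig.
rewrite /int_box /Rintegral integral_mkcond.
have /= <- := integral21_prod_meas1 ig.
rewrite integral0_eq // => y _; rewrite /fubini_G.
have [yb|yb] := boolP (y \in `[0, 2 * pi]%R); last first.
  rewrite integral0_eq // => x _; rewrite /patch; case: ifP => //.
  by rewrite inE /= => -[_ h]; case/negP: yb.
rewrite -[RHS](g0 y) [RHS]integral_mkcond; apply: eq_integral => x _.
rewrite /patch; congr (if _ then _ else _).
apply/idP/idP; rewrite !inE /=; first by case.
by move=> ?; split.
Qed.

Lemma int_box_iter2 g : continuous g ->
  (forall x, (\int[leb]_(y in `[0%R, (2 * pi)%R]) (g (x, y))%:E = 0)%E) -> int_box g = 0.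
Proof.
move=> cg g0; have mB := measurable_box.
have := sqi_integrable mB leb2_box_fin (continuous_sqb cg) => /(integrable_mkcond _ mB) ig.
rewrite /int_box /Rintegral integral_mkcond.
have /= <- := integral12_prod_meas1 ig.
rewrite integral0_eq // => x _; rewrite /fubini_F.
have [xb|xb] := boolP (x \in `[0, 2 * pi]%R); last first.
  rewrite integral0_eq // => y _; rewrite /patch; case: ifP => //.
  by rewrite inE /= => -[h _]; case/negP: xb.
rewrite -[RHS](g0 x) [RHS]integral_mkcond; apply: eq_integral => y _.
rewrite /patch; congr (if _ then _ else _).
apply/idP/idP; rewrite !inE /=; first by case.
by move=> ?; split.
Qed.

Lemma continuous_sect1 g y : continuous g -> continuous (fun x => g (x, y)).
Proof.
move=> cg x; apply: (cvg_comp (fun x : R => (x, y)) g); last exact: cg.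
by apply: cvg_pairR; [exact: cvg_id|exact: cvg_cst].
Qed.

Lemma continuous_sect2 g x : continuous g -> continuous (fun y => g (x, y)).
Proof.
move=> cg y; apply: (cvg_comp (fun y : R => (x, y)) g); last exact: cg.
by apply: cvg_pairR; [exact: cvg_cst|exact: cvg_id].
Qed.

Lemma int_box_d1 (h g : R * R -> R) : continuous g ->
  (forall x y : R, is_derive x (1 : R) (fun u => h (u, y)) (g (x, y))) ->
  (forall y, h (2 * pi, y) = h (0, y)) -> int_box g = 0.
Proof.
move=> cg dh per; apply: int_box_iter1 => // y.
by apply: (@FTC_periodic (fun u => h (u, y))) => //; exact: continuous_sect1.
Qed.

Lemma int_box_d2 (h g : R * R -> R) : continuous g ->
  (forall x y : R, is_derive y (1 : R) (fun u => h (x, u)) (g (x, y))) ->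
  (forall x, h (x, 2 * pi) = h (x, 0)) -> int_box g = 0.
Proof.
move=> cg dh per; apply: int_box_iter2 => // x.
by apply: (@FTC_periodic (fun u => h (x, u))) => //; exact: continuous_sect2.
Qed.

End Box.

(** * Fourier coefficients and the integrals of exponentials *)

Section Fourier.
Context {R : realType}.
Local Open Scope complex_scope.
Implicit Types (f g : R * R -> R) (k l m : int * int) (a b : int * int -> R[i]).

Definition vol : R := (2 * pi) ^+ 2.

Definition phase k (x : R * R) : R := k.1%:~R * x.1 + k.2%:~R * x.2.

Definition ck k (x : R * R) : R := cos (phase k x).
Definition sk k (x : R * R) : R := sin (phase k x).

Let mB := @measurable_box R.
Let fB := @leb2_box_fin R.

Lemma vol_gt0 : 0 < vol. Proof. by rewrite exprn_gt0 // twopi_gt0. Qed.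

Lemma phaseD k l x : phase (k + l) x = phase k x + phase l x.
Proof. rewrite /phase /= !intrD; ring. Qed.

Lemma phaseN k x : phase (- k) x = - phase k x.
Proof. rewrite /phase /= !mulrNz; ring. Qed.

Lemma phase0 x : phase 0 x = 0.
Proof. by rewrite /phase /= !mul0r addr0. Qed.

Lemma continuous_phase k : continuous (phase k).
Proof.
move=> x; apply: cvgD; apply: cvgM; try exact: cvg_cst.
  exact: cvg_fst.
exact: cvg_snd.
Qed.

Lemma continuous_ck k : continuous (ck k).
Proof. by move=> x; apply: continuous_comp; [exact: continuous_phase|exact: continuous_cos]. Qed.

Lemma continuous_sk k : continuous (sk k).
Proof. by move=> x; apply: continuous_comp; [exact: continuous_phase|exact: continuous_sin]. Qed.

Lemma sqb_ck f k : sqb f -> sqb (fun x => f x * ck k x).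
Proof.
move=> hf; apply: (@sqi_bmul _ _ _ _ _ mB f (ck k) 1) => //; first exact: continuous_meas (continuous_ck (k := k)).
by move=> x _; exact: cos_max.
Qed.

Lemma sqb_sk f k : sqb f -> sqb (fun x => f x * sk k x).
Proof.
move=> hf; apply: (@sqi_bmul _ _ _ _ _ mB f (sk k) 1) => //; first exact: continuous_meas (continuous_sk (k := k)).
by move=> x _; exact: sin_max.
Qed.

Lemma fourierE f k : fourier f k =
  Complex (vol^-1 * int_box (fun x => f x * ck k x)) (- (vol^-1 * int_box (fun x => f x * sk k x))).
Proof.
rewrite /fourier -/vol; set A := int_box _; set B := int_box _.
by apply: complexP; rewrite ?ReM ?ImM /= ?mul0r ?subr0 ?addr0 ?mulrN.
Qed.

Lemma int_boxD f g : sqb f -> sqb g -> int_box (fun x => f x + g x) = int_box f + int_box g.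
Proof. by move=> hf hg; apply: RintegralD => //; exact: sqi_integrable. Qed.

Lemma int_boxZ c f : sqb f -> int_box (fun x => c * f x) = c * int_box f.
Proof. by move=> hf; apply: RintegralZl => //; exact: sqi_integrable. Qed.

Lemma int_box_sum (I : Type) (s : seq I) (F : I -> R * R -> R) :
  (forall i, sqb (F i)) -> int_box (fun x => \sum_(i <- s) F i x) = \sum_(i <- s) int_box (F i).
Proof. by move=> hF; apply: Rintegral_sum => // i; exact: (sqi_integrable mB fB (hF i)). Qed.

Lemma eq_int_box f g : (forall x, f x = g x) -> int_box f = int_box g.
Proof. by move=> fg; apply: eq_Rintegral => x _; exact: fg. Qed.

Lemma fourierD f g k : sqb f -> sqb g ->
  fourier (fun x => f x + g x) k = fourier f k + fourier g k.
Proof.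
move=> hf hg; rewrite !fourierE; apply: complexP; rewrite /= -?opprD -mulrDr -int_boxD.
- by congr (_ * _); apply: eq_int_box => x; rewrite mulrDl.
- exact: sqb_ck.
- exact: sqb_ck.
- by congr (- (_ * _)); apply: eq_int_box => x; rewrite mulrDl.
- exact: sqb_sk.
- exact: sqb_sk.
Qed.

Lemma fourierZ c f k : sqb f -> fourier (fun x => c * f x) k = c%:C * fourier f k.
Proof.
move=> hf; rewrite !fourierE; apply: complexP; rewrite ?ReM ?ImM /= ?mul0r ?subr0 ?addr0 ?mulrN.
  rewrite [RHS]mulrCA -(int_boxZ c (sqb_ck k hf)).
  by congr (_ * _); apply: eq_int_box => x; rewrite mulrA.
rewrite [X in _ = - X]mulrCA -(int_boxZ c (sqb_sk k hf)).
by congr (- (_ * _)); apply: eq_int_box => x; rewrite mulrA.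
Qed.

Lemma eq_fourier f g k : (forall x, f x = g x) -> fourier f k = fourier g k.
Proof. by move=> fg; have -> : f = g by apply/funext. Qed.

Lemma fourierB f g k : sqb f -> sqb g ->
  fourier (fun x => f x - g x) k = fourier f k - fourier g k.
Proof.
move=> hf hg; rewrite -[- fourier g k]mulN1r.
have -> : -1 = (-1)%:C :> R[i] by rewrite rmorphN.
rewrite -fourierZ // -fourierD //; last exact: sqiZ.
by apply: eq_fourier => x; rewrite mulN1r.
Qed.

Lemma fourier_sum (I : Type) (s : seq I) (F : I -> R * R -> R) k :
  (forall i, sqb (F i)) -> fourier (fun x => \sum_(i <- s) F i x) k = \sum_(i <- s) fourier (F i) k.
Proof.
move=> hF; elim: s => [|i s ih].
  rewrite big_nil (@eq_fourier _ (fun=> 0 * 1)); last by move=> x; rewrite big_nil mul0r.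
  by rewrite fourierZ ?mul0r //; exact: sqi_cst.
rewrite big_cons -ih -fourierD //; last exact: sqi_sum.
by apply: eq_fourier => x; rewrite big_cons.
Qed.

Lemma fourier_hermitian f : sqb f -> hermitian (fourier f).
Proof.
move=> hf k; rewrite !fourierE; apply: complexP; rewrite ?ReJ ?ImJ /=.
  by congr (_ * _); apply: eq_int_box => x; rewrite /ck phaseN cosN.
congr (- _); rewrite -mulrN; congr (_ * _); rewrite -mulN1r -(int_boxZ (-1) (sqb_sk k hf)).
by apply: eq_int_box => x; rewrite /sk phaseN sinN mulN1r mulrN.
Qed.

Lemma is_derive_phase1 k (y x : R) : is_derive x (1 : R) (fun u => phase k (u, y)) k.1%:~R.
Proof. by rewrite /phase /=; apply: is_derive_eq; rewrite ?addr0 ?mulr1 // /GRing.scale /= ?mulr1. Qed.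

Lemma is_derive_phase2 k (x y : R) : is_derive y (1 : R) (fun u => phase k (x, u)) k.2%:~R.
Proof.
rewrite /phase /=.
have h : is_derive y (1 : R) (fun u : R => k.2%:~R * u) k.2%:~R.
  by apply: is_derive_eq; rewrite ?addr0 ?mulr1 // /GRing.scale /= ?mulr1.
by apply: is_derive_eq (is_deriveD (is_derive_cst (k.1%:~R * x) y 1) h) _; rewrite add0r.
Qed.

Lemma cosDn2pi (n : nat) (x : R) : cos (n%:R * (2 * pi) + x) = cos x /\ sin (n%:R * (2 * pi) + x) = sin x.
Proof.
elim: n => [|n [ih1 ih2]]; first by rewrite mul0r add0r.
have -> : n.+1%:R * (2 * pi) + x = (n%:R * (2 * pi) + x) + pi *+ 2 by rewrite -natr1 -mulr_natl; ring.
by rewrite cosD2pi sinD2pi.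
Qed.

Lemma cosDz2pi (z : int) (x : R) : cos (z%:~R * (2 * pi) + x) = cos x /\ sin (z%:~R * (2 * pi) + x) = sin x.
Proof.
case: z => n; first exact: cosDn2pi.
have [<- <-] := cosDn2pi n.+1 ((Negz n)%:~R * (2 * pi) + x).
have -> : n.+1%:R * (2 * pi) + ((Negz n)%:~R * (2 * pi) + x) = x.
  by rewrite NegzE mulrNz /=; ring.
by [].
Qed.

Lemma phase_per1 k (y : R) : phase k (2 * pi, y) = k.1%:~R * (2 * pi) + phase k (0, y).
Proof. by rewrite /phase /= mulr0 add0r. Qed.

Lemma phase_per2 k (x : R) : phase k (x, 2 * pi) = k.2%:~R * (2 * pi) + phase k (x, 0).
Proof. by rewrite /phase /= mulr0 addr0 addrC. Qed.

(** Multiplied by a nonzero component of k, the integrand is a partial derivative of the periodic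
    function F (phase k x), so its integral over the box vanishes. *)
Lemma int_box_phase (F f : R -> R) k : k != 0 -> continuous f ->
  (forall u : R, is_derive u (1 : R) F (f u)) -> (forall (z : int) u, F (z%:~R * (2 * pi) + u) = F u) ->
  int_box (fun x => f (phase k x)) = 0.
Proof.
move=> k0 cf dF per.
have cfp : continuous (fun x => f (phase k x)).
  by move=> x; apply: (cvg_comp (phase k) f); [exact: continuous_phase|exact: cf].
have ccfp (c : R) : continuous (fun x => c * f (phase k x)).
  by move=> x; apply: cvgM; [exact: cvg_cst|exact: cfp].
have eq0 (z : int) : z != 0 -> int_box (fun x => z%:~R * f (phase k x)) = 0 :> R ->
    int_box (fun x => f (phase k x)) = 0.
  move=> z0; rewrite int_boxZ; last exact: continuous_sqb.
  by move/eqP; rewrite mulf_eq0 intr_eq0 (negPf z0) => /eqP.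
have [k1|k1] := eqVneq k.1 0.
  apply: (eq0 k.2).
    by apply: contra k0 => /eqP h; rewrite [k]surjective_pairing k1 h.
  apply: (@int_box_d2 _ (fun x => F (phase k x))) => //.
    by move=> x y; rewrite mulrC; exact: (is_derive1_comp (dF _) (is_derive_phase2 k x y)).
  by move=> x; rewrite phase_per2 per.
apply: (eq0 k.1 k1); apply: (@int_box_d1 _ (fun x => F (phase k x))) => //.
  by move=> x y; rewrite mulrC; exact: (is_derive1_comp (dF _) (is_derive_phase1 k y x)).
by move=> y; rewrite phase_per1 per.
Qed.

Lemma int_box_ck k : int_box (ck k) = if k == 0 then vol else 0.
Proof.
have [->|k0] := eqVneq k 0.
  rewrite -[RHS]mul1r -int_box_cst; apply: eq_int_box => x.
  by rewrite /ck phase0 cos0.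
apply: (@int_box_phase sin cos) => //; first exact: continuous_cos.
by move=> z u; rewrite (cosDz2pi _ _).2.
Qed.

Lemma int_box_sk k : int_box (sk k) = 0 :> R.
Proof.
have [->|k0] := eqVneq k 0.
  rewrite -[RHS](mul0r vol) -int_box_cst; apply: eq_int_box => x.
  by rewrite /sk phase0 sin0.
apply: (@int_box_phase (fun u => - cos u) sin) => //; first exact: continuous_sin.
  by move=> u; have := is_deriveN (is_derive_cos u); rewrite opprK.
by move=> z u; rewrite (cosDz2pi _ _).1.
Qed.

Lemma fourier_one k : fourier (fun=> 1) k = (k == 0)%:R :> R[i].
Proof.
rewrite fourierE; under eq_int_box do rewrite mul1r.
have -> : int_box (fun x => 1 * sk k x) = 0 :> R.
  by under eq_int_box do rewrite mul1r; exact: int_box_sk.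
rewrite int_box_ck mulr0 oppr0; case: eqP => _; last by rewrite mulr0.
by rewrite mulVf // gt_eqF // vol_gt0.
Qed.

Lemma int_box_lin c d f g : sqb f -> sqb g ->
  int_box (fun x => c * f x + d * g x) = c * int_box f + d * int_box g.
Proof. by move=> hf hg; rewrite int_boxD ?int_boxZ //; exact: sqiZ. Qed.

Lemma fourier_mul_ck f l k : sqb f ->
  fourier (fun x => f x * ck l x) k = 2^-1%:C * (fourier f (k - l) + fourier f (k + l)).
Proof.
move=> hf; rewrite !fourierE; apply: complexP; rewrite ?ReImE /= mul0r ?subr0 ?addr0.
  have -> : int_box (fun x => f x * ck l x * ck k x) =
      int_box (fun x => 2^-1 * (f x * ck (k - l) x) + 2^-1 * (f x * ck (k + l) x)).
    by apply: eq_int_box => x; rewrite /ck !phaseD phaseN cosB cosD; field.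
  rewrite int_box_lin; [ring|exact: sqb_ck..].
have -> : int_box (fun x => f x * ck l x * sk k x) =
    int_box (fun x => 2^-1 * (f x * sk (k - l) x) + 2^-1 * (f x * sk (k + l) x)).
  apply: eq_int_box => x; rewrite /ck /sk !phaseD phaseN.
  move: (phase k x) (phase l x) => p q; rewrite !sinD sinN cosN; by field.
rewrite int_box_lin; [ring|exact: sqb_sk..].
Qed.

Lemma fourier_mul_sk f l k : sqb f ->
  fourier (fun x => f x * sk l x) k = Complex 0 (- 2^-1) * (fourier f (k - l) - fourier f (k + l)).
Proof.
move=> hf; rewrite !fourierE; apply: complexP; rewrite ?ReImE /= mul0r ?sub0r ?add0r ?addr0.
  have -> : int_box (fun x => f x * sk l x * ck k x) =
      int_box (fun x => 2^-1 * (f x * sk (k + l) x) + (- 2^-1) * (f x * sk (k - l) x)).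
    apply: eq_int_box => x; rewrite /ck /sk !phaseD phaseN.
  move: (phase k x) (phase l x) => p q; rewrite !sinD sinN cosN; by field.
  rewrite int_box_lin; [ring|exact: sqb_sk..].
have -> : int_box (fun x => f x * sk l x * sk k x) =
    int_box (fun x => 2^-1 * (f x * ck (k - l) x) + (- 2^-1) * (f x * ck (k + l) x)).
  by apply: eq_int_box => x; rewrite /ck /sk !phaseD phaseN cosB cosD; field.
rewrite int_box_lin; [ring|exact: sqb_ck..].
Qed.

End Fourier.

(** * Trigonometric polynomials and functions with prescribed coefficients *)

Section TrigPoly.
Context {R : realType}.
Local Open Scope complex_scope.
Local Notation mR := (measurableTypeR R).
Local Notation Re := (@complex.Re R).
Local Notation Im := (@complex.Im R).
Local Notation cabs := (@Normc.normc R).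
Local Notation vol := (@vol R).
Implicit Types (f g : R * R -> R) (k l m : int * int) (a b : int * int -> R[i]).

Let mB := @measurable_box R.
Let fB := @leb2_box_fin R.

(** The real part of the partial sum of a_k e^{ik.x}; for hermitian [a] it is the partial sum
    itself. *)
Definition tp N a (x : R * R) : R :=
  \sum_(k <- sq N) (Re (a k) * ck k x - Im (a k) * sk k x).

Lemma tp_term_continuous a k : continuous (fun x : R * R => Re (a k) * ck k x - Im (a k) * sk k x).
Proof.
move=> x; apply: cvgB; apply: cvgM; try exact: cvg_cst.
  exact: continuous_ck.
exact: continuous_sk.
Qed.

Lemma continuous_tp N a : continuous (tp N a).
Proof.
move=> x; apply: (@cvg_sumr _ _ _ _ _ _ (fun x k => Re (a k) * ck k x - Im (a k) * sk k x)) => k.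
exact: tp_term_continuous.
Qed.

Lemma tp_sqb N a : sqb (tp N a).
Proof. exact: continuous_sqb (continuous_tp (N := N) (a := a)). Qed.

Lemma fourier_tp_mul N a f k : hermitian a -> sqb f ->
  fourier (fun x => tp N a x * f x) k = \sum_(l <- sq N) a l * fourier f (k - l).
Proof.
move=> ha hf.
rewrite (@eq_fourier _ _ (fun x => \sum_(l <- sq N) (Re (a l) * (f x * ck l x) - Im (a l) * (f x * sk l x)))); last first.
  by move=> x; rewrite /tp big_distrl /=; apply: eq_bigr => l _; ring.
rewrite fourier_sum; last first.
  move=> l; apply: (sqiB mB); apply: (sqiZ mB); [exact: sqb_ck|exact: sqb_sk].
(* Each real term contributes half of the expected term at l and half of that at - l; the symmetry
   of the square recombines the halves. *)
transitivity (\sum_(l <- sq N) (2^-1%:C * (a l * fourier f (k - l)) + 2^-1%:C * (a (- l) * fourier f (k - - l)))).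
  apply: eq_bigr => l _; rewrite fourierB; last 2 first.
  - by apply: (sqiZ mB); exact: sqb_ck.
  - by apply: (sqiZ mB); exact: sqb_sk.
  rewrite !fourierZ; [|exact: sqb_sk|exact: sqb_ck].
  rewrite fourier_mul_ck // fourier_mul_sk // ha opprK.
  move: (fourier f (k - l)) (fourier f (k + l)) (a l) => [p1 p2] [q1 q2] [r1 r2].
  by apply: complexP; rewrite ?ReImE /=; field.
rewrite big_split /= (big_sqN N (fun l => 2^-1%:C * (a l * fourier f (k - l)))) -big_split /=.
apply: eq_bigr => l _; move: (a l * _) => [p q].
by apply: complexP; rewrite ?ReImE /=; field.
Qed.

Lemma fourier_tp N a k : hermitian a -> fourier (tp N a) k = if k \in sq N then a k else 0.
Proof.
move=> ha; rewrite (@eq_fourier _ _ (fun x => tp N a x * 1)); last by move=> x; rewrite mulr1.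
rewrite fourier_tp_mul //; last exact: (sqi_cst mB fB 1).
under eq_bigr do rewrite fourier_one subr_eq0 eq_sym.
rewrite -(big_sq_pair N k a) [RHS]big_mkcond /=; apply: eq_bigr => l _.
by case: eqP => _; rewrite ?mulr1 ?mulr0.
Qed.

Lemma int_box_tp N a g : sqb g ->
  int_box (fun x => tp N a x * g x) = vol * \sum_(k <- sq N) Re (a k * conjc (fourier g k)).
Proof.
move=> hg; have v0 : vol != 0 by rewrite gt_eqF // vol_gt0.
rewrite (@eq_int_box _ _ (fun x => \sum_(k <- sq N) (Re (a k) * (g x * ck k x) + (- Im (a k)) * (g x * sk k x)))); last first.
  by move=> x; rewrite /tp big_distrl /=; apply: eq_bigr => l _; ring.
rewrite int_box_sum; last first.
  move=> l; apply: (sqiD mB); apply: (sqiZ mB); [exact: sqb_ck|exact: sqb_sk].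
rewrite big_distrr; apply: eq_bigr => l _; rewrite int_box_lin; [|exact: sqb_ck|exact: sqb_sk].
rewrite fourierE ReM ReJ ImJ.
transitivity (vol * (Re (a l) * (vol^-1 * int_box (fun x => g x * ck l x)) - Im (a l) * (vol^-1 * int_box (fun x => g x * sk l x)))).
  by move: (int_box _) (int_box _) v0 => p q v0; field.
by congr (vol * _); rewrite opprK.
Qed.

Lemma int_box_tp_sqr N a : hermitian a ->
  int_box (fun x => tp N a x ^+ 2) = vol * \sum_(k <- sq N) nsq (a k).
Proof.
move=> ha; rewrite (@eq_int_box _ _ (fun x => tp N a x * tp N a x)); last by move=> x; rewrite expr2.
rewrite int_box_tp; last exact: tp_sqb.
congr (_ * _); apply: eq_big_seq => k kN; rewrite fourier_tp // kN.
by rewrite !ReImE /nsq; ring.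
Qed.

Lemma tpB M N a x : (M <= N)%N ->
  tp N a x - tp M a x = tp N (fun k => if k \in sq M then 0 else a k) x.
Proof.
move=> MN; rewrite {2}/tp (@big_uniq_sub _ (sq M) (sq N)) ?sq_uniq //; last by move=> k; exact: mem_sqW.
rewrite big_mkcond /= /tp -sumrB; apply: eq_bigr => k _.
by case: ifP => _; rewrite /= ?subr0 //; ring.
Qed.

Lemma int_box_tpB M N a : (M <= N)%N -> hermitian a ->
  int_box (fun x => (tp N a x - tp M a x) ^+ 2) =
  vol * (\sum_(k <- sq N) nsq (a k) - \sum_(k <- sq M) nsq (a k)).
Proof.
move=> MN ha; rewrite (@eq_int_box _ _ (fun x => tp N (fun k => if k \in sq M then 0 else a k) x ^+ 2)); last first.
  by move=> x; rewrite tpB.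
rewrite int_box_tp_sqr; last by move=> k; rewrite mem_sqN ha; case: ifP; rewrite ?conjc0.
congr (_ * _); rewrite (@big_uniq_sub _ (sq M) (sq N)) ?sq_uniq //; last by move=> k; exact: mem_sqW.
rewrite [X in _ - X]big_mkcond /= -sumrB; apply: eq_bigr => k _.
by case: ifP => _; rewrite ?nsq0 ?subrr ?subr0.
Qed.

Lemma int_box_sub_tp N f a : sqb f ->
  int_box (fun x => (f x - tp N a x) ^+ 2) =
  int_box (fun x => f x ^+ 2) - 2 * int_box (fun x => tp N a x * f x) + int_box (fun x => tp N a x ^+ 2).
Proof.
move=> hf; have ht := tp_sqb N a; have [_ i1] := hf; have [_ i2] := ht.
have i3 := sqi_mul mB ht hf.
rewrite (@eq_int_box _ _ (fun x => (f x ^+ 2 + (- 2) * (tp N a x * f x)) + tp N a x ^+ 2)); last first.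
  by move=> x; ring.
rewrite /int_box RintegralD //; last by apply: integrable_addr => //; exact: integrable_mulr.
rewrite RintegralD //; last exact: integrable_mulr.
by rewrite RintegralZl // mulNr.
Qed.

Lemma bessel f : sqb f -> bnd (nsq \o fourier f) (vol^-1 * int_box (fun x => f x ^+ 2)).
Proof.
move=> hf N; have v0 := @vol_gt0 R; rewrite ler_pdivlMl //=.
have : 0 <= int_box (fun x => (f x - tp N (fourier f) x) ^+ 2).
  by apply: Rintegral_ge0 => x _; exact: sqr_ge0.
rewrite int_box_sub_tp // int_box_tp // int_box_tp_sqr; last exact: fourier_hermitian.
have -> : \sum_(k <- sq N) Re (fourier f k * conjc (fourier f k)) = \sum_(k <- sq N) nsq (fourier f k).
  by apply: eq_bigr => k _; move: (fourier f k) => z; rewrite !ReImE /nsq; ring.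
lra.
Qed.

Definition mass a : R := limn (fun N => \sum_(k <- sq N) nsq (a k)).

Definition tail a N : R := mass a - \sum_(k <- sq N) nsq (a k).

(** The tail condition makes consecutive truncations close at the rate 8^-j that [riesz_fischer]
    requires; j <= N forces the truncation levels to infinity. *)
Definition good a j N : bool := (j <= N)%N && (vol * tail a N <= 8^-1 ^+ j).

(* The truncation level is a measurable function of the coefficients; this makes
   the representative [rf] measurable jointly in time and space when [a] depends
   on time. *)
Definition idx a j : nat :=
  if pselect (exists N, good a j N) is left h then ex_minn h else 0%N.

Definition rf a : R * R -> R := esup_lim (fun j => tp (idx a j) a).

Section Bounded.
Variables (a : int * int -> R[i]) (M : R).
Hypothesis ha : hermitian a.
Hypothesis aM : bnd (nsq \o a) M.

Let cvg_mass : (fun N => \sum_(k <- sq N) nsq (a k)) @ \oo --> mass a.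
Proof. by apply: (@bnd_cvg _ (nsq \o a) M) => // k; exact: nsq_ge0. Qed.

Lemma tail_cvg : tail a @ \oo --> (0 : R).
Proof. by rewrite -(subrr (mass a)); apply: cvgB => //; exact: cvg_cst. Qed.

Lemma tail_ge0 N : 0 <= tail a N.
Proof.
rewrite subr_ge0; apply: nondecreasing_cvgn_le; last by apply/cvg_ex; eexists; exact: cvg_mass.
by apply: sum_sq_mono => k; exact: nsq_ge0.
Qed.

Lemma goodP j : exists N, good a j N.
Proof.
have h : 0 < 8^-1 ^+ j / vol by rewrite divr_gt0 ?vol_gt0 ?exprn_gt0 // invr_gt0 ltr0n.
have /cvgrPdist_le /(_ _ h) [N0 _ hN] := tail_cvg.
exists (maxn j N0); rewrite /good leq_maxl /=.
have := hN (maxn j N0) (leq_maxr _ _); rewrite /= sub0r normrN ger0_norm ?tail_ge0 //.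
by rewrite ler_pdivlMr ?vol_gt0 // mulrC.
Qed.

(** Minimality is expressed as a finite Boolean combination of values of [good], from which
    measurability in time can be read off. *)
Lemma idxE j N : (idx a j == N) = good a j N && all (fun n => ~~ good a j n) (iota 0 N).
Proof.
rewrite /idx; case: pselect => [h|/(_ (goodP j))//]; case: ex_minnP => m gm hm.
apply/eqP/andP => [<-|[gN /allP hN]].
  split=> //; apply/allP => n; rewrite mem_iota add0n /= => nm.
  by apply/negP => /hm; rewrite leqNgt nm.
apply/eqP; rewrite eqn_leq (hm _ gN) /=; rewrite leqNgt; apply/negP => mN.
by have := hN m; rewrite mem_iota /= add0n mN gm => /(_ isT).
Qed.

Lemma idx_good j : good a j (idx a j).
Proof. by have := idxE j (idx a j); rewrite eqxx => /esym/andP[]. Qed.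

Lemma idx_le j : (idx a j <= idx a j.+1)%N.
Proof.
rewrite {1}/idx; case: pselect => [h|/(_ (goodP j))//]; case: ex_minnP => m gm; apply.
have /andP[h1 h2] := idx_good j.+1; apply/andP; split; first exact: ltnW.
by apply: le_trans h2 _; rewrite exprS ler_piMl // ?exprn_ge0 //; lra.
Qed.

Lemma rf_approx : sqb (rf a) /\
  forall j, int_box (fun x => (rf a x - tp (idx a j) a x) ^+ 2) <= 4 * 2^-1 ^+ j.
Proof.
apply: (riesz_fischer mB) => j; first exact: tp_sqb.
rewrite -/(int_box _) int_box_tpB ?idx_le //.
have /andP[_] := idx_good j; apply: le_trans; rewrite ler_wpM2l //; first exact/ltW/vol_gt0.
by have := tail_ge0 (idx a j.+1); rewrite /tail; lra.
Qed.

Lemma rf_sqb : sqb (rf a). Proof. by case: rf_approx. Qed.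

Lemma idx_cvg (u : nat -> R) (L : R) : u @ \oo --> L -> (fun j => u (idx a j)) @ \oo --> L.
Proof.
move=> /cvgrPdist_le h; apply/cvgrPdist_le => e /h [N _ hN]; exists N => // j /= Nj.
by apply: hN => /=; apply: leq_trans Nj _; have /andP[] := idx_good j.
Qed.

Lemma rf_mul_cvg g : sqb g ->
  (fun j => int_box (fun x => tp (idx a j) a x * g x)) @ \oo --> int_box (fun x => rf a x * g x).
Proof.
move=> hg; have [h1 h2] := rf_approx.
apply: (sqi_cvg mB h1 _ hg); first by move=> j; exact: tp_sqb.
apply: (@squeeze_cvgr _ _ _ _ (fun=> 0) (fun j => 4 * 2^-1 ^+ j)).
- by apply: nearW => j; rewrite h2 andbT; apply: Rintegral_ge0 => x _; exact: sqr_ge0.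
- exact: cvg_cst.
- exact: cvg_geo_half.
Qed.

Lemma parseval_summable g : sqb g -> cvgn (fun N => \sum_(k <- sq N) Re (a k * conjc (fourier g k))).
Proof.
move=> hg; apply: (@abs_cvg _ _ (fun k => cabs (conjc (fourier g k) * a k))).
  by move=> k; rewrite mulrC; exact: cabs_Re.
apply: sum_cabs_le; last exact: aM.
move=> N; apply: le_trans (bessel hg N).
by rewrite le_eqVlt; apply/orP; left; apply/eqP; apply: eq_bigr => k _; rewrite /comp nsqJ.
Qed.

(** The L^2 approximation identifies the limit along the levels [idx a j] only; absolute convergence
    of the series extends it to all [N]. *)
Lemma rf_parseval g : sqb g ->
  (fun N => vol * \sum_(k <- sq N) Re (a k * conjc (fourier g k))) @ \oo -->
  int_box (fun x => rf a x * g x).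
Proof.
move=> hg; have /cvg_ex[L hL] := parseval_summable hg.
have h : (fun N => vol * \sum_(k <- sq N) Re (a k * conjc (fourier g k))) @ \oo --> vol * L.
  by apply: cvgM => //; exact: cvg_cst.
have := idx_cvg h; under eq_fun do rewrite -int_box_tp //.
by move=> h'; rewrite (cvg_unique _ (rf_mul_cvg hg) h').
Qed.

Lemma fourier_rf_mul (v : R * R -> R) k : continuous v ->
  ccvg \oo (fun j => \sum_(l <- sq (idx a j)) a l * fourier v (k - l)) (fourier (fun x => rf a x * v x) k).
Proof.
move=> cv; have hv := continuous_sqb cv.
have H (u : R * R -> R) : sqb (fun x => v x * u x) ->
    (fun j => int_box (fun x => tp (idx a j) a x * v x * u x)) @ \oo --> int_box (fun x => rf a x * v x * u x).
  have e (w : R * R -> R) : int_box (fun x => w x * v x * u x) = int_box (fun x => w x * (v x * u x)).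
    by apply: eq_int_box => x; rewrite mulrA.
  move=> hu; rewrite e [X in X @ _](_ : _ = fun j => int_box (fun x => tp (idx a j) a x * (v x * u x))).
    exact: rf_mul_cvg.
  by apply/funext => j; exact: e.
have E j : \sum_(l <- sq (idx a j)) a l * fourier v (k - l) = fourier (fun x => tp (idx a j) a x * v x) k.
  by rewrite fourier_tp_mul.
split; under eq_fun do rewrite E fourierE /=; rewrite fourierE /=; try apply: cvgN.
  by apply: cvgM; [exact: cvg_cst|exact: H (sqb_ck k hv)].
by apply: cvgM; [exact: cvg_cst|exact: H (sqb_sk k hv)].
Qed.

Lemma fourier_rf k : fourier (rf a) k = a k.
Proof.
have h : continuous (fun _ : R * R => 1 : R) by move=> x; exact: cvg_cst.
have := fourier_rf_mul k h.
rewrite (@eq_fourier _ (fun x => rf a x * 1) (rf a)); last by move=> x; rewrite mulr1.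
move=> h1; apply: (ccvg_unique h1).
have near_k : \forall j \near \oo, \sum_(l <- sq (idx a j)) a l * fourier (fun=> 1) (k - l) = a k.
  have [N _ hN] := near_sq k; exists N => // j /= Nj.
  have kj : k \in sq (idx a j) by apply: hN; apply: leq_trans Nj _; have /andP[] := idx_good j.
  under eq_bigr do rewrite fourier_one subr_eq0 eq_sym.
  have := big_sq_pair (idx a j) k a; rewrite kj => <-; rewrite [RHS]big_mkcond /=; apply: eq_bigr => l _.
  by case: eqP => _; rewrite ?mulr1 ?mulr0.
by split; apply: cvg_near_cst; apply: filterS near_k => j ->.
Qed.

Lemma int_box_rf_sqr : int_box (fun x => rf a x ^+ 2) <= vol * M.
Proof.
have := rf_parseval rf_sqb.
rewrite (@eq_int_box _ (fun x => rf a x * rf a x) (fun x => rf a x ^+ 2)); last by move=> x; rewrite expr2.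
move=> h; rewrite -(cvg_lim _ h) //; apply: limr_le; first by apply/cvg_ex; eexists; exact: h.
apply: nearW => N; rewrite ler_wpM2l //; first exact/ltW/vol_gt0.
apply: le_trans (aM N); rewrite le_eqVlt; apply/orP; left; apply/eqP; apply: eq_bigr => k _.
by rewrite fourier_rf !ReImE /nsq /=; ring.
Qed.

End Bounded.

Lemma int_box_mean f : int_box f = vol * Re (fourier f 0).
Proof.
rewrite fourierE /= mulrA divff ?gt_eqF ?vol_gt0 // mul1r; apply: eq_int_box => x.
by rewrite /ck phase0 cos0 mulr1.
Qed.

(** For fixed j, on the measurable set of times where [idx (a t) j] equals N the approximation is
    [tp N (a t)], which is jointly measurable. Countably many N cover all times, and an upper limit
    over j concludes. *)
Lemma rf_measurable (a : R -> int * int -> R[i]) M (D : set (mR * (mR * mR))) : measurable D ->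
  (forall t, hermitian (a t)) -> (forall t, bnd (nsq \o a t) M) ->
  (forall k, continuous (fun t => Re (a t k)) /\ continuous (fun t => Im (a t k))) ->
  measurable_fun D (fun z => rf (a z.1) z.2).
Proof.
move=> mD ha aM ca.
have mre k : measurable_fun (setT : set mR) (fun t => Re (a t k)).
  by apply: continuous_measurable_fun; case: (ca k).
have mim k : measurable_fun (setT : set mR) (fun t => Im (a t k)).
  by apply: continuous_measurable_fun; case: (ca k).
have msum N : measurable_fun (setT : set mR) (fun t => \sum_(k <- sq N) nsq (a t k)).
  apply: measurable_sum => k; apply: measurable_funD; exact: measurable_funX.
have mmass : measurable_fun (setT : set mR) (fun t => mass (a t)).
  apply: (@measurable_fun_cvg _ _ _ _ (fun N t => \sum_(k <- sq N) nsq (a t k))) => // t _.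
  by apply: (@bnd_cvg _ (nsq \o a t) M) => // k; exact: nsq_ge0.
have mgood j N : measurable_fun (setT : set mR) (fun t => good (a t) j N).
  rewrite /good; case: (j <= N)%N => /=; last exact: measurable_cst.
  apply: measurable_fun_ler; last exact: measurable_cst.
  by apply: measurable_funM; [exact: measurable_cst|exact: measurable_funB].
have mall j s : measurable_fun (setT : set mR) (fun t => all (fun n => ~~ good (a t) j n) s).
  elim: s => [|n s ih] /=; first exact: measurable_cst.
  by apply: measurable_and => //; exact: measurable_neg.
have midx j N : measurable [set t : mR | idx (a t) j = N].
  have -> : [set t : mR | idx (a t) j = N] =
     (fun t => good (a t) j N && all (fun n => ~~ good (a t) j n) (iota 0 N)) @^-1` [set true].
    apply/seteqP; split=> t /=; first by move=> /eqP; rewrite (idxE (aM t)).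
    by move=> h; apply/eqP; rewrite (idxE (aM t)).
  have := measurable_and (mgood j N) (mall j (iota 0 N)).
  by move=> /(_ measurableT [set true]); rewrite setTI; apply.
apply: (@esup_lim_measurable _ _ _ D (fun j z => tp (idx (a z.1) j) (a z.1) z.2)) => j.
have mtp N : measurable_fun D (fun z : mR * (mR * mR) => tp N (a z.1) z.2).
  have m1 (g : mR -> R) : measurable_fun setT g -> measurable_fun D (fun z : mR * (mR * mR) => g z.1).
    move=> mg; apply: (measurable_funS measurableT) => //.
    by apply: (@measurableT_comp _ _ _ _ _ _ g) => //; exact: measurable_fst.
  have m2 (g : R * R -> R) : continuous g -> measurable_fun D (fun z : mR * (mR * mR) => g z.2).
    move=> /continuous_measurable_prod mg; apply: (measurable_funS measurableT) => //.
    by apply: (@measurableT_comp _ _ _ _ _ _ g) => //; exact: measurable_snd.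
  apply: measurable_sum => k; apply: measurable_funB; apply: measurable_funM.
  - exact: (m1 (fun t => Re (a t k))).
  - exact: m2 (continuous_ck (k := k)).
  - exact: (m1 (fun t => Im (a t k))).
  - exact: m2 (continuous_sk (k := k)).
move=> _ Y mY.
have -> : D `&` (fun z => tp (idx (a z.1) j) (a z.1) z.2) @^-1` Y =
  \bigcup_(N : nat) ((D `&` (fun z => tp N (a z.1) z.2) @^-1` Y) `&` (fst @^-1` [set t | idx (a t) j = N])).
  apply/seteqP; split=> [z [Dz Yz]|z [N _ [[Dz Yz] /= hN]]].
    by exists (idx (a z.1) j).
  by split=> //=; rewrite hN.
apply: bigcup_measurable => N _; apply: measurableI; first exact: mtp.
by rewrite -[X in measurable X]setTI; exact: measurable_fst.
Qed.

End TrigPoly.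

(** * Test functions *)

Section TestFunctions.
Context {R : realType}.
Local Open Scope complex_scope.
Local Notation mu := (@leb2 R).
Local Notation bx := (@box R).
Local Notation Re := (@complex.Re R).
Local Notation Im := (@complex.Im R).
Local Notation cabs := (@Normc.normc R).
Local Notation vol := (@vol R).
Local Notation fn := (@freq_norm R).
Implicit Types (f g : R * R -> R) (phi : R * (R * R) -> R) (k l m : int * int).

Let mB := @measurable_box R.
Let fB := @leb2_box_fin R.

Lemma int_box_bound f (C : R) : continuous f -> (forall x, bx x -> `|f x| <= C) -> `|int_box f| <= C * vol.
Proof.
move=> cf fC; have sf := sqi_integrable mB fB (continuous_sqb cf).
apply: le_trans (le_normr_Rintegral mB sf) _.
rewrite -(int_box_cst C); apply: le_Rintegral => //.
- by have := integrable_norm sf.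
- by have := sqi_integrable mB fB (sqi_cst mB fB C).
Qed.

Lemma continuous_mul f g : continuous f -> continuous g -> continuous (fun x => f x * g x).
Proof. by move=> cf cg x; apply: cvgM; [exact: cf|exact: cg]. Qed.

Lemma fourier_bound f (C : R) k : continuous f -> (forall x, bx x -> `|f x| <= C) -> cabs (fourier f k) <= 2 * C.
Proof.
move=> cf fC; have v0 := @vol_gt0 R.
have h (u : R * R -> R) : continuous u -> (forall x, `|u x| <= 1) -> `|vol^-1 * int_box (fun x => f x * u x)| <= C.
  move=> cu u1; rewrite normrM gtr0_norm ?invr_gt0 // mulrC ler_pdivrMr //.
  apply: int_box_bound; first exact: continuous_mul.
  by move=> x /fC fx; rewrite normrM; apply: le_trans fx; rewrite ler_piMr.
apply: le_trans (cabs_le_ReIm _) _; rewrite fourierE /= normrN mulr_natl mulr2n; apply: lerD; apply: h.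
- exact: continuous_ck.
- by move=> x; exact: cos_max.
- exact: continuous_sk.
- by move=> x; exact: sin_max.
Qed.

(** Integration by parts in real form: for c the component of k in the direction of differentiation,
    the hypotheses say that the derivatives of f cos and f sin have integral 0. *)
Lemma fourier_parts f g (c : R) k : continuous f -> continuous g ->
  int_box (fun x => 1 * (g x * ck k x) + (- c) * (f x * sk k x)) = 0 ->
  int_box (fun x => 1 * (g x * sk k x) + c * (f x * ck k x)) = 0 ->
  fourier g k = Complex 0 c * fourier f k.
Proof.
move=> /continuous_sqb sf /continuous_sqb sg.
rewrite !int_box_lin; try by [exact: sqb_ck|exact: sqb_sk].
move=> h1 h2; rewrite !fourierE.
have -> : int_box (fun x => g x * ck k x) = c * int_box (fun x => f x * sk k x) by lra.
have -> : int_box (fun x => g x * sk k x) = - (c * int_box (fun x => f x * ck k x)) by lra.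
by apply: complexP; rewrite ?ReM ?ImM /=; ring.
Qed.

Lemma continuous_lin (c d : R) (f g u v : R * R -> R) : continuous f -> continuous g -> continuous u -> continuous v ->
  continuous (fun x => c * (f x * u x) + d * (g x * v x)).
Proof.
by move=> cf cg cu cv x; apply: cvgD; apply: cvgM; try exact: cvg_cst; exact: continuous_mul.
Qed.

Lemma fourier_d1 f g k : continuous f -> continuous g ->
  (forall x y : R, is_derive x (1 : R) (fun u => f (u, y)) (g (x, y))) ->
  (forall y, f (2 * pi, y) = f (0, y)) ->
  fourier g k = Complex 0 k.1%:~R * fourier f k.
Proof.
move=> cf cg df per; have cc := continuous_ck (k := k); have cs := continuous_sk (k := k).
apply: fourier_parts => //.
  apply: (@int_box_d1 _ (fun x => f x * ck k x)); first exact: continuous_lin.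
    move=> x y; have := is_deriveM (df x y) (is_derive1_comp (is_derive_cos _) (is_derive_phase1 k y x)).
    by move/is_derive_eq; apply; rewrite /GRing.scale /= /ck /sk; ring.
  by move=> y; rewrite per /ck phase_per1 (cosDz2pi _ _).1.
apply: (@int_box_d1 _ (fun x => f x * sk k x)); first exact: continuous_lin.
  move=> x y; have := is_deriveM (df x y) (is_derive1_comp (is_derive_sin _) (is_derive_phase1 k y x)).
  by move/is_derive_eq; apply; rewrite /GRing.scale /= /ck /sk; ring.
by move=> y; rewrite per /sk phase_per1 (cosDz2pi _ _).2.
Qed.

Lemma fourier_d2 f g k : continuous f -> continuous g ->
  (forall x y : R, is_derive y (1 : R) (fun u => f (x, u)) (g (x, y))) ->
  (forall x, f (x, 2 * pi) = f (x, 0)) ->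
  fourier g k = Complex 0 k.2%:~R * fourier f k.
Proof.
move=> cf cg df per; have cc := continuous_ck (k := k); have cs := continuous_sk (k := k).
apply: fourier_parts => //.
  apply: (@int_box_d2 _ (fun x => f x * ck k x)); first exact: continuous_lin.
    move=> x y; have := is_deriveM (df x y) (is_derive1_comp (is_derive_cos _) (is_derive_phase2 k x y)).
    by move/is_derive_eq; apply; rewrite /GRing.scale /= /ck /sk; ring.
  by move=> y; rewrite per /ck phase_per2 (cosDz2pi _ _).1.
apply: (@int_box_d2 _ (fun x => f x * sk k x)); first exact: continuous_lin.
  move=> x y; have := is_deriveM (df x y) (is_derive1_comp (is_derive_sin _) (is_derive_phase2 k x y)).
  by move/is_derive_eq; apply; rewrite /GRing.scale /= /ck /sk; ring.
by move=> y; rewrite per /sk phase_per2 (cosDz2pi _ _).2.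
Qed.

(** The part of [test_function] that does not mention T; it is stable under differentiation. *)
Definition periodic_smooth phi : Prop :=
  [/\ smooth phi, forall t x1 x2, phi (t, (x1 + 2 * pi, x2)) = phi (t, (x1, x2)) &
    forall t x1 x2, phi (t, (x1, x2 + 2 * pi)) = phi (t, (x1, x2))].

Lemma pairD (U V : zmodType) (a b : U) (c d : V) : (a, c) + (b, d) = (a + b, c + d).
Proof. by []. Qed.

Lemma derive_periodic phi (v p z : R * (R * R)) : (forall z, phi (z + p) = phi z) ->
  'D_v phi (z + p) = 'D_v phi z.
Proof.
move=> per; rewrite /derive (_ : (fun h => h^-1 *: ((phi \o shift (z + p)) (h *: v) - phi (z + p))) =
  (fun h => h^-1 *: ((phi \o shift z) (h *: v) - phi z))) //.
by apply/funext => h; rewrite /= addrA !per.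
Qed.

Lemma periodic_smooth_derive phi (v : R * (R * R)) : periodic_smooth phi -> periodic_smooth ('D_v phi).
Proof.
move=> [sm p1 p2]; split.
- by move=> vs z; have := sm (rcons vs v) z; rewrite foldr_rcons.
- move=> t x1 x2.
  have -> : (t, (x1 + 2 * pi, x2)) = (t, (x1, x2)) + (0, (2 * pi, 0)) by rewrite /= !pairD !addr0.
  by apply: derive_periodic => -[u [y1 y2]]; rewrite !pairD !addr0.
- move=> t x1 x2.
  have -> : (t, (x1, x2 + 2 * pi)) = (t, (x1, x2)) + (0, (0, 2 * pi)) by rewrite /= !pairD !addr0.
  by apply: derive_periodic => -[u [y1 y2]]; rewrite !pairD !addr0.
Qed.

Lemma periodic_smooth_dt phi : periodic_smooth phi -> periodic_smooth (dt phi).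
Proof. exact: periodic_smooth_derive. Qed.

Lemma periodic_smooth_d1 phi : periodic_smooth phi -> periodic_smooth (d1 phi).
Proof. exact: periodic_smooth_derive. Qed.

Lemma periodic_smooth_d2 phi : periodic_smooth phi -> periodic_smooth (d2 phi).
Proof. exact: periodic_smooth_derive. Qed.

Lemma periodic_smooth_continuous phi : periodic_smooth phi -> continuous phi.
Proof. by move=> [sm _ _] z; apply: differentiable_continuous; exact: (sm [::]). Qed.

Lemma at_time_continuous phi t : periodic_smooth phi -> continuous (at_time phi t).
Proof.
move=> /periodic_smooth_continuous cphi x; rewrite /at_time.
apply: (cvg_comp (fun x : R * R => (t, x)) phi); last exact: cphi.
by apply: cvg_pairR; [exact: cvg_cst|exact: cvg_id].
Qed.

Lemma is_derive_line phi (v z : R * (R * R)) (F : R -> R) (t : R) : differentiable phi z ->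
  (forall h : R, F (h + t) = phi (h *: v + z)) -> is_derive t (1 : R) F ('D_v phi z).
Proof.
move=> dphi hF; have hz : F t = phi z by rewrite -[t in LHS]add0r hF scale0r add0r.
have e : (fun h : R => h^-1 *: ((F \o shift t) (h *: 1) - F t)) =
   (fun h => h^-1 *: ((phi \o shift z) (h *: v) - phi z)).
  by apply/funext => h; rewrite /= hz -hF /GRing.scale /= mulr1.
split; first by rewrite /derivable /= e; exact: diff_derivable.
by rewrite /derive e.
Qed.

Lemma is_derive_dt phi (t : R) x : smooth phi -> is_derive t (1 : R) (fun u => phi (u, x)) (dt phi (t, x)).
Proof.
move=> sm; apply: is_derive_line; first exact: (sm [::]).
by case: x => x1 x2 h; congr (phi (_, (_, _))); rewrite /= /GRing.scale /= ?mulr0 ?mulr1 ?add0r.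
Qed.

Lemma is_derive_d1 phi (t x y : R) : smooth phi -> is_derive x (1 : R) (fun u => phi (t, (u, y))) (d1 phi (t, (x, y))).
Proof.
move=> sm; apply: is_derive_line; first exact: (sm [::]).
by move=> h; congr (phi (_, (_, _))); rewrite /= /GRing.scale /= ?mulr0 ?mulr1 ?add0r.
Qed.

Lemma is_derive_d2 phi (t x y : R) : smooth phi -> is_derive y (1 : R) (fun u => phi (t, (x, u))) (d2 phi (t, (x, y))).
Proof.
move=> sm; apply: is_derive_line; first exact: (sm [::]).
by move=> h; congr (phi (_, (_, _))); rewrite /= /GRing.scale /= ?mulr0 ?mulr1 ?add0r.
Qed.

Lemma fourier_dx1 phi t k : periodic_smooth phi ->
  fourier (at_time (d1 phi) t) k = Complex 0 k.1%:~R * fourier (at_time phi t) k.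
Proof.
move=> sp; apply: fourier_d1.
- exact: at_time_continuous.
- by apply: at_time_continuous; exact: periodic_smooth_derive.
- by move=> x y; apply: is_derive_d1; case: sp.
- by move=> y; case: sp => _ p1 _; rewrite /at_time -[X in (X, y)]add0r p1.
Qed.

Lemma fourier_dx2 phi t k : periodic_smooth phi ->
  fourier (at_time (d2 phi) t) k = Complex 0 k.2%:~R * fourier (at_time phi t) k.
Proof.
move=> sp; apply: fourier_d2.
- exact: at_time_continuous.
- by apply: at_time_continuous; exact: periodic_smooth_derive.
- by move=> x y; apply: is_derive_d2; case: sp.
- by move=> x; case: sp => _ _ p2; rewrite /at_time -[X in (x, X)]add0r p2.
Qed.

Lemma continuous_slab_bounded phi (A B : R) : continuous phi ->
  exists C, forall t x, A <= t <= B -> bx x -> `|phi (t, x)| <= C.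
Proof.
move=> cphi.
have cb : compact (`[A, B] `*` bx) by do 2! (apply: compact_setX; try exact: segment_compact).
have /compact_bounded [M [_ hM]] : compact (phi @` (`[A, B] `*` bx)).
  by apply: continuous_compact => //; exact: continuous_subspaceT.
exists (M + 1) => t x tAB bxx; apply: (hM (M + 1)); first by rewrite ltrDl.
by exists (t, x) => //; split=> //=; rewrite in_itv.
Qed.

Lemma fourier_at_time_bound phi (A B : R) : periodic_smooth phi ->
  exists C, forall t k, A <= t <= B -> cabs (fourier (at_time phi t) k) <= C.
Proof.
move=> sp; have [C hC] := continuous_slab_bounded A B (periodic_smooth_continuous sp).
exists (2 * C) => t k tAB; apply: fourier_bound; first exact: at_time_continuous.
by move=> x; exact: hC.
Qed.

Lemma cabs_fourier_dx11 phi t k : periodic_smooth phi ->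
  cabs (fourier (at_time (d1 (d1 phi)) t) k) = k.1%:~R ^+ 2 * cabs (fourier (at_time phi t) k).
Proof.
move=> sp; rewrite (fourier_dx1 t k (periodic_smooth_d1 sp)) (fourier_dx1 t k sp) !cabsM mulrA -expr2 cabs_sqr /nsq /= expr0n add0r //.
Qed.

Lemma cabs_fourier_dx22 phi t k : periodic_smooth phi ->
  cabs (fourier (at_time (d2 (d2 phi)) t) k) = k.2%:~R ^+ 2 * cabs (fourier (at_time phi t) k).
Proof.
move=> sp; rewrite (fourier_dx2 t k (periodic_smooth_d2 sp)) (fourier_dx2 t k sp) !cabsM mulrA -expr2 cabs_sqr /nsq /= expr0n add0r //.
Qed.

(** Multiplied by (1 + k_1^2)(1 + k_2^2), both left-hand sides become combinations of the moduli of
    coefficients of derivatives of [phi], each bounded uniformly for t in [A, B]. *)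
Lemma fourier_decay phi (A B : R) : periodic_smooth phi ->
  exists2 C, 0 <= C & forall t k, A <= t <= B ->
    cabs (fourier (at_time phi t) k) <= C * decay k /\
    fn k ^+ 2 * cabs (fourier (at_time phi t) k) <= C * decay k.
Proof.
move=> sp.
(* The operators [E1] and [E2] are the second derivatives in x_1 and x_2, kept abstract: only their
   effect on the moduli of coefficients is used. *)
have [E1 [s1 e1]] : exists E1 : (R * (R * R) -> R) -> R * (R * R) -> R,
    (forall psi, periodic_smooth psi -> periodic_smooth (E1 psi)) /\
    (forall psi t k, periodic_smooth psi ->
      cabs (fourier (at_time (E1 psi) t) k) = k.1%:~R ^+ 2 * cabs (fourier (at_time psi t) k)).
  exists (fun psi => d1 (d1 psi)); split; last exact: cabs_fourier_dx11.
  by move=> psi /periodic_smooth_d1 /periodic_smooth_d1.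
have [E2 [s2 e2]] : exists E2 : (R * (R * R) -> R) -> R * (R * R) -> R,
    (forall psi, periodic_smooth psi -> periodic_smooth (E2 psi)) /\
    (forall psi t k, periodic_smooth psi ->
      cabs (fourier (at_time (E2 psi) t) k) = k.2%:~R ^+ 2 * cabs (fourier (at_time psi t) k)).
  exists (fun psi => d2 (d2 psi)); split; last exact: cabs_fourier_dx22.
  by move=> psi /periodic_smooth_d2 /periodic_smooth_d2.
have bd psi : periodic_smooth psi -> exists2 C, 0 <= C & forall t k, A <= t <= B ->
    cabs (fourier (at_time psi t) k) <= C.
  move=> /(fourier_at_time_bound A B) [C hC]; exists `|C| => // t k /hC h.
  exact: le_trans (h k) (ler_norm _).
have [C0 c0 h0] := bd _ sp.
have [C1 c1 h1] := bd _ (s1 _ sp).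
have [C2 c2 h2] := bd _ (s2 _ sp).
have [C11 c11 h11] := bd _ (s1 _ (s1 _ sp)).
have [C12 c12 h12] := bd _ (s1 _ (s2 _ sp)).
have [C22 c22 h22] := bd _ (s2 _ (s2 _ sp)).
have [C112 c112 h112] := bd _ (s1 _ (s1 _ (s2 _ sp))).
have [C122 c122 h122] := bd _ (s1 _ (s2 _ (s2 _ sp))).
(* The constants follow the monomials of (a + b)(1 + a)(1 + b) with a = k_1^2 and b = k_2^2, whence
   the 2 before [C12]; [C0] serves the estimate without |k|^2. *)
exists (C0 + C1 + C2 + C11 + 2 * C12 + C22 + C112 + C122); first lra.
move=> t k tAB; rewrite /decay fn_sqr.
move: (h0 t k tAB) (h1 t k tAB) (h2 t k tAB) (h11 t k tAB) (h12 t k tAB) (h22 t k tAB) (h112 t k tAB) (h122 t k tAB).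
rewrite (e1 _ t k (s1 _ (s2 _ sp))) (e1 _ t k (s2 _ (s2 _ sp))) (e1 _ t k (s2 _ sp)) (e1 _ t k (s1 _ sp)).
rewrite (e2 _ t k (s2 _ sp)) (e2 _ t k sp) (e1 _ t k sp).
have := cabs_ge0 (fourier (at_time phi t) k).
move: (cabs _) => X X0; set a : R := k.1%:~R ^+ 2; set b : R := k.2%:~R ^+ 2.
have a0 : 0 <= a by exact: sqr_ge0.
have b0 : 0 <= b by exact: sqr_ge0.
move=> g0 g1 g2 g11 g12 g22 g112 g122.
rewrite -invfM ler_pdivlMr; last by rewrite mulr_gt0 //; lra.
rewrite ler_pdivlMr; last by rewrite mulr_gt0 //; lra.
split; first by rewrite (_ : _ * _ = X + a * X + b * X + a * (b * X)); [lra|ring].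
have -> : (a + b) * X * ((1 + a) * (1 + b)) = a * X + b * X + a * (a * X) + 2 * (a * (b * X)) + b * (b * X) + a * (a * (b * X)) + a * (b * (b * X)) by ring.
have : a * X + b * X <= C1 + C2 by apply: lerD.
lra.
Qed.

Lemma is_derive_int_box phi (u : R * R -> R) (t : R) : periodic_smooth phi -> continuous u ->
  is_derive t (1 : R) (fun t => int_box (fun x => at_time phi t x * u x))
    (int_box (fun x => at_time (dt phi) t x * u x)).
Proof.
move=> sp cu; have sp' : periodic_smooth (dt phi) by exact: periodic_smooth_dt.
have [C hC] := continuous_slab_bounded (t - 1) (t + 1) (periodic_smooth_continuous sp').
have [D hD] := continuous_box_bounded cu.
have dpu (s : R) x : is_derive s (1 : R) (fun s => at_time phi s x * u x) (at_time (dt phi) s x * u x).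
  have sm : smooth phi by case: sp.
  have := is_deriveM (is_derive_dt s x sm) (is_derive_cst (u x) s 1).
  by move/is_derive_eq; apply; rewrite /GRing.scale /= mulr0 add0r mulrC.
have sq (psi : R * (R * R) -> R) s : periodic_smooth psi -> sqb (fun x => at_time psi s x * u x).
  by move=> spsi; apply: continuous_sqb; apply: continuous_mul => //; exact: at_time_continuous.
have p1 (s : R) x : partial1of2 (fun s x => at_time phi s x * u x) s x = at_time (dt phi) s x * u x.
  by rewrite partial1of2E; case: (dpu s x).
have ep : \int[mu]_(y in bx) partial1of2 (fun s x => at_time phi s x * u x) t y =
    int_box (fun x => at_time (dt phi) t x * u x).
  by apply: eq_Rintegral => x _; rewrite p1.
have := @cvg_differentiation_under_integral _ _ _ mu (fun s x => at_time phi s x * u x) bx mB t (t - 1) (t + 1)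
   _ _ _ (fun=> `|C| * `|D|) _ _ _.
rewrite ep => H.
have {}H : h^-1 *: (int_box (fun x => at_time phi (h + t) x * u x) - int_box (fun x => at_time phi t x * u x)) @[h --> 0^'] -->
  int_box (fun x => at_time (dt phi) t x * u x).
  apply: H.
  - by rewrite /= in_itv /=; apply/andP; split; lra.
  - by move=> s _; apply: (sqi_integrable mB fB); exact: sq.
  - by move=> s x _ _; case: (dpu s x).
  - by move=> _; rewrite mulr_ge0.
  - exact: (sqi_integrable mB fB (sqi_cst mB fB _)).
  - move=> s x; rewrite /= in_itv /= => /andP[s1 s2] bxx; rewrite p1 normrM; apply: ler_pM => //.
      by apply: le_trans (ler_norm _); apply: hC => //; rewrite !ltW.
    exact: le_trans (hD _ bxx) (ler_norm _).
have e : (fun h : R => h^-1 *: (((fun t => int_box (fun x => at_time phi t x * u x)) \o shift t) (h *: 1) - int_box (fun x => at_time phi t x * u x))) =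
  (fun h => h^-1 *: (int_box (fun x => at_time phi (h + t) x * u x) - int_box (fun x => at_time phi t x * u x))).
  by apply/funext => h; rewrite /= /GRing.scale /= mulr1.
split; first by rewrite /derivable /= e; apply/cvg_ex; eexists; exact: H.
by rewrite /derive e; apply: cvg_lim.
Qed.

Lemma is_derive_fourier phi k (t : R) : periodic_smooth phi ->
  is_derive t (1 : R) (fun t => Re (fourier (at_time phi t) k)) (Re (fourier (at_time (dt phi) t) k)) /\
  is_derive t (1 : R) (fun t => Im (fourier (at_time phi t) k)) (Im (fourier (at_time (dt phi) t) k)).
Proof.
move=> sp; split.
  under eq_fun do rewrite fourierE /=; rewrite fourierE /=.
  have := is_deriveZ vol^-1 (is_derive_int_box t sp (continuous_ck (k := k))).
  by move/is_derive_eq; apply.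
under eq_fun do rewrite fourierE /=; rewrite fourierE /=.
have := is_deriveN (is_deriveZ vol^-1 (is_derive_int_box t sp (continuous_sk (k := k)))).
by move/is_derive_eq; apply.
Qed.

End TestFunctions.

(** * Fourier inversion *)

Section Rectangles.
Context {R : realType}.
Local Open Scope complex_scope.
Local Notation cabs := (@Normc.normc R).

Lemma pairB (U V : zmodType) (a b : U) (c d : V) : (a, c) - (b, d) = (a - b, c - d).
Proof. by []. Qed.

Lemma big_rect (V : nmodType) n m (F : int * int -> V) :
  \sum_(k <- rect n m) F k =
  \sum_(i <- iota 0 n.*2.+1) \sum_(j <- iota 0 m.*2.+1) F (i%:Z - n%:Z, j%:Z - m%:Z).
Proof. by rewrite /rect big_allpairs_dep. Qed.

Lemma telescope_iota (V : zmodType) (G : int -> V) (c : int) n :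
  \sum_(i <- iota 0 n) (G (i%:Z - c - 1) - G (i%:Z - c)) = G (- c - 1) - G (n%:Z - c - 1).
Proof.
elim: n => [|n ih]; first by rewrite big_nil sub0r subrr.
rewrite -addn1 iotaD big_cat /= ih big_seq1 add0n.
have -> : (n + 1)%:Z - c - 1 = n%:Z - c by rewrite PoszD; lia.
by rewrite addrA subrK.
Qed.

Lemma telescope_rect1 (V : zmodType) (d : int * int -> V) n m :
  \sum_(k <- rect n m) (d (k - (1, 0)) - d k) =
  \sum_(j <- iota 0 m.*2.+1) (d (- n%:Z - 1, j%:Z - m%:Z) - d (n%:Z, j%:Z - m%:Z)).
Proof.
rewrite big_rect exchange_big /=; apply: eq_bigr => j _.
transitivity (\sum_(i <- iota 0 n.*2.+1) ((fun i => d (i, j%:Z - m%:Z)) (i%:Z - n%:Z - 1) - (fun i => d (i, j%:Z - m%:Z)) (i%:Z - n%:Z))).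
  by apply: eq_bigr => i _ /=; rewrite pairB subr0.
rewrite (telescope_iota (fun i => d (i, j%:Z - m%:Z))); congr (_ - d (_, _)).
by rewrite -addnn; lia.
Qed.

Lemma telescope_rect2 (V : zmodType) (d : int * int -> V) m :
  \sum_(k <- rect 0 m) (d (k - (0, 1)) - d k) = d (0, - m%:Z - 1) - d (0, m%:Z).
Proof.
rewrite big_rect /= big_seq1.
transitivity (\sum_(j <- iota 0 m.*2.+1) ((fun j => d (0, j)) (j%:Z - m%:Z - 1) - (fun j => d (0, j)) (j%:Z - m%:Z))).
  by apply: eq_bigr => j _ /=; rewrite subrr pairB subr0.
rewrite (telescope_iota (fun j => d (0, j))); congr (_ - d (_, _)).
by rewrite -addnn; lia.
Qed.

Lemma notin_sq_fst n (i j : int) : (n < `|i|)%N -> (i, j) \notin sq n.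
Proof. by move=> h; rewrite mem_sq /= leqNgt h. Qed.

Lemma notin_sq_snd n (i j : int) : (n < `|j|)%N -> (i, j) \notin sq n.
Proof. by move=> h; rewrite mem_sq /= andbC leqNgt h. Qed.

Lemma absz_oppS (n : nat) : `|(- n%:Z - 1)%R|%N = n.+1.
Proof. lia. Qed.

Lemma bnd_small (c : int * int -> R[i]) A (e : R) : bnd (nsq \o c) A -> 0 < e ->
  exists N, forall k, k \notin sq N -> cabs (c k) <= e.
Proof.
move=> cA e0; have [N hN] := bnd_tail (fun k => nsq_ge0 (c k)) cA (exprn_gt0 2 e0).
exists N => k kN; have := hN [:: k] isT; rewrite big_seq1 => h.
rewrite -(@ler_pXn2r _ 2) ?nnegrE ?cabs_ge0 ?(ltW e0) // cabs_sqr; apply: h => l.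
by rewrite inE => /eqP ->.
Qed.

End Rectangles.

(** * Differences of a Lipschitz periodic function against e^{iz} - 1 *)

Section Quotient1D.
Context {R : realType}.
Implicit Types (u v w : R).

Lemma mul_cos_le_sin v : 0 <= v -> v <= pi -> v * cos v <= sin v.
Proof.
move=> v0 vpi; have [->|vn0] := eqVneq v 0; first by rewrite mul0r sin0.
have vp : 0 < v by rewrite lt_neqAle eq_sym vn0.
have [|c] := @MVT R sin cos 0 v vp (fun x _ => is_derive_sin x).
  by apply: continuous_subspaceT => x; exact: continuous_sin.
rewrite in_itv /= => /andP[c0 cv]; rewrite sin0 !subr0 => ->; rewrite mulrC ler_wpM2r //.
rewrite le_eqVlt; apply/orP; right; rewrite ltr_cos ?in_itv //=; apply/andP; split; lra.
Qed.

(** With v = 2 w the inequality reads 4 w sin w cos w <= 4 sin^2 w, which is [mul_cos_le_sin]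
    multiplied by 4 sin w. *)
Lemma mul_sin_le v : 0 <= v -> v <= pi -> v * sin v <= 2 - 2 * cos v /\ (cos v = 1 -> v = 0).
Proof.
move=> v0 vpi; pose w := v / 2; have vE : v = w *+ 2 by rewrite mulr2n /w; lra.
have w0 : 0 <= w by rewrite /w; lra.
have wpi : w <= pi by have := @pi_gt0 R; rewrite /w; lra.
have h := mul_cos_le_sin w0 wpi.
have s0 : 0 <= sin w by apply: sin_ge0_pi; rewrite w0 wpi.
have h2 := cos2Dsin2 w.
rewrite vE sin_mulr2n cos_mulr2n !mulr2n; split; first by nra.
move=> h3; have [->|wn0] := eqVneq w 0; first by rewrite addr0.
have : 0 < sin w by apply: sin_gt0_pi; rewrite lt_neqAle eq_sym wn0 w0 /=; have := @pi_gt0 R; rewrite /w; lra.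
by move=> s; nra.
Qed.

(* [|w sin w| <= 2 - 2 cos w] for [|w| <= pi], where w is u - v up to a period. *)
Lemma periodic_quotient (F : R -> R) (L : R) u v : 0 <= L ->
  (forall x y, 0 <= x <= 2 * pi -> 0 <= y <= 2 * pi -> `|F x - F y| <= L * `|x - y|) ->
  F (2 * pi) = F 0 -> 0 <= u <= 2 * pi -> 0 <= v <= 2 * pi ->
  `|(F u - F v) * sin (u - v)| <= L * (2 - 2 * cos (u - v)) /\
  (cos (u - v) = 1 -> F u - F v = 0).
Proof.
move=> L0 lip per hu hv; have p0 := @pi_gt0 R.
have key w : `|F u - F v| <= L * `|w| -> `|w| <= pi -> cos w = cos (u - v) -> sin w = sin (u - v) ->
  `|(F u - F v) * sin (u - v)| <= L * (2 - 2 * cos (u - v)) /\ (cos (u - v) = 1 -> F u - F v = 0).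
  move=> hF hw <- <-.
  have [h1 h2] := mul_sin_le (normr_ge0 w) hw.
  have es : `|sin w| = sin `|w|.
    have s0 : 0 <= sin `|w| by apply: sin_ge0_pi; rewrite normr_ge0.
    by have [w0|w0] := ger0P w; move: s0; [rewrite ger0_norm // => s0; rewrite ger0_norm|rewrite ltr0_norm // sinN => s0; rewrite ler0_norm //; lra].
  have ec : cos w = cos `|w| by have [w0|w0] := ger0P w; rewrite ?cosN.
  split.
    rewrite normrM es ec; apply: le_trans (_ : L * `|w| * sin `|w| <= _).
      by apply: ler_wpM2r => //; rewrite -es.
    by rewrite -mulrA ler_wpM2l.
  rewrite ec => /h2 w0; apply/eqP; rewrite -normr_le0.
  by apply: le_trans hF _; rewrite w0 mulr0.
(* Beyond half a period the increment of [F] is taken the other way round, through the endpoint 2 pi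
   identified with 0. *)
have [h1|h1] := ltP pi (u - v).
  apply: (key (u - v - 2 * pi)).
  - have -> : F u - F v = (F u - F (2 * pi)) + (F 0 - F v) by rewrite per; ring.
    apply: le_trans (ler_normD _ _) _.
    have b0 : 0 <= (0 : R) <= 2 * pi by lra.
    have b1 : 0 <= (2 * pi : R) <= 2 * pi by lra.
    have := lip u (2 * pi) hu b1; have := lip 0 v b0 hv.
    by rewrite (@ler0_norm _ (u - _)) ?(@ler0_norm _ (0 - _)) ?(@ler0_norm _ (u - v - _)); lra.
  - by rewrite ler0_norm; lra.
  - by rewrite -[in RHS](subrK (2 * pi) (u - v)) mulr_natl cosD2pi.
  - by rewrite -[in RHS](subrK (2 * pi) (u - v)) mulr_natl sinD2pi.
have [h2|h2] := ltP (u - v) (- pi).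
  apply: (key (u - v + 2 * pi)).
  - have -> : F u - F v = (F u - F 0) + (F (2 * pi) - F v) by rewrite per; ring.
    apply: le_trans (ler_normD _ _) _.
    have b0 : 0 <= (0 : R) <= 2 * pi by lra.
    have b1 : 0 <= (2 * pi : R) <= 2 * pi by lra.
    have := lip u 0 hu b0; have := lip (2 * pi) v b1 hv.
    by rewrite (@ger0_norm _ (u - _)) ?(@ger0_norm _ (2 * pi - v)) ?(@ger0_norm _ (u - v + _)); lra.
  - by rewrite ger0_norm; lra.
  - by rewrite mulr_natl cosD2pi.
  - by rewrite mulr_natl sinD2pi.
apply: (key (u - v)) => //; first exact: lip.
by rewrite ler_norml; apply/andP; split; lra.
Qed.

End Quotient1D.

Section Inversion.
Context {R : realType}.
Local Open Scope complex_scope.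
Local Notation mu := (@leb2 R).
Local Notation bx := (@box R).
Local Notation Re := (@complex.Re R).
Local Notation Im := (@complex.Im R).
Local Notation cabs := (@Normc.normc R).
Implicit Types (k : int * int) (x y : R * R).

Let mB := @measurable_box R.
Let fB := @leb2_box_fin R.

Definition cexp k y : R[i] := Complex (ck k y) (sk k y).

Lemma cexpD k (l : int * int) y : cexp (k + l) y = cexp k y * cexp l y.
Proof.
rewrite /cexp /ck /sk phaseD; move: (phase k y) (phase l y) => p q.
by apply: complexP; rewrite ?ReImE /= ?cosD ?sinD; ring.
Qed.

Lemma cexpN k y : cexp (- k) y = conjc (cexp k y).
Proof. by apply: complexP; rewrite ?ReImE /= /ck /sk phaseN ?cosN ?sinN. Qed.

Lemma cabs_cexp k y : cabs (cexp k y) = 1.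
Proof. by rewrite cabsE /nsq /= /ck /sk cos2Dsin2 sqrtr1. Qed.

Lemma tpE N (a : int * int -> R[i]) y : tp N a y = Re (\sum_(k <- sq N) a k * cexp k y).
Proof. by rewrite Re_sum; apply: eq_bigr => k _; rewrite ReM. Qed.

Lemma eq_fourier_box (f g : R * R -> R) k : (forall x, bx x -> f x = g x) -> fourier f k = fourier g k.
Proof.
move=> fg; rewrite !fourierE; congr (Complex (_ * _) (- (_ * _))).
  by apply: eq_Rintegral => x; rewrite inE => /fg ->.
by apply: eq_Rintegral => x; rewrite inE => /fg ->.
Qed.

Lemma fourier_lin (c d : R) (f g : R * R -> R) k : sqb f -> sqb g ->
  fourier (fun x => c * f x + d * g x) k = c%:C * fourier f k + d%:C * fourier g k.
Proof. by move=> hf hg; rewrite fourierD ?fourierZ //; exact: (sqiZ mB). Qed.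

(* The hypotheses say that G = (e^{iz} - 1) (- G / 2 - i b) with
   z = phase e x - phase e y. *)
Lemma fourier_shift (G b : R * R -> R) e y k : sqb G -> sqb b ->
  (forall x, bx x -> (1 - cos (phase e x - phase e y)) * b x = G x / 2 * sin (phase e x - phase e y)) ->
  (forall x, bx x -> b x * sin (phase e x - phase e y) = G x * (1 + cos (phase e x - phase e y)) / 2) ->
  let c := fun l => - 2^-1%:C * fourier G l - 'i * fourier b l in
  fourier G k = conjc (cexp e y) * c (k - e) - c k.
Proof.
move=> hG hb h1 h2 c; pose C := ck e y; pose S := sk e y.
have E1 : fourier (fun x => 1 * b x + (-1) * (C * (b x * ck e x) + S * (b x * sk e x))) k =
    fourier (fun x => (C / 2) * (G x * sk e x) + (- (S / 2)) * (G x * ck e x)) k.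
  apply: eq_fourier_box => x /h1; rewrite sinB cosB -/(ck e x) -/(sk e x) -/(ck e y) -/(sk e y) -/C -/S => h.
  by transitivity ((1 - (ck e x * C + sk e x * S)) * b x); [ring|rewrite h; field].
have E2 : fourier (fun x => C * (b x * sk e x) + (- S) * (b x * ck e x)) k =
    fourier (fun x => 2^-1 * G x + 2^-1 * (C * (G x * ck e x) + S * (G x * sk e x))) k.
  apply: eq_fourier_box => x /h2; rewrite sinB cosB -/(ck e x) -/(sk e x) -/(ck e y) -/(sk e y) -/C -/S => h.
  by transitivity (b x * (sk e x * C - ck e x * S)); [ring|rewrite h; field].
have [bc bs] : sqb (fun x => b x * ck e x) /\ sqb (fun x => b x * sk e x) by split; [exact: sqb_ck|exact: sqb_sk].
have [Gc Gs] : sqb (fun x => G x * ck e x) /\ sqb (fun x => G x * sk e x) by split; [exact: sqb_ck|exact: sqb_sk].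
have lin f g p q : sqb f -> sqb g -> sqb (fun x => p * f x + q * g x).
  by move=> hf hg; apply: (sqiD mB); exact: (sqiZ mB).
move: E1 E2.
rewrite (@fourier_lin 1 (-1) b (fun x => C * (b x * ck e x) + S * (b x * sk e x))) //; last exact: lin.
rewrite (@fourier_lin 2^-1 2^-1 G (fun x => C * (G x * ck e x) + S * (G x * sk e x))) //; last exact: lin.
rewrite !fourier_lin // !fourier_mul_ck // !fourier_mul_sk // /c /cexp -/C -/S.
move: (fourier G k) (fourier b k) (fourier G (k - e)) (fourier b (k - e)) (fourier G (k + e)) (fourier b (k + e)).
move: C S => C S [g1 g2] [b1 b2] [gm1 gm2] [bm1 bm2] [gp1 gp2] [bp1 bp2].
move=> /(congr1 (fun z => (Re z, Im z))); rewrite !ReImE /= => -[e1 e2].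
move=> /(congr1 (fun z => (Re z, Im z))); rewrite !ReImE /= => -[e3 e4].
by apply: complexP; rewrite !ReImE /=; lra.
Qed.

(** Since 1 / (e^{iz} - 1) = - 1/2 - (i/2) cot (z/2), the quotient of G by e^{iz} - 1 is - G / 2 - i
    b with b = (G / 2) cot (z/2). The hypothesis bounds b, so the quotient is square integrable and
    Bessel's inequality applies to its coefficients. *)
Lemma quotient_coef (G : R * R -> R) e y (L : R) : continuous G -> 0 <= L ->
  (forall x, bx x -> `|G x * sin (phase e x - phase e y)| <= L * (2 - 2 * cos (phase e x - phase e y)) /\
     (cos (phase e x - phase e y) = 1 -> G x = 0)) ->
  exists2 c : int * int -> R[i], exists A, bnd (nsq \o c) A &
    forall k, fourier G k = conjc (cexp e y) * c (k - e) - c k.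
Proof.
move=> cG L0 hG; pose z x := phase e x - phase e y.
pose D x := 2 - 2 * cos (z x).
(* Where [D x] is 0 the inverse is 0 by convention; this is the right value, because [G] vanishes
   there as well. *)
pose b x := G x * sin (z x) / D x.
have D0 x : 0 <= D x by rewrite /D; have := cos_le1 (z x); lra.
have cz : continuous z by move=> x; apply: cvgB; [exact: continuous_phase|exact: cvg_cst].
have ccz : continuous (fun x => cos (z x)).
  by move=> x; apply: (cvg_comp z cos); [exact: cz|exact: continuous_cos].
have csz : continuous (fun x => sin (z x)).
  by move=> x; apply: (cvg_comp z sin); [exact: cz|exact: continuous_sin].
(* Replacing [D x] by D x + 1/(n + 1) gives continuous functions that converge to [b] on the whole
   box, zeros of [D] included. *)
have mb : measurable_fun bx b.
  apply: (@measurable_fun_cvg _ _ _ _ (fun n x => G x * sin (z x) / (D x + n.+1%:R^-1))).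
    move=> n; apply: continuous_meas => x; apply: cvgM; first exact: continuous_mul.
    have dn : 0 < D x + n.+1%:R^-1 by rewrite ltr_wpDl // invr_gt0.
    apply: cvgV; first by rewrite gt_eqF.
    apply: cvgD; last exact: cvg_cst.
    by apply: cvgB; [exact: cvg_cst|apply: cvgM; [exact: cvg_cst|exact: ccz]].
  move=> x bxx; have [d0|d0] := eqVneq (D x) 0.
    have G0 : G x = 0 by apply: (hG x bxx).2; move: d0; rewrite /D /z; lra.
    rewrite /b G0 !mul0r; under eq_fun do rewrite !mul0r; exact: cvg_cst.
  apply: cvgM; first exact: cvg_cst.
  apply: cvgV => //; rewrite -[X in _ --> X]addr0.
  by apply: cvgD; [exact: cvg_cst|exact: cvg_harmonic].
have bL x : bx x -> `|b x| <= L.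
  move=> bxx; rewrite /b normrM normfV (ger0_norm (D0 x)).
  have [d0|d0] := eqVneq (D x) 0; first by rewrite d0 invr0 mulr0.
  rewrite ler_pdivrMr ?lt_neqAle ?D0 1?eq_sym ?d0 //.
  exact: (hG x bxx).1.
have sb : sqb b by exact: (sqi_bounded mB fB mb bL).
have sG := continuous_sqb cG.
exists (fun l => - 2^-1%:C * fourier G l - 'i * fourier b l); last first.
  move=> k; apply: fourier_shift => // x bxx; rewrite -/(z x) /b.
    have [d0|d0] := eqVneq (D x) 0.
      by rewrite d0 invr0 mulr0 ((hG x bxx).2 _) ?mul0r //; move: d0; rewrite /D /z; lra.
    by move: d0; rewrite /D => d0; field.
  have [d0|d0] := eqVneq (D x) 0.
    by rewrite d0 invr0 mulr0 ((hG x bxx).2 _) ?mul0r //; move: d0; rewrite /D /z; lra.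
  have := cos2Dsin2 (z x) => h.
  have -> : G x * sin (z x) / D x * sin (z x) = G x * sin (z x) ^+ 2 / D x by ring.
  have -> : sin (z x) ^+ 2 = (1 - cos (z x)) * (1 + cos (z x)) by lra.
  by move: d0; rewrite /D => d0; field.
eexists; apply: le_bnd (bndD (bndZ (ler0n R 2) (bessel sG)) (bndZ (ler0n R 2) (bessel sb))) => k /=.
move: (fourier G k) (fourier b k) => [g1 g2] [b1 b2]; rewrite /nsq !ReImE /=.
have := sqr_ge0 (g1 / 2 + b2); have := sqr_ge0 (g2 / 2 - b1); have := sqr_ge0 g1; have := sqr_ge0 g2; lra.
Qed.

Variables (f : R * R -> R) (L : R) (g : int * int -> R) (A : R).
Hypothesis cf : continuous f.
Hypothesis L0 : 0 <= L.
Hypothesis lip1 : forall u v w, 0 <= u <= 2 * pi -> 0 <= v <= 2 * pi -> 0 <= w <= 2 * pi ->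
  `|f (u, w) - f (v, w)| <= L * `|u - v|.
Hypothesis lip2 : forall u v w, 0 <= u <= 2 * pi -> 0 <= v <= 2 * pi -> 0 <= w <= 2 * pi ->
  `|f (w, u) - f (w, v)| <= L * `|u - v|.
Hypothesis per1 : forall w, f (2 * pi, w) = f (0, w).
Hypothesis per2 : forall w, f (w, 2 * pi) = f (w, 0).
Hypothesis fg : forall k, cabs (fourier f k) <= g k.
Hypothesis gA : bnd g A.

(* Chernoff's argument: f - f(y) is a sum of two multiples of e^{i(x_j - y_j)} - 1,
   so that partial sums over rectangles telescope to boundary terms.  The
   boundary of the first sum has 2 M + 1 terms, hence N tends to infinity for
   fixed M; the second function depends on x_2 only and leaves two terms. *)
Lemma rect_inversion y (e : R) : bx y -> 0 < e -> exists M0, forall M, (M0 <= M)%N ->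
  exists N0, forall N, (N0 <= N)%N ->
  cabs (\sum_(k <- rect N M) fourier f k * cexp k y - (f y)%:C) <= e.
Proof.
case: y => y1 y2 [/= Y1 Y2] e0; rewrite !in_itv /= in Y1 Y2.
set y := (y1, y2).
pose G1 x := f x - f (y1, x.2); pose G2 x := f (y1, x.2) - f y.
have cf2 : continuous (fun x : R * R => f (y1, x.2)).
  move=> x; apply: (cvg_comp (fun x : R * R => (y1, x.2)) f); last exact: cf.
  by apply: cvg_pairR; [exact: cvg_cst|exact: cvg_snd].
have cG1 : continuous G1 by move=> x; apply: cvgB; [exact: cf|exact: cf2].
have cG2 : continuous G2 by move=> x; apply: cvgB; [exact: cf2|exact: cvg_cst].
have ph1 x : phase (1, 0) x - phase (1, 0) y = x.1 - y1 by rewrite /phase /= !mul1r !mul0r !addr0.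
have ph2 x : phase (0, 1) x - phase (0, 1) y = x.2 - y2 by rewrite /phase /= !mul1r !mul0r !add0r.
have [c1 [A1 hA1] hc1] : exists2 c : int * int -> R[i], exists A, bnd (nsq \o c) A &
    forall k, fourier G1 k = conjc (cexp (1, 0) y) * c (k - (1, 0)) - c k.
  apply: (quotient_coef cG1 L0) => -[x1 x2] [/= X1 X2]; rewrite !in_itv /= in X1 X2; rewrite ph1.
  by apply: (@periodic_quotient _ (fun u => f (u, x2))) => // u v hu hv; exact: lip1.
have [c2 [A2 hA2] hc2] : exists2 c : int * int -> R[i], exists A, bnd (nsq \o c) A &
    forall k, fourier G2 k = conjc (cexp (0, 1) y) * c (k - (0, 1)) - c k.
  apply: (quotient_coef cG2 L0) => -[x1 x2] [/= X1 X2]; rewrite !in_itv /= in X1 X2; rewrite ph2.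
  by apply: (@periodic_quotient _ (fun u => f (y1, u))) => // u v hu hv; exact: lip2.
(* The function [G2] does not depend on x_1, so its derivative in x_1 is 0 and i k_1 annihilates its
   coefficients. *)
have G20 k : k.1 != 0 -> fourier G2 k = 0.
  move=> k1; have /esym/eqP : fourier (fun=> 0) k = Complex 0 k.1%:~R * fourier G2 k.
    apply: fourier_d1 => //; first by move=> x; exact: cvg_cst.
    by move=> x z; rewrite /G2 /=; exact: is_derive_cst.
  have -> : fourier (fun=> 0) k = 0 :> R[i].
    rewrite (@eq_fourier _ _ (fun=> 0 * 1)); last by move=> x; rewrite mul0r.
    by rewrite fourierZ ?mul0r //; exact: (sqi_cst mB fB 1).
  rewrite mulf_eq0 => /orP[/eqP /(congr1 Im) /eqP|/eqP //].
  by rewrite /= intr_eq0 (negPf k1).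
have decomp k : fourier f k = fourier G1 k + (fourier G2 k + (f y)%:C * (k == 0)%:R).
  rewrite -fourier_one -fourierZ; last exact: (sqi_cst mB fB 1).
  rewrite -fourierD; last 2 first.
  - exact: continuous_sqb.
  - by apply: continuous_sqb => x; exact: cvg_cst.
  rewrite -fourierD; last 2 first.
  - exact: continuous_sqb.
  - by apply: continuous_sqb => x; apply: cvgD; [exact: cG2|exact: cvg_cst].
  by apply: eq_fourier => x; rewrite /G1 /G2; ring.
have S3 N M : \sum_(k <- rect N M) (f y)%:C * (k == 0)%:R * cexp k y = (f y)%:C.
  rewrite (bigD1_seq 0) ?rect_uniq ?mem_rect //= big1 ?addr0; last by move=> k /negPf ->; rewrite mulr0 mul0r.
  by rewrite mulr1; apply: complexP; rewrite ?ReImE /= /ck /sk phase0 cos0 sin0; ring.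
have shift (c : int * int -> R[i]) u k : cexp k y * (conjc (cexp u y) * c (k - u) - c k) =
    cexp (k - u) y * c (k - u) - cexp k y * c k.
  by rewrite cexpD cexpN; ring.
have S1 N M : \sum_(k <- rect N M) fourier G1 k * cexp k y =
    \sum_(j <- iota 0 M.*2.+1) (cexp (- N%:Z - 1, j%:Z - M%:Z) y * c1 (- N%:Z - 1, j%:Z - M%:Z) -
       cexp (N%:Z, j%:Z - M%:Z) y * c1 (N%:Z, j%:Z - M%:Z)).
  rewrite -(telescope_rect1 (fun k => cexp k y * c1 k)); apply: eq_bigr => k _.
  by rewrite hc1 mulrC shift.
have S2 N M : \sum_(k <- rect N M) fourier G2 k * cexp k y =
    cexp (0, - M%:Z - 1) y * c2 (0, - M%:Z - 1) - cexp (0, M%:Z) y * c2 (0, M%:Z).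
  rewrite -(telescope_rect2 (fun k => cexp k y * c2 k)).
  transitivity (\sum_(k <- rect 0 M) fourier G2 k * cexp k y); last first.
    by apply: eq_bigr => k _; rewrite hc2 mulrC shift.
  rewrite (@big_uniq_sub _ (rect 0 M) (rect N M)) ?rect_uniq //; last first.
    by move=> k; rewrite !mem_rect => /andP[h1 h2]; rewrite h2 andbT; apply: leq_trans h1 _.
  rewrite [RHS]big_mkcond /= [LHS]big_seq [RHS]big_seq; apply: eq_bigr => k.
  rewrite !mem_rect => /andP[_ ->]; rewrite andbT; case: leqP => // k1.
  by rewrite G20 ?mul0r //; move: k1; lia.
have e4 : 0 < e / 4 by lra.
have [M0 hM0] := bnd_small hA2 e4.
exists M0.+1 => M hM.
(* Each of the 2 M + 1 values of j leaves two boundary terms, and together they are allowed e /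
   2. *)
have e5 : 0 < e / 4 / M.*2.+1%:R by rewrite divr_gt0.
have [N0 hN0] := bnd_small hA1 e5.
exists N0.+1 => N hN.
under eq_bigr do rewrite decomp mulrDl mulrDl.
rewrite !big_split /= S1 S2 S3.
rewrite (_ : forall a b c : R[i], a + (b + c) - c = a + b); last by move=> a b c; ring.
apply: le_trans (cabsD _ _) _.
have -> : e = M.*2.+1%:R * (e / 4 / M.*2.+1%:R + e / 4 / M.*2.+1%:R) + (e / 4 + e / 4).
  have m0 : M.*2.+1%:R != 0 :> R by rewrite pnatr_eq0.
  by move: (M.*2.+1%:R) m0 => q q0; field.
apply: lerD; last first.
  apply: le_trans (cabsB _ _) _; rewrite !cabsM !cabs_cexp !mul1r.
  by apply: lerD; apply: hM0; apply: notin_sq_snd => //; rewrite absz_oppS; exact: leqW.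
apply: le_trans (cabs_sum _ _ _) _.
apply: le_trans (_ : \sum_(j <- iota 0 M.*2.+1) (e / 4 / M.*2.+1%:R + e / 4 / M.*2.+1%:R) <= _).
  apply: ler_sum => j _; apply: le_trans (cabsB _ _) _; rewrite !cabsM !cabs_cexp !mul1r.
  by apply: lerD; apply: hN0; apply: notin_sq_fst => //; rewrite absz_oppS; exact: leqW.
by rewrite big_const_seq count_predT size_iota iter_addr_0 mulr_natl.
Qed.

(** The rectangle supplied by [rect_inversion] depends on y. Absolute summability removes this
    dependence: a rectangle or a square containing [sq N0] has a partial sum within e / 3 of that
    over [sq N0], uniformly in y. *)
Lemma fourier_inversion (e : R) : 0 < e -> exists N0, forall N y, (N0 <= N)%N -> bx y ->
  `|f y - tp N (fourier f) y| <= e.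
Proof.
move=> e0; have e3 : 0 < e / 3 by lra.
have g0 k : 0 <= g k by exact: le_trans (cabs_ge0 _) (fg k).
have [N0 hN0] := bnd_tail g0 gA e3.
have tl y s : uniq s -> {subset sq N0 <= s} ->
    cabs (\sum_(k <- s) fourier f k * cexp k y - \sum_(k <- sq N0) fourier f k * cexp k y) <= e / 3.
  move=> us ss; rewrite (@big_uniq_sub _ (sq N0) s) ?sq_uniq //.
  rewrite (bigID (mem (sq N0))) /= addrC addrK.
  apply: le_trans (cabs_sum _ _ _) _; rewrite -big_filter.
  apply: le_trans (hN0 [seq k <- s | k \notin sq N0] _ _); last 2 first.
  - exact: filter_uniq.
  - by move=> k; rewrite mem_filter => /andP[].
  by apply: ler_sum => k _; rewrite cabsM cabs_cexp mulr1.
exists N0 => N y hN bxy.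
have [M0 hM0] := rect_inversion bxy e3.
have [N1 hN1] := hM0 (maxn M0 N0) (leq_maxl _ _).
have := hN1 (maxn N1 N0) (leq_maxl _ _).
set S := \sum_(k <- rect _ _) _ => hS.
have h1 := tl y (sq N) (sq_uniq N) (fun k => @mem_sqW N0 N k hN).
have h2 : cabs (S - \sum_(k <- sq N0) fourier f k * cexp k y) <= e / 3.
  apply: tl; first exact: rect_uniq.
  by move=> k; rewrite mem_sq mem_rect => /andP[a b]; rewrite !leq_max a b !orbT.
rewrite tpE distrC; set P := \sum_(k <- sq N) _.
have -> : Re P - f y = Re (P - (f y)%:C) by rewrite ReD ReN.
apply: le_trans (cabs_Re _) _.
move: hS h1 h2; rewrite -/P; set Q := \sum_(k <- sq N0) _ => hS h1 h2.
have -> : P - (f y)%:C = (P - Q) - (S - Q) + (S - (f y)%:C) by ring.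
have := cabsD (P - Q - (S - Q)) (S - (f y)%:C); have := cabsB (P - Q) (S - Q); lra.
Qed.

Lemma inversion_parseval (h : R * R -> R) : sqb h ->
  (fun N => vol * \sum_(k <- sq N) Re (fourier f k * conjc (fourier h k))) @ \oo -->
  int_box (fun x => f x * h x).
Proof.
move=> hh; have sf := continuous_sqb cf.
have H : (fun N => int_box (fun x => (f x - tp N (fourier f) x) ^+ 2)) @ \oo --> (0 : R).
  apply/cvgrPdist_le => e e0.
  have v0 := @vol_gt0 R; have d0 : 0 < e / vol by rewrite divr_gt0.
  (* An error that is at most 1 dominates its square. *)
  have d1 : 0 < Num.min 1 (e / vol) by rewrite lt_min ltr01.
  have [N0 hN0] := fourier_inversion d1.
  exists N0 => // N hN; rewrite sub0r normrN.
  have -> : e = e / vol * vol by rewrite divfK // gt_eqF.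
  apply: int_box_bound => [x|x bxx].
    rewrite /=; under eq_fun do rewrite expr2.
    by apply: continuous_mul => {}x; apply: cvgB; [exact: cf|exact: continuous_tp|exact: cf|exact: continuous_tp].
  rewrite normrX; have := hN0 N x hN bxx; rewrite le_min => /andP[h1 h2].
  apply: le_trans h2; rewrite expr2 ler_piMr //.
have := @sqi_cvg _ _ _ mu _ mB f (fun N => tp N (fourier f)) h sf (fun N => tp_sqb N _) hh H.
apply: cvg_trans; apply: near_eq_cvg; apply: nearW => N.
by rewrite -int_box_tp.
Qed.

End Inversion.

(** * The commutator *)

Section Nonlinear.
Context {R : realType}.
Local Open Scope complex_scope.
Local Notation Re := (@complex.Re R).
Local Notation Im := (@complex.Im R).
Local Notation cabs := (@Normc.normc R).
Local Notation vol := (@vol R).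
Local Notation fn := (@freq_norm R).
Implicit Types (k l m : int * int).

Lemma ccvg_idx (a : int * int -> R[i]) M (u : nat -> R[i]) z : bnd (nsq \o a) M ->
  ccvg \oo u z -> ccvg \oo (fun j => u (idx a j)) z.
Proof.
move=> aM [h1 h2]; split; first exact: (idx_cvg aM h1).
exact: (idx_cvg aM h2).
Qed.

Lemma ccvg_fourier_rf_mul (a : int * int -> R[i]) M (v : R * R -> R) k :
  hermitian a -> bnd (nsq \o a) M -> continuous v ->
  ccvg \oo (fun N => \sum_(l <- sq N) a l * fourier v (k - l)) (fourier (fun x => rf a x * v x) k).
Proof.
move=> ha aM cv; have hb := bessel (continuous_sqb cv).
have [z hz] : exists z, ccvg \oo (fun N => \sum_(l <- sq N) a l * fourier v (k - l)) z.
  apply: (@abs_ccvg _ (fun l => a l * fourier v (k - l)) (fun l => cabs (fourier v (k - l) * a l))).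
    by move=> l; rewrite mulrC.
  apply: sum_cabs_le; last exact: aM.
  move=> N; apply: (@bnd_shift _ (nsq \o fourier v)) hb (sq_uniq N) => l.
  exact: nsq_ge0.
by rewrite (ccvg_unique (fourier_rf_mul ha aM k cv) (ccvg_idx aM hz)).
Qed.

Lemma fn_le_sqr k : fn k <= fn k ^+ 2.
Proof.
have [->|k0] := eqVneq k 0; first by rewrite fn_eq0 expr0n.
by rewrite expr2 ler_peMl ?fn_ge0 // fn_ge1.
Qed.

Lemma ReIm_int (z : int) : Re (z%:~R : R[i]) = z%:~R /\ Im (z%:~R : R[i]) = 0.
Proof.
have -> : (z%:~R : R[i]) = (z%:~R)%:C by rewrite rmorph_int.
by [].
Qed.

Variable beta : R.
Local Notation s := (2 - beta).
Hypothesis s0 : 0 <= s.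
Hypothesis s1 : s <= 1.
Variables (a : int * int -> R[i]) (M : R).
Hypothesis ha : hermitian a.
Hypothesis aM : bnd (nsq \o a) M.
Hypothesis a00 : a 0 = 0.
(** Here [p] stands for the coefficients of the test function at a fixed time, and [v1], [v2] for
    its gradient. *)
Variables (p : int * int -> R[i]) (v1 v2 : R * R -> R) (Cp : R).
Hypothesis hp : hermitian p.
Hypothesis cv1 : continuous v1.
Hypothesis cv2 : continuous v2.
Hypothesis hv1 : forall k, fourier v1 k = Complex 0 k.1%:~R * p k.
Hypothesis hv2 : forall k, fourier v2 k = Complex 0 k.2%:~R * p k.
Hypothesis hCp : forall k, fn k ^+ 2 * cabs (p k) <= Cp * decay k.
Hypothesis Cp0 : 0 <= Cp.

(** Solving - |k|^2 psi_k = |k|^beta a_k gives psi_k = - |k|^-s a_k. *)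
Definition psic k : R[i] := (- wgt s k)%:C * a k.

Lemma psic_hermitian : hermitian psic.
Proof. by move=> k; rewrite /psic wgtN ha conjcM conjc_real. Qed.

Lemma psic_le k : cabs (psic k) = wgt s k * cabs (a k).
Proof. by rewrite cabsM cabs_real normrN ger0_norm // wgt_ge0. Qed.

Lemma wgt_le1 k : k != 0 -> wgt s k <= 1.
Proof.
by move=> k0; have := wgt_le s0 ltr01 (fn_ge1 k0); rewrite powR1.
Qed.

Lemma psic_bnd : bnd (nsq \o psic) M.
Proof.
apply: le_bnd aM => k /=; have [->|k0] := eqVneq k 0; first by rewrite /psic a00 mulr0.
rewrite -!cabs_sqr psic_le exprMn ler_piMl ?sqr_ge0 //.
by rewrite expr_le1 ?wgt_ge0 // wgt_le1.
Qed.

Lemma M_ge0 : 0 <= M.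
Proof. by apply: bnd_ge0 aM => k; exact: nsq_ge0. Qed.

Lemma a_le k : cabs (a k) <= 1 + M.
Proof. by apply: cabs_le1; apply: (bnd_single k _ aM) => l; exact: nsq_ge0. Qed.

Lemma powR_wgt k : k != 0 -> fn k `^ s * wgt s k = 1.
Proof.
move=> k0; rewrite /wgt powRN mulfV // gt_eqF // powR_gt0 //.
exact: lt_le_trans ltr01 (fn_ge1 k0).
Qed.

(* Terms of the commutator, in which k x (k - l) = l x (k - l) absorbs the
   difference |k|^s - |l|^s into |k - l|^2 |p (k - l)| |a l|. *)
Definition cterm k l : R[i] :=
  (- (cross k (k - l) * (fn k `^ s - fn l `^ s)))%:C * (psic l * p (k - l)).

Definition csum N k : R[i] := \sum_(l <- sq N) cterm k l.

Definition wt k : R := fn k ^+ 2 * cabs (p k).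

Lemma wt_ge0 k : 0 <= wt k.
Proof. by rewrite mulr_ge0 ?sqr_ge0 ?cabs_ge0. Qed.

Lemma wt_bnd : bnd wt (Cp * 25).
Proof. by apply: (le_bnd hCp); apply: bndZ => //; exact: decay_bnd. Qed.

Lemma cross_subr k l : cross k (k - l) = cross l (k - l) :> R.
Proof. by rewrite /cross /= !intrB; ring. Qed.

Lemma cterm_le k l : cabs (cterm k l) <= wt (k - l) * cabs (a l).
Proof.
have [->|l0] := eqVneq l 0; first by rewrite /cterm /psic a00 !mulr0 mul0r mulr0 cabs0 mulr0.
have [->|k0] := eqVneq k 0.
  by rewrite /cterm cross0l mul0r oppr0 mul0r cabs0 mulr_ge0 ?wt_ge0 ?cabs_ge0.
rewrite /cterm cabsM cabs_real normrN normrM cabsM psic_le cross_subr /wt.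
have fl : 0 < fn l by exact: lt_le_trans ltr01 (fn_ge1 l0).
have fk : 0 < fn k by exact: lt_le_trans ltr01 (fn_ge1 k0).
have h1 := @cross_le R l (k - l).
have h2 := powRB_le s0 s1 fk fl.
have h3 := le_trans h2 (ler_wpM2r (divr_ge0 (powR_ge0 _ _) (ltW fl)) (@fnB R k l)).
have h4 : `|cross l (k - l)| * `|fn k `^ s - fn l `^ s| <= fn l * fn (k - l) * (fn (k - l) * (fn l `^ s / fn l)).
  by apply: ler_pM.
have h5 : 0 <= wgt s l * cabs (a l) * cabs (p (k - l)).
  by rewrite !mulr_ge0 ?wgt_ge0 ?cabs_ge0.
apply: le_trans (ler_wpM2r h5 h4) _.
have h6 := powR_wgt l0.
have -> : fn l * fn (k - l) * (fn (k - l) * (fn l `^ s / fn l)) * (wgt s l * cabs (a l) * cabs (p (k - l)))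
   = (fn l `^ s * wgt s l) * (fn (k - l) ^+ 2 * cabs (p (k - l)) * cabs (a l)).
  by field; rewrite gt_eqF.
by rewrite h6 mul1r.
Qed.

(** A majorant of every partial sum [csum N k], square summable in k by [young]. *)
Definition cmaj k : R := limn (fun N => \sum_(l <- sq N) wt (k - l) * cabs (a l)).

Lemma cabs_a_bnd : bnd (fun k => cabs (a k) ^+ 2) M.
Proof. by apply: le_bnd aM => k /=; rewrite cabs_sqr. Qed.

Lemma cmaj_summable k : bnd (fun l => wt (k - l) * cabs (a l)) (Cp * 25 * (1 + M)).
Proof.
move=> N; apply: le_trans (_ : \sum_(l <- sq N) wt (k - l) * (1 + M) <= _).
  by apply: ler_sum => l _; rewrite ler_wpM2l ?wt_ge0 // a_le.
rewrite -mulr_suml ler_wpM2r ?addr_ge0 ?M_ge0 //.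
exact: (bnd_shift k wt_ge0 wt_bnd (sq_uniq N)).
Qed.

Lemma wta_ge0 k l : 0 <= wt (k - l) * cabs (a l).
Proof. by rewrite mulr_ge0 ?wt_ge0 ?cabs_ge0. Qed.

Lemma cmaj_cvg k : (fun N => \sum_(l <- sq N) wt (k - l) * cabs (a l)) @ \oo --> cmaj k.
Proof. exact: (bnd_cvg (wta_ge0 k) (cmaj_summable k)). Qed.

Lemma le_cmaj N k : \sum_(l <- sq N) wt (k - l) * cabs (a l) <= cmaj k.
Proof.
apply: nondecreasing_cvgn_le; last by apply/cvg_ex; eexists; exact: cmaj_cvg.
by apply: sum_sq_mono => l; exact: wta_ge0.
Qed.

Lemma cmaj_bnd : bnd (fun k => cmaj k ^+ 2) ((Cp * 25) ^+ 2 * M).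
Proof.
move=> n; have h : (fun N => \sum_(k <- sq n) (\sum_(l <- sq N) wt (k - l) * cabs (a l)) ^+ 2) @ \oo -->
    \sum_(k <- sq n) cmaj k ^+ 2.
  apply: (@cvg_sumr _ _ _ _ _ _ (fun N k => (\sum_(l <- sq N) wt (k - l) * cabs (a l)) ^+ 2)) => k.
  by rewrite expr2; under eq_fun do rewrite expr2; apply: cvgM; exact: cmaj_cvg.
rewrite -(cvg_lim _ h) //; apply: limr_le; first by apply/cvg_ex; eexists; exact: h.
apply: nearW => N; exact: (young wt_ge0 wt_bnd cabs_a_bnd N n).
Qed.

Lemma csum_le N k : cabs (csum N k) <= cmaj k.
Proof.
apply: le_trans (le_cmaj N k); apply: le_trans (cabs_sum _ _ _) _.
by apply: ler_sum => l _; exact: cterm_le.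
Qed.

Lemma csumJ N k : csum N (- k) = conjc (csum N k).
Proof.
rewrite /csum conjc_sum -(big_sqN N (cterm (- k))); apply: eq_bigr => l _.
rewrite /cterm (conjcM _ (psic l * _)) (conjcM (psic l)) conjc_real -psic_hermitian -hp !fnN.
have -> : - k - - l = - (k - l) by rewrite opprD.
by rewrite crossNN.
Qed.

Definition commc : int * int -> R[i] := commutator beta v1 v2 (rf psic).

(** The four convolutions in the commutator converge separately, so their partial sums over the same
    square may be combined term by term; the combination is [cterm] because k x (k - l) = l x (k -
    l). *)
Lemma commc_cvg k : ccvg \oo (fun N => csum N k) (commc k).
Proof.
pose A l := psic l * fourier v1 (k - l); pose B l := psic l * fourier v2 (k - l).
have hA := ccvg_fourier_rf_mul k psic_hermitian psic_bnd cv1.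
have hB := ccvg_fourier_rf_mul k psic_hermitian psic_bnd cv2.
pose T1 l := fourier v1 (k - l) * Lam s (fun l => - dx2 psic l) l.
pose T2 l := fourier v2 (k - l) * Lam s (dx1 psic) l.
have fpsi : fourier (rf psic) = psic.
  by apply/funext => l; exact: (fourier_rf psic_hermitian psic_bnd).
(* The two convolutions taken separately do not profit from the cancellation: |k - l| |l| <= (1 +
   |k|) |k - l|^2, using |k - l| <= |k - l|^2 on the lattice. The factor 1 + |k| is harmless as k is
   fixed. *)
pose maj l := (1 + fn k) * (wt (k - l) * cabs (a l)).
have maj_bnd : bnd maj ((1 + fn k) * (Cp * 25 * (1 + M))).
  by apply: bndZ; [rewrite addr_ge0 ?fn_ge0|exact: cmaj_summable].
have T_le (x y : R) l : `|x| <= fn (k - l) -> `|y| <= fn l ->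
    cabs (Complex 0 x * p (k - l) * ((fn l `^ s)%:C * (Complex 0 y * psic l))) <= maj l.
  move=> hx hy; rewrite /maj /wt; have [->|l0] := eqVneq l 0.
    by rewrite /psic a00 !mulr0 cabs0 !mulr0.
  rewrite (cabsM (Complex 0 x * _)) (cabsM (Complex 0 x)) (cabsM (fn l `^ s)%:C) (cabsM (Complex 0 y)).
  rewrite psic_le cabs_real ger0_norm ?powR_ge0 //.
  have cI (r : R) : cabs (Complex 0 r) = `|r| by rewrite cabsE /nsq /= expr0n add0r sqrtr_sqr.
  rewrite !cI.
  have -> : `|x| * cabs (p (k - l)) * (fn l `^ s * (`|y| * (wgt s l * cabs (a l)))) =
     (fn l `^ s * wgt s l) * ((`|x| * `|y|) * (cabs (p (k - l)) * cabs (a l))) by ring.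
  rewrite powR_wgt // mul1r.
  have -> : (1 + fn k) * (fn (k - l) ^+ 2 * cabs (p (k - l)) * cabs (a l)) =
     ((1 + fn k) * fn (k - l) ^+ 2) * (cabs (p (k - l)) * cabs (a l)) by ring.
  apply: ler_wpM2r; first by rewrite mulr_ge0 ?cabs_ge0.
  apply: le_trans (_ : fn (k - l) * fn l <= _); first exact: ler_pM.
  have h1 : fn l <= fn k + fn (k - l).
    by rewrite -[X in fn X <= _](subKr k) -(@fnN R (k - l)); exact: fnD.
  have h2 := fn_le_sqr (k - l); have h3 := @fn_ge0 R (k - l); have h4 := @fn_ge0 R k.
  apply: le_trans (ler_wpM2l h3 h1) _; rewrite mulrDr mulrDl mul1r -expr2 addrC lerD2l mulrC.
  exact: ler_wpM2l.
have comp_le l : `|(l.1%:~R : R)| <= fn l /\ `|(l.2%:~R : R)| <= fn l.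
  have h := @fn_sqr R l; have h0 := @fn_ge0 R l; have a1 := sqr_ge0 (l.1%:~R : R); have a2 := sqr_ge0 (l.2%:~R : R).
  by split; rewrite -(@ler_pXn2r _ 2) ?nnegrE // -normrX ger0_norm // h; lra.
have [z1 hz1] : exists z, ccvg \oo (fun N => \sum_(l <- sq N) T1 l) z.
  apply: (abs_ccvg _ maj_bnd) => l; rewrite /T1 /Lam /dx2 hv1.
  have -> : - ('i * l.2%:~R * psic l) = Complex 0 (- l.2%:~R) * psic l.
    have [i1 i2] := ReIm_int l.2.
    by apply: complexP; rewrite !ReImE i1 i2 /=; ring.
  by apply: T_le; [exact: (comp_le (k - l)).1|rewrite normrN; exact: (comp_le l).2].
have [z2 hz2] : exists z, ccvg \oo (fun N => \sum_(l <- sq N) T2 l) z.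
  apply: (abs_ccvg _ maj_bnd) => l; rewrite /T2 /Lam /dx1 hv2.
  have -> : 'i * l.1%:~R * psic l = Complex 0 l.1%:~R * psic l.
    have [i1 i2] := ReIm_int l.1.
    by apply: complexP; rewrite !ReImE i1 i2 /=; ring.
  by apply: T_le; [exact: (comp_le (k - l)).2|exact: (comp_le l).1].
have e1 : pmul (fourier v1) (Lam s (fun l => - dx2 (fourier (rf psic)) l)) k = z1.
  rewrite fpsi; apply: ccvg_limn; move: hz1; congr (ccvg _ _ _); apply/funext => N.
  by rewrite -big_sq.
have e2 : pmul (fourier v2) (Lam s (dx1 (fourier (rf psic)))) k = z2.
  rewrite fpsi; apply: ccvg_limn; move: hz2; congr (ccvg _ _ _); apply/funext => N.
  by rewrite -big_sq.
rewrite /commc /commutator e1 e2 /Lam /perp_div /dx1 /dx2.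
have -> : (fun N => csum N k) = (fun N =>
    (fn k `^ s)%:C * (- ('i * k.2%:~R * (\sum_(l <- sq N) psic l * fourier v1 (k - l))) +
                         'i * k.1%:~R * (\sum_(l <- sq N) psic l * fourier v2 (k - l))) -
    (\sum_(l <- sq N) T1 l + \sum_(l <- sq N) T2 l)).
  apply/funext => N; rewrite !mulr_sumr -sumrN -big_split /= mulr_sumr -!big_split -sumrB /=.
  apply: eq_bigr => l _; rewrite /cterm /T1 /T2 /Lam /dx1 /dx2 hv1 hv2.
  have [i1 i2] := ReIm_int k.1; have [i3 i4] := ReIm_int k.2.
  have [i5 i6] := ReIm_int l.1; have [i7 i8] := ReIm_int l.2.
  move: (psic l) (p (k - l)) (fn k `^ s) (fn l `^ s) => z w x y.
  rewrite /cross /= !intrB.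
  by apply: complexP; rewrite !ReImE i1 i2 i3 i4 i5 i6 i7 i8 /=; ring.
apply: ccvgB; last exact: ccvgD.
apply: ccvgM; first exact: ccvg_cst.
apply: ccvgD; first apply: ccvgN.
  by apply: ccvgM; [exact: ccvg_cst|exact: hA].
by apply: ccvgM; [exact: ccvg_cst|exact: hB].
Qed.

Lemma commc_le k : cabs (commc k) <= cmaj k.
Proof.
apply: (@ccvg_le _ _ _ _ _ _ (fun=> cmaj k) (cmaj k) _ (commc_cvg k)); first exact: cvg_cst.
by apply: nearW => N; exact: csum_le.
Qed.

Lemma commc_bnd : bnd (nsq \o commc) ((Cp * 25) ^+ 2 * M).
Proof.
apply: le_bnd cmaj_bnd => k /=; rewrite -cabs_sqr.
have := commc_le k; have := cabs_ge0 (commc k); nra.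
Qed.

Lemma commc_hermitian : hermitian commc.
Proof.
move=> k; apply: ccvg_unique (commc_cvg (- k)) _.
have h : ccvg \oo (fun N => conjc (csum N k)) (conjc (commc k)) by apply: ccvgJ; exact: commc_cvg.
by under eq_fun do rewrite csumJ.
Qed.

(** An exact finite identity. After l is changed to - l, the weights of the two stream coefficients
    turn |k|^s - |l|^s into |l|^-s - |k|^-s, which is the kernel. Grouping the pairs by m = k + l
    leads to the square of twice the size. *)
Lemma csum_quad N : - 2^-1%:C * \sum_(k <- sq N) psic k * conjc (csum N k) =
  \sum_(m <- sq N.*2) quad s N a m * conjc (p m).
Proof.
transitivity (\sum_(k <- sq N) \sum_(l <- sq N) (ker s k l)%:C * (a k * a l * conjc (p (k + l)))).
  rewrite mulr_sumr; apply: eq_bigr => k _.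
  rewrite /csum conjc_sum -(big_sqN N (fun l => conjc (cterm k l))) !mulr_sumr; apply: eq_bigr => l _.
  rewrite /cterm (conjcM _ (psic (- l) * _)) (conjcM (psic (- l))) conjc_real opprK -psic_hermitian opprK fnN /psic.
  have [->|k0] := eqVneq k 0; first by rewrite a00 !(mulr0, mul0r).
  have [->|l0] := eqVneq l 0; first by rewrite a00 !(mulr0, mul0r).
  rewrite -cross_sum.
  have hk := powR_wgt k0; have hl := powR_wgt l0.
  have e : ker s k l = - 2^-1 * (cross k l * (fn k `^ s * wgt s k * wgt s l - fn l `^ s * wgt s l * wgt s k)) * -1.
    by rewrite /ker hk hl; ring.
  rewrite e; move: (a k) (a l) (conjc (p (k + l))) (fn k `^ s) (fn l `^ s) (wgt s k) (wgt s l) (cross k l) => z w q x y u v c.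
  by apply: complexP; rewrite !ReImE /=; ring.
transitivity (\sum_(m <- sq N.*2) \sum_(k <- sq N) \sum_(l <- sq N | k + l == m) (ker s k l)%:C * (a k * a l * conjc (p (k + l)))); last first.
  apply: eq_bigr => m _; rewrite /quad (big_pair_sum N (fun l m => (ker s l m)%:C * (a l * a m))) mulr_suml.
  apply: eq_bigr => k _; rewrite mulr_suml; apply: eq_bigr => l /eqP ->.
  by rewrite !mulrA.
rewrite [RHS]exchange_big /=; apply: eq_big_seq => k kN; rewrite [RHS](exchange_big_dep xpredT) //=; apply: eq_big_seq => l lN.
under eq_bigl do rewrite eq_sym.
rewrite (big_sq_pair N.*2 (k + l) (fun=> (ker s k l)%:C * (a k * a l * conjc (p (k + l))))).
suff -> : k + l \in sq N.*2 by [].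
by move: kN lN; rewrite !mem_sq /= -addnn; lia.
Qed.

(** The nonlinear term as the pairing of the right-hand side of the infinite system with the test
    function. This form can be integrated in time mode by mode; [nlvE] identifies it with the
    commutator form. *)
Definition nlv : R := vol * limn (fun N => \sum_(m <- sq N) Re (qlim s a m * conjc (p m))).

Lemma qlim_p_le m : `|Re (qlim s a m * conjc (p m))| <= M * (Cp * decay m).
Proof.
apply: le_trans (cabs_Re _) _; rewrite cabsM cabsJ.
apply: le_trans (ler_wpM2r (cabs_ge0 _) (qlim_le s0 s1 m aM)) _.
by rewrite mulrAC mulrC ler_wpM2l ?M_ge0.
Qed.

Lemma qlim_p_cvg : (fun N => \sum_(m <- sq N) Re (qlim s a m * conjc (p m))) @ \oo --> nlv / vol.
Proof.
have -> : nlv / vol = limn (fun N => \sum_(m <- sq N) Re (qlim s a m * conjc (p m))).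
  by rewrite /nlv mulrAC divff ?mul1r // gt_eqF // vol_gt0.
apply: (abs_cvg qlim_p_le).
by apply: bndZ; [exact: M_ge0|apply: bndZ => //; exact: decay_bnd].
Qed.

(** The two members of [csum_quad] converge to the two sides, up to the factor [vol]. The majorants
    are (|a_k|^2 + cmaj k^2) / 2 for the commutator sum and M Cp [decay] for the regrouped one. *)
Lemma nlvE : nlv = - 2^-1 * int_box (fun x => rf psic x * rf commc x).
Proof.
have v0 : vol != 0 by rewrite gt_eqF // vol_gt0.
have hC := rf_sqb commc_hermitian commc_bnd.
have fC k : fourier (rf commc) k = commc k by exact: (fourier_rf commc_hermitian commc_bnd).
have h1 := rf_parseval psic_hermitian psic_bnd hC.
have h2 : (fun N => \sum_(k <- sq N) Re (psic k * conjc (commc k))) @ \oo -->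
    int_box (fun x => rf psic x * rf commc x) / vol.
  rewrite [X in X @ _](_ : _ = fun N => vol * (\sum_(k <- sq N) Re (psic k * conjc (fourier (rf commc) k))) / vol).
    by apply: cvgM; [exact: h1|exact: cvg_cst].
  by apply/funext => N; rewrite mulrAC divff // mul1r; apply: eq_bigr => k _; rewrite fC.
have h3 : (fun N => \sum_(k <- sq N) Re (psic k * conjc (csum N k))) @ \oo -->
    int_box (fun x => rf psic x * rf commc x) / vol.
  apply: (@tannery_cvg _ (fun N k => Re (psic k * conjc (csum N k))) _ (fun k => (cabs (a k) ^+ 2 + cmaj k ^+ 2) / 2) _ id _ _ _ _ _ h2) => //.
  - move=> N k; apply: le_trans (cabs_Re _) _; rewrite cabsM cabsJ psic_le.
    have e1 : wgt s k * cabs (a k) <= cabs (a k).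
      have [->|k0] := eqVneq k 0; first by rewrite a00 cabs0 mulr0.
      by rewrite ler_piMl ?cabs_ge0 // wgt_le1.
    have e2 := csum_le N k; have e3 := cabs_ge0 (csum N k); have e4 := cabs_ge0 (a k).
    have e5 : wgt s k * cabs (a k) * cabs (csum N k) <= cabs (a k) * cmaj k.
      by apply: ler_pM => //; rewrite mulr_ge0 ?wgt_ge0.
    apply: le_trans e5 _; have := sqr_ge0 (cabs (a k) - cmaj k); lra.
  - move=> n; rewrite -mulr_suml big_split /=.
    apply: ler_wpM2r; first by rewrite invr_ge0.
    by apply: lerD; [exact: cabs_a_bnd|exact: cmaj_bnd].
  - move=> k.
    have [h _] : ccvg \oo (fun N => psic k * conjc (csum N k)) (psic k * conjc (commc k)).
      by apply: ccvgM; [exact: ccvg_cst|apply: ccvgJ; exact: commc_cvg].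
    exact: h.
have h4 : (fun N => \sum_(m <- sq N.*2) Re (quad s N a m * conjc (p m))) @ \oo --> nlv / vol.
  apply: (@tannery_cvg _ (fun N m => Re (quad s N a m * conjc (p m))) _ (fun m => M * (Cp * decay m)) _ (fun N => N.*2) _ _ _ _ _ qlim_p_cvg).
  - move=> N m; apply: le_trans (cabs_Re _) _; rewrite cabsM cabsJ.
    apply: le_trans (ler_wpM2r (cabs_ge0 _) (quad_le s0 s1 N m aM)) _.
    by rewrite mulrAC mulrC ler_wpM2l ?M_ge0.
  - by apply: bndZ; [exact: M_ge0|apply: bndZ => //; exact: decay_bnd].
  - move=> m.
    have [h _] : ccvg \oo (fun N => quad s N a m * conjc (p m)) (qlim s a m * conjc (p m)).
      by apply: ccvgM; [exact: (ccvg_qlim s0 s1 m aM)|exact: ccvg_cst].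
    exact: h.
  - by move=> N; rewrite -addnn leq_addr.
have h5 : (fun N => \sum_(m <- sq N.*2) Re (quad s N a m * conjc (p m))) @ \oo -->
    - 2^-1 * (int_box (fun x => rf psic x * rf commc x) / vol).
  rewrite [X in X @ _](_ : _ = fun N => - 2^-1 * \sum_(k <- sq N) Re (psic k * conjc (csum N k))).
    by apply: cvgM; [exact: cvg_cst|exact: h3].
  apply/funext => N; rewrite -!Re_sum -csum_quad; move: (\sum_(k <- _) _) => z.
  by rewrite !ReImE /=; ring.
have e : nlv / vol = - 2^-1 * (int_box (fun x => rf psic x * rf commc x) / vol) by exact: cvg_unique h4 h5.
by rewrite -[LHS](divfK v0) e; field.
Qed.

Lemma nonlinear_rf : nonlinear_value beta (rf a) v1 v2 nlv.
Proof.
exists (rf psic), (rf commc); split; last exact: nlvE.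
- split.
  + by apply/L2P; exact: (rf_sqb psic_hermitian psic_bnd).
  + rewrite /mean_zero int_box_mean (fourier_rf psic_hermitian psic_bnd) /psic a00 mulr0.
    by rewrite mulr0.
  + move=> k k0; rewrite /Lapl /Lam (fourier_rf psic_hermitian psic_bnd) (fourier_rf ha aM) /psic.
    rewrite mulrA; congr (_ * _).
    have fk : 0 < fn k by exact: lt_le_trans ltr01 (fn_ge1 k0).
    rewrite -rmorphN -rmorphM mulrNN /wgt; congr (_%:C).
    rewrite -(@powR_mulrn _ _ 2) ?ltW // -powRD; last by apply/implyP => _; rewrite gt_eqF.
    by congr (_ `^ _); lra.
- by apply/L2P; exact: (rf_sqb commc_hermitian commc_bnd).
- by move=> k; rewrite (fourier_rf commc_hermitian commc_bnd).
Qed.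

End Nonlinear.

(** * Integration in time *)

Section TimeIntegration.
Context {R : realType}.
Local Notation leb := (@lebesgue_measure R).

Lemma bounded_Rintegral_cvg (T B : R) (f_ : nat -> R -> R) (f : R -> R) :
  (forall n, continuous (f_ n)) -> (forall n t, 0 <= t <= T -> `|f_ n t| <= B) ->
  (forall t, 0 <= t <= T -> f_ ^~ t @ \oo --> f t) ->
  leb.-integrable `[0, T] (EFin \o f) /\
  (fun n => \int[leb]_(t in `[0, T]) f_ n t) @ \oo --> \int[leb]_(t in `[0, T]) f t.
Proof.
move=> cf fB ff; pose D : set (measurableTypeR R) := `[0, T]%classic.
have mD : measurable D by exact: measurable_itv.
have mf n : measurable_fun D (f_ n).
  by apply: (measurable_funS measurableT) => //; exact: continuous_measurable_fun.
have mf' : measurable_fun D f.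
  apply: (@measurable_fun_cvg _ _ _ _ f_) => // t; rewrite /D /= in_itv /= => tT; exact: ff.
have fin : (leb D < +oo)%E.
  by rewrite lebesgue_measure_itv /=; case: ifP => // _; rewrite -EFinD ltry.
have fDB n t : D t -> `|f_ n t| <= B by rewrite /D /= in_itv /= => /fB.
have itf n : leb.-integrable D (EFin \o f_ n) by exact: (@bounded_integrable _ _ _ _ D mD fin (f_ n) B (mf n) (fDB n)).
have E1 n : measurable_fun D (EFin \o f_ n) by apply/measurable_EFinP.
have E2 : measurable_fun D (EFin \o f) by apply/measurable_EFinP.
have E3 : {ae leb, forall t, D t -> (EFin \o f_ n) t @[n --> \oo] --> (EFin \o f) t}.
  apply: aeW => t Dt; apply: cvg_EFin; first exact: nearW.
  by apply: ff; move: Dt; rewrite /D /= in_itv.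
have E4 : leb.-integrable D (EFin \o cst B).
  by apply: (@bounded_integrable _ _ _ _ D mD fin (cst B) `|B|).
have E5 : {ae leb, forall t n, D t -> (`|(EFin \o f_ n) t| <= (EFin \o cst B) t)%E}.
  by apply: aeW => t n Dt; rewrite /= lee_fin fDB.
have [h1 _ h2] := dominated_convergence mD E1 E2 E3 E4 E5.
by split=> //; apply: fine_cvg; rewrite fineK //; exact: integrable_fin_num.
Qed.

Lemma FTC_increment (T : R) (F f : R -> R) : 0 < T -> continuous F -> continuous f ->
  (forall t : R, 0 < t -> is_derive t (1 : R) F (f t)) ->
  \int[leb]_(t in `[0, T]) f t = F T - F 0.
Proof.
move=> T0 cF cf dF; rewrite /Rintegral (@continuous_FTC2 _ f F) //.
- exact: continuous_subspaceT.
- split=> [x||].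
  + by rewrite in_itv /= => /andP[x0 _]; case: (dF x x0).
  + by apply: cvg_at_right_filter; exact: cF.
  + by apply: cvg_at_left_filter; exact: cF.
- by move=> x; rewrite in_itv /= => /andP[x0 _]; rewrite derive1E; case: (dF x x0).
Qed.

Lemma is_derive_sum_seq (I : Type) (s : seq I) (F f : I -> R -> R) (t : R) :
  (forall i, is_derive t (1 : R) (F i) (f i t)) ->
  is_derive t (1 : R) (fun t => \sum_(i <- s) F i t) (\sum_(i <- s) f i t).
Proof.
move=> dF; elim: s => [|i s ih].
  by under eq_fun do rewrite big_nil; rewrite big_nil; exact: is_derive_cst.
under eq_fun do rewrite big_cons; rewrite big_cons.
exact: (is_deriveD (dF i) ih).
Qed.

Lemma is_derive_continuous (F : R -> R) (f : R) (t : R) : is_derive t (1 : R) F f -> {for t, continuous F}.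
Proof. by move=> [h _]; apply/differentiable_continuous/derivable1_diffP. Qed.

End TimeIntegration.

(** * The weak formulation *)

Section WeakForm.
Context {R : realType}.
Local Open Scope complex_scope.
Local Notation leb := (@lebesgue_measure R).
Local Notation Re := (@complex.Re R).
Local Notation Im := (@complex.Im R).
Local Notation vol := (@vol R).
Implicit Types (phi : R * (R * R) -> R) (k m : int * int).

Let mB := @measurable_box R.
Let fB := @leb2_box_fin R.

Lemma lipschitz_of_derive (F f : R -> R) (L b : R) :
  (forall x : R, is_derive x (1 : R) F (f x)) -> (forall x, 0 <= x <= b -> `|f x| <= L) ->
  forall u v, 0 <= u <= b -> 0 <= v <= b -> `|F u - F v| <= L * `|u - v|.
Proof.
move=> dF fL.
have key u v : 0 <= u <= b -> 0 <= v <= b -> u <= v -> `|F u - F v| <= L * `|u - v|.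
  move=> /andP[u0 ub] /andP[v0 vb] uv.
  have cF : {within `[u, v], continuous F}.
    by apply: continuous_subspaceT => x; exact: is_derive_continuous (dF x).
  have [c] := MVT_segment uv (fun x _ => dF x) cF.
  rewrite in_itv /= => /andP[uc cv] e; rewrite distrC e normrM (distrC u v).
  by apply: ler_wpM2r => //; apply: fL; rewrite (le_trans u0 uc) (le_trans cv vb).
move=> u v hu hv; have [uv|/ltW vu] := leP u v; first exact: key.
by rewrite distrC (distrC u v); exact: key.
Qed.

(** Parseval's formula in [rf_parseval] concerns the representative [rf], whereas [h] is arbitrary
    here; the uniform convergence of the Fourier series of [phi] at time 0 takes its place. *)
Lemma initial_parseval phi (h : R * R -> R) : periodic_smooth phi -> sqb h ->
  (fun N => vol * \sum_(k <- sq N) Re (fourier (at_time phi 0) k * conjc (fourier h k))) @ \oo -->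
  int_box (fun x => at_time phi 0 x * h x).
Proof.
move=> sp hh; have [sm p1 p2] := sp.
have [C1 hC1] := continuous_slab_bounded 0 0 (periodic_smooth_continuous (periodic_smooth_d1 sp)).
have [C2 hC2] := continuous_slab_bounded 0 0 (periodic_smooth_continuous (periodic_smooth_d2 sp)).
have [C C0 hC] := fourier_decay 0 0 sp.
have z0 : 0 <= (0 : R) <= 0 by apply/andP; split.
apply: (@inversion_parseval _ _ (`|C1| + `|C2|) (fun k => C * decay k) (C * 25)) => //.
- exact: at_time_continuous.
- move=> u v w hu hv hw.
  apply: (@lipschitz_of_derive (fun u => phi (0, (u, w))) (fun u => d1 phi (0, (u, w))) _ (2 * pi)) => //.
    by move=> x; exact: is_derive_d1.
  move=> x hx; apply: le_trans (hC1 0 (x, w) z0 _) _; first by split; rewrite /= in_itv.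
  by have := ler_norm C1; have := normr_ge0 C2; lra.
- move=> u v w hu hv hw.
  apply: (@lipschitz_of_derive (fun u => phi (0, (w, u))) (fun u => d2 phi (0, (w, u))) _ (2 * pi)) => //.
    by move=> x; exact: is_derive_d2.
  move=> x hx; apply: le_trans (hC2 0 (w, x) z0 _) _; first by split; rewrite /= in_itv.
  by have := ler_norm C2; have := normr_ge0 C1; lra.
- by move=> w; rewrite /at_time -[X in (X, w)]add0r p1.
- by move=> w; rewrite /at_time -[X in (w, X)]add0r p2.
- by move=> k; have [] := hC 0 k z0.
- by apply: bndZ => //; exact: decay_bnd.
Qed.

Variables (beta : R) (a : R -> int * int -> R[i]) (M : R).
Local Notation s := (2 - beta).
Hypothesis s0 : 0 <= s.
Hypothesis s1 : s <= 1.
Hypothesis ha : forall t, hermitian (a t).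
Hypothesis aM : forall t, bnd (nsq \o a t) M.
Hypothesis a00 : forall t, a t 0 = 0.
Hypothesis ca : forall k, continuous (fun t => Re (a t k)) /\ continuous (fun t => Im (a t k)).
Hypothesis cq : forall k, continuous (fun t => Re (qlim s (a t) k)) /\ continuous (fun t => Im (qlim s (a t) k)).
Hypothesis da : forall k (t : R), 0 < t ->
  is_derive t (1 : R) (fun t => Re (a t k)) (Re (qlim s (a t) k)) /\
  is_derive t (1 : R) (fun t => Im (a t k)) (Im (qlim s (a t) k)).

Lemma Re_mul_conj (z w : R[i]) : Re (z * conjc w) = Re z * Re w + Im z * Im w.
Proof. by rewrite !ReImE; ring. Qed.

(** On a finite square the integrand is the time derivative of the pairing [H_ N] of the
    coefficients of theta and [phi]. Its integral is minus the initial pairing, because [phi]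
    vanishes at T, and dominated convergence in time removes the truncation. *)
Lemma weak_form phi (T : R) (theta0 : R * R -> R) : 0 < T -> periodic_smooth phi ->
  (forall x, phi (T, x) = 0) -> sqb theta0 -> (forall k, a 0 k = fourier theta0 k) ->
  let Nt := fun t => nlv beta (a t) (fourier (at_time phi t)) in
  [/\ forall t, 0 <= t <= T -> nonlinear_value beta (rf (a t)) (at_time (d1 phi) t) (at_time (d2 phi) t) (Nt t),
      leb.-integrable `[0, T] (EFin \o Nt) &
      \int[leb]_(t in `[0, T]) (int_box (fun x => rf (a t) x * at_time (dt phi) t x) + Nt t) =
      - int_box (fun x => theta0 x * at_time phi 0 x)].
Proof.
move=> T0 sp phiT hth a0 Nt; have v0 := @vol_gt0 R.
have M0 : 0 <= M by apply: (M_ge0 (aM 0)).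
have spt := periodic_smooth_dt sp.
have [Cp Cp0 hp] := fourier_decay 0 T sp.
have [Cq Cq0 hq] := fourier_decay 0 T spt.
pose p t := fourier (at_time phi t); pose q t := fourier (at_time (dt phi) t).
have sqp (psi : R * (R * R) -> R) t : periodic_smooth psi -> sqb (at_time psi t).
  by move=> h; apply: continuous_sqb; exact: at_time_continuous.
have cpsi (psi : R * (R * R) -> R) k : periodic_smooth psi ->
    continuous (fun t => Re (fourier (at_time psi t) k)) /\ continuous (fun t => Im (fourier (at_time psi t) k)).
  move=> h; split=> t; have [h1 h2] := is_derive_fourier k t h.
    exact: is_derive_continuous h1.
  exact: is_derive_continuous h2.
pose n_ N t := vol * \sum_(k <- sq N) Re (qlim s (a t) k * conjc (p t k)).
pose m_ N t := vol * \sum_(k <- sq N) Re (a t k * conjc (q t k)).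
pose H_ N t := vol * \sum_(k <- sq N) Re (a t k * conjc (p t k)).
have csum (f g : R -> int * int -> R[i]) N :
    (forall k, continuous (fun t => Re (f t k)) /\ continuous (fun t => Im (f t k))) ->
    (forall k, continuous (fun t => Re (g t k)) /\ continuous (fun t => Im (g t k))) ->
    continuous (fun t => vol * \sum_(k <- sq N) Re (f t k * conjc (g t k))).
  move=> hf hg t; apply: cvgM; first exact: cvg_cst.
  apply: (@cvg_sumr _ _ _ _ _ _ (fun t k => Re (f t k * conjc (g t k)))) => k.
  under eq_fun do rewrite Re_mul_conj; rewrite Re_mul_conj.
  have [f1 f2] := hf k; have [g1 g2] := hg k.
  by apply: cvgD; apply: cvgM; [exact: f1|exact: g1|exact: f2|exact: g2].
have cn N : continuous (n_ N) by apply: csum => // k; exact: cpsi.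
have cm N : continuous (m_ N) by apply: csum => // k; exact: cpsi.
have cH N : continuous (H_ N) by apply: csum => // k; exact: cpsi.
have bn N t : 0 <= t <= T -> `|n_ N t| <= vol * (M * (Cp * 25)).
  move=> tT; rewrite normrM (gtr0_norm v0) ler_wpM2l ?(ltW v0) //.
  apply: le_trans (ler_norm_sum _ _ _) _.
  apply: le_trans (_ : \sum_(k <- sq N) M * (Cp * decay k) <= _).
    by apply: ler_sum => k _; apply: (qlim_p_le s0 s1 (aM t)) => l; have [] := hp t l tT.
  by apply: (bndZ M0 (bndZ Cp0 decay_bnd)).
have bm N t : 0 <= t <= T -> `|m_ N t| <= vol * ((1 + M) * (Cq * 25)).
  move=> tT; rewrite normrM (gtr0_norm v0) ler_wpM2l ?(ltW v0) //.
  apply: le_trans (ler_norm_sum _ _ _) _.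
  apply: le_trans (_ : \sum_(k <- sq N) (1 + M) * (Cq * decay k) <= _).
    apply: ler_sum => k _; apply: le_trans (cabs_Re _) _; rewrite cabsM cabsJ.
    apply: ler_pM; [exact: cabs_ge0|exact: cabs_ge0|exact: (a_le (aM t))|].
    by have [] := hq t k tT.
  by apply: (bndZ _ (bndZ Cq0 decay_bnd)); rewrite addr_ge0.
have ln t : 0 <= t <= T -> n_ ^~ t @ \oo --> Nt t.
  move=> tT; have -> : Nt t = vol * (Nt t / vol) by rewrite mulrC divfK // gt_eqF.
  apply: cvgM; first exact: cvg_cst.
  by apply: (@qlim_p_cvg _ _ s0 s1 _ _ (aM t) _ Cp) => // k; have [] := hp t k tT.
have lm t : m_ ^~ t @ \oo --> int_box (fun x => rf (a t) x * at_time (dt phi) t x).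
  exact: (rf_parseval (ha t) (aM t) (sqp _ t spt)).
have [iN _] := bounded_Rintegral_cvg cn bn ln.
have [_ I1] : leb.-integrable `[0, T] (EFin \o (fun t => int_box (fun x => rf (a t) x * at_time (dt phi) t x) + Nt t)) /\
    (fun N => \int[leb]_(t in `[0, T]) (m_ N t + n_ N t)) @ \oo -->
    \int[leb]_(t in `[0, T]) (int_box (fun x => rf (a t) x * at_time (dt phi) t x) + Nt t).
  apply: (@bounded_Rintegral_cvg _ _ (vol * ((1 + M) * (Cq * 25)) + vol * (M * (Cp * 25)))).
  - by move=> N t; apply: cvgD; [exact: cm|exact: cn].
  - by move=> N t tT; apply: le_trans (ler_normD _ _) _; apply: lerD; [exact: bm|exact: bn].
  - by move=> t tT; apply: cvgD; [exact: lm|exact: ln].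
split=> //.
  move=> t tT; apply: (@nonlinear_rf _ _ s0 s1 _ _ (ha t) (aM t) (a00 t) _ _ _ Cp) => //.
  - exact: fourier_hermitian (sqp _ t sp).
  - exact: at_time_continuous (periodic_smooth_d1 sp).
  - exact: at_time_continuous (periodic_smooth_d2 sp).
  - by move=> k; exact: fourier_dx1.
  - by move=> k; exact: fourier_dx2.
  - by move=> k; have [] := hp t k tT.
have I2 N : \int[leb]_(t in `[0, T]) (m_ N t + n_ N t) = H_ N T - H_ N 0.
  have cmn : continuous (fun t => m_ N t + n_ N t) by move=> t; apply: cvgD; [exact: cm|exact: cn].
  apply: (FTC_increment T0 (cH N) cmn) => t t0; rewrite /H_ /m_ /n_ -mulrDr -big_split /=.
  apply: is_deriveZ; apply: (@is_derive_sum_seq _ _ _ (fun k t => Re (a t k * conjc (p t k)))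
     (fun k t => Re (a t k * conjc (q t k)) + Re (qlim s (a t) k * conjc (p t k)))) => k.
  have [d1 d2] := da k t0; have [d3 d4] := is_derive_fourier k t sp.
  under eq_fun do rewrite Re_mul_conj; rewrite !Re_mul_conj.
  have := is_deriveD (is_deriveM d1 d3) (is_deriveM d2 d4).
  by move/is_derive_eq; apply; rewrite /GRing.scale /= /p /q; ring.
have HT N : H_ N T = 0.
  rewrite /H_ big1 ?mulr0 // => k _.
  have -> : p T k = 0.
    rewrite /p (@eq_fourier _ _ (fun=> 0 * 1)); last by move=> x; rewrite /at_time phiT mul0r.
    by rewrite fourierZ ?mul0r //; exact: (sqi_cst mB fB 1).
  by rewrite conjc0 mulr0.
have I3 : (fun N => \int[leb]_(t in `[0, T]) (m_ N t + n_ N t)) @ \oo --> - int_box (fun x => theta0 x * at_time phi 0 x).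
  have -> : (fun N => \int[leb]_(t in `[0, T]) (m_ N t + n_ N t)) =
      (fun N => - (vol * \sum_(k <- sq N) Re (fourier (at_time phi 0) k * conjc (fourier theta0 k)))).
    apply/funext => N; rewrite I2 HT sub0r /H_; congr (- (_ * _)); apply: eq_bigr => k _.
    by rewrite a0 !Re_mul_conj /p; ring.
  apply: cvgN; rewrite (@eq_int_box _ _ (fun x => at_time phi 0 x * theta0 x)); last by move=> x; rewrite mulrC.
  exact: initial_parseval.
exact: (cvg_unique (@norm_hausdorff _ _) I1 I3).
Qed.

End WeakForm.

Theorem theorem1p6 (R : realType) (beta : R) (theta0 : R * R -> R)
    (hbeta1 : 1 < beta) (hbeta2 : beta <= 2)
    (htheta0 : L2 theta0) (hmean : mean_zero theta0) :
  exists theta : R * (R * R) -> R,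
    forall T : R, 0 < T -> weak_solution beta T theta0 theta.
Proof.
have s0 : 0 <= 2 - beta by lra.
have s1 : 2 - beta <= 1 by lra.
have sth : sqb theta0 by apply/L2P.
have a00 : fourier theta0 0 = 0.
  apply: complexP; first by have := int_box_mean theta0; rewrite hmean => /esym/eqP; rewrite mulf_eq0 (gt_eqF (@vol_gt0 R)) => /eqP.
  have := fourier_hermitian sth 0; rewrite oppr0 => /(congr1 (@complex.Im R)); rewrite ImJ /=; lra.
have [a [a0 /all_and3[aM ha az] ca cq da]] := galerkin_solution s0 s1 (fourier_hermitian sth) (bessel sth) a00.
set M := (_ + 1) in aM.
(* The coefficients are defined for all times, so one function serves every T. *)
exists (fun z => rf (a z.1) z.2) => T T0; split.
- split.
    apply: (rf_measurable (M := M)) => //.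
    by apply: measurableX; [exact: measurable_itv|exact: measurable_box].
  exists (Num.sqrt (vol * M)); apply: aeW => t _.
  apply: norm2_le; first exact: (rf_sqb (ha t) (aM t)).
  exact: (int_box_rf_sqr (ha t) (aM t)).
- apply: aeW => t _; rewrite /mean_zero int_box_mean.
  by rewrite (fourier_rf (ha t) (aM t)) az mulr0.
- move=> phi [sm p1 p2 [T' T'T phi0]].
  have sp : periodic_smooth phi by split.
  have phiT x : phi (T, x) = 0 by apply: phi0; exact: ltW.
  have [h1 h2 h3] := weak_form s0 s1 ha aM az ca cq da T0 sp phiT sth a0.
  exists (fun t => nlv beta (a t) (fourier (at_time phi t))); split=> //.
  by apply: aeW => t tT; apply: h1; move: tT; rewrite in_itv.
Qed.
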